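(* Let $(x_k)_{k\ge 0}$ be a uniformly ergodic Markov chain on a Borel space $\mathcal X$ with transition kernel $P$, unique stationary distribution $\pi$, and $x_0\sim\pi$. Let $A:\mathcal X\to\mathbb R^{d\times d}$ and $b:\mathcal X\to\mathbb R^d$ satisfy $A_{\max}:=\sup_x\|A(x)\|\le 1$ and $b_{\max}:=\sup_x\|b(x)\|<\infty$, and suppose $\bar A:=\mathbb E_{\pi}[A(x)]$ is Hurwitz. For a stepsize $\beta$ let $\theta^{(\beta)}_{k+1}=\theta^{(\beta)}_k+\beta\big(A(x_k)\theta^{(\beta)}_k+b(x_k)\big)$, $k\ge0$, and $\bar\theta^{(\beta)}_{k_0,k}:=\frac1{k-k_0}\sum_{t=k_0}^{k-1}\theta^{(\beta)}_t$. Let $\theta^*$ be the solution of $\bar A\theta+\bar b=0$, $\bar b:=\mathbb E_\pi[b(x)]$. Suppose $\beta\tau_\beta<\frac{0.05}{95\gamma_{\max}}$ holds for both $\beta=\alpha$ and $\beta=2\alpha$, and define the Richardson--Romberg extrapolated iterates, computed with the same data stream $(x_k)_{k\ge0}$, $$\widetilde\theta^{(\alpha)}_{k_0,k}=2\bar\theta^{(\alpha)}_{k_0,k}-\bar\theta^{(2\alpha)}_{k_0,k}.$$ Then for all $k_0\ge\frac{4\gamma_{\max}}{\alpha}\log\big(\frac1{\alpha\tau_\alpha}\big)$ and $k\ge k_0+\tau_\alpha$: $$\mathbb E\big[\widetilde\theta^{(\alpha)}_{k_0,k}\big]-\theta^*=\mathcal O(\alpha^2)+\mathcal O\Big(\frac1{\alpha(k-k_0)}\exp\Big(-\frac{\alpha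 k_0}{4\gamma_{\max}}\Big)\Big),$$ $$\mathbb E\Big[\big(\widetilde\theta^{(\alpha)}_{k_0,k}-\theta^*\big)\big(\widetilde\theta^{(\alpha)}_{k_0,k}-\theta^*\big)^\top\Big]=\mathcal O(\alpha^4)+\mathcal O\Big(\frac{\tau_\alpha}{k-k_0}\Big)+\mathcal O\Big(\frac1{\alpha(k-k_0)^2}\exp\Big(-\frac{\alpha k_0}{4\gamma_{\max}}\Big)\Big).$$
   Context: Norms: $\|\cdot\|$ is the Euclidean norm for vectors and the spectral norm for matrices. Chain and initialization: uniformly ergodic means $\sup_{x\in\mathcal X}\|P^n(x,\cdot)-\pi\|_{TV}\to0$ as $n\to\infty$. $\mathcal X$ is a (standard) Borel space; $A,b$ are deterministic measurable functions. The initial iterates may depend on $x_0$ but are independent of $(x_k)_{k\ge1}$ given $x_0$, and have finite second moments; their laws are fixed, not depending on $\alpha$. Lyapunov constants: Hurwitz means all eigenvalues have strictly negative real parts. $\Gamma$ is the symmetric positive definite matrix with $\bar A^\top\Gamma+\Gamma\bar A=-I$; $\gamma_{\max}$ is its maximum eigenvalue. Mixing time: for $\epsilon\in(0,1)$, $\tau_\epsilon$ is the smallest number $\tau_\epsilon\ge1$ such that for all $x\in\mathcal X$ and all $k\ge\tau_\epsilon$: $\|\mathbb E[A(x_k)\mid x_0=x]-\bar A\|\le\epsilon A_{\max}$ and $\|\mathbb E[b(x_k)\mid x_0=x]-\bar b\|\le\epsilon b_{\max}$. ($\alpha,2\alpha\in(0,1)$.) Conventions: $k_0,k$ are integers. $h=\mathcal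 O(f)$ means $\|h\|\le c\,f$ with $c$ depending only on $A,b,P$ and the laws of the initial iterates, and independent of $\alpha,k_0,k$. *)

(* Defs.v *)
From HB Require Import structures.
From mathcomp Require Import all_boot all_order all_algebra.
From mathcomp Require Import all_classical all_reals all_analysis.
From mathcomp Require Import complex.

Set Implicit Arguments.
Unset Strict Implicit.
Unset Printing Implicit Defensive.
Import Order.TTheory GRing.Theory Num.Theory.
Import numFieldNormedType.Exports.
Local Open Scope classical_set_scope.
Local Open Scope ring_scope.

(* The norm that MathComp-Analysis puts on matrices is the max norm, hence
   the Euclidean and spectral norms below. *)
Definition l2norm (R : realType) (d : nat) (v : 'cV[R]_d) : R :=
  Num.sqrt (\sum_(i < d) v i 0 ^+ 2).

Definition opnorm (R : realType) (m n : nat) (M : 'M[R]_(m, n)) : R :=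
  sup [set l2norm (M *m v) | v in [set v : 'cV[R]_n | l2norm v <= 1]].

Definition hurwitz (R : realType) (d : nat) (M : 'M[R]_d) : Prop :=
  forall z : R[i],
    eigenvalue (map_mx (real_complex R) M) z -> complex.Re z < 0.

Definition posdefmx (R : realType) (d : nat) (M : 'M[R]_d) : Prop :=
  forall v : 'cV[R]_d, v != 0 -> 0 < (v^T *m M *m v) 0 0.

Definition max_eigenvalue (R : realType) (d : nat) (M : 'M[R]_d) (g : R) :
    Prop :=
  eigenvalue M g /\ forall a, eigenvalue M a -> a <= g.

Definition measurable_mx (R : realType) (dT : measure_display)
    (T : measurableType dT) (m n : nat) (F : T -> 'M[R]_(m, n)) : Prop :=
  forall i j, measurable_fun [set: T] (fun x => F x i j).

Definition mx_mean (R : realType) (dT : measure_display)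
    (T : measurableType dT) (mu : {measure set T -> \bar R}) (m n : nat)
    (F : T -> 'M[R]_(m, n)) : 'M[R]_(m, n) :=
  \matrix_(i, j) \int[mu]_x F x i j.

(* Borel spaces in the sense of Kallenberg and Klenke: X is isomorphic, as a
   measurable space, to a Borel subset of the real line.  The image of f is
   Borel by the last clause, taken at B = setT. *)
Definition borel_space (R : realType) (dX : measure_display)
    (X : measurableType dX) : Prop :=
  exists f : X -> R,
    [/\ injective f, measurable_fun [set: X] f &
        forall B : set X, measurable B -> measurable (f @` B)].

Section kernels.
Context (R : realType) (dX : measure_display) (X : measurableType dX).
Implicit Types (P : R.-pker X ~> X) (mu nu : {measure set X -> \bar R}).

Fixpoint kernel_iter P (n : nat) : R.-spker X ~> X :=
  if n is n'.+1 then mkcomp_noparam (kernel_iter P n') P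
  else kdirac (@measurable_id _ X setT).

(* Some authors take twice this quantity; the choice does not affect
   uniform_ergodicity. *)
Definition tv_dist mu nu : \bar R :=
  ereal_sup [set `|mu B - nu B|%E | B in measurable].

Definition uniform_ergodicity P mu : Prop :=
  (fun n => ereal_sup (range (fun x => tv_dist (kernel_iter P n x) mu)))
    @ \oo --> 0%E.

Definition stationary P mu : Prop :=
  forall B : set X, measurable B -> (\int[mu]_x P x B = mu B)%E.

Definition unique_stationary P (mu : probability X R) : Prop :=
  stationary P mu /\
  forall nu : probability X R, stationary P nu ->
    forall B : set X, measurable B -> nu B = mu B.

(* Supremum over all x of the norm of F x, in the extended reals: there the
   supremum of an unbounded family is +oo, whereas sup in R returns 0. *)
Definition sup_norm (m n : nat) (N : 'M[R]_(m, n) -> R)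
    (F : X -> 'M[R]_(m, n)) : \bar R :=
  ereal_sup (range (fun x => (N (F x))%:E)).

(* mx_mean (kernel_iter P k x) F is E[F(x_k) | x_0 = x]. *)
Definition mixed_from P mu (d : nat) (A : X -> 'M[R]_d) (b : X -> 'cV[R]_d)
    (eps : R) (t : nat) : Prop :=
  forall (x : X) (k : nat), (t <= k)%N ->
    ((opnorm (mx_mean (kernel_iter P k x) A - mx_mean mu A))%:E
       <= eps%:E * sup_norm (@opnorm R d d) A)%E /\
    ((l2norm (mx_mean (kernel_iter P k x) b - mx_mean mu b))%:E
       <= eps%:E * sup_norm (@l2norm R d) b)%E.

Definition is_mixing_time P mu (d : nat) (A : X -> 'M[R]_d)
    (b : X -> 'cV[R]_d) (eps : R) (t : nat) : Prop :=
  [/\ (1 <= t)%N, mixed_from P mu A b eps t &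
      forall s, (1 <= s)%N -> mixed_from P mu A b eps s -> (t <= s)%N].

(* The default value 1 is never used when the chain is uniformly ergodic,
   A and b are bounded and eps > 0: a mixing time then exists. *)
Definition mixing_time P mu (d : nat) (A : X -> 'M[R]_d)
    (b : X -> 'cV[R]_d) (eps : R) : nat :=
  xget 1%N [set t | is_mixing_time P mu A b eps t].

End kernels.

Section chain.
Context (R : realType) (dX : measure_display) (X : measurableType dX).
Context (dO : measure_display) (Omega : measurableType dO).
Variable Pr : probability Omega R.

(* P(x_{n+1} \in B | x_0, ..., x_n) = P(x_n, B) almost surely, integrated
   over the events C of the sigma-algebra generated by x_0, ..., x_n. *)
Definition markov_chain (P : R.-pker X ~> X) (x : nat -> {RV Pr >-> X}) :
    Prop :=
  forall (n : nat) (C : set Omega) (B : set X),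
    g_sigma_preimage (fun i : 'I_n.+1 => x i : Omega -> X) C ->
    measurable B ->
    (Pr (C `&` x n.+1 @^-1` B) = \int[Pr]_(w in C) P (x n w) B)%E.

(* h is a version of y |-> Pr(E | Y = y). *)
Definition is_cond_prob (Y : {RV Pr >-> X}) (E : set Omega) (h : X -> R) :
    Prop :=
  measurable_fun [set: X] h /\
  forall B : set X, measurable B ->
    (\int[Pr]_(w in Y @^-1` B) (h (Y w))%:E = Pr (E `&` Y @^-1` B))%E.

(* Independence of the families of events F and G given Y.  Versions of the
   conditional probabilities exist and are almost surely unique, so that
   quantifying over all of them is the usual definition. *)
Definition cond_independent (Y : {RV Pr >-> X}) (F G : set_system Omega) :
    Prop :=
  forall (E1 E2 : set Omega) (h1 h2 : X -> R),
    F E1 -> G E2 -> is_cond_prob Y E1 h1 -> is_cond_prob Y E2 h2 ->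
    is_cond_prob Y (E1 `&` E2) (fun y => h1 y * h2 y).

Definition sigma_vec (d : nat) (u : Omega -> 'cV[R]_d) : set_system Omega :=
  g_sigma_preimage (fun (i : 'I_d) (w : Omega) => u w i 0).

Definition sigma_future (x : nat -> {RV Pr >-> X}) : set_system Omega :=
  <<s \bigcup_(k in [set k | (1 <= k)%N])
        preimage_set_system [set: Omega] (x k) measurable >>.

(* Laws on R^d are carried by d-tuples, which have a product sigma-algebra in
   the library while column vectors have none. *)
Definition has_law (d : nat) (u : Omega -> 'cV[R]_d)
    (mu : probability (d.-tuple R) R) : Prop :=
  forall B : set (d.-tuple R), measurable B ->
    Pr [set w | B [tuple u w i 0 | i < d]] = mu B.

Definition admissible_init (x : nat -> {RV Pr >-> X}) (d : nat)
    (mu : probability (d.-tuple R) R) (u : Omega -> 'cV[R]_d) : Prop :=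
  [/\ measurable_mx u, has_law u mu &
      cond_independent (x 0%N) (sigma_vec u) (sigma_future x)].

End chain.

Definition finite_second_moment (R : realType) (d : nat)
    (mu : probability (d.-tuple R) R) : Prop :=
  (\int[mu]_t ((l2norm (\col_(i < d) tnth t i)) ^+ 2)%:E < +oo)%E.

Section iterates.
Context (R : realType) (X Omega : Type) (d : nat).
Variables (A : X -> 'M[R]_d) (b : X -> 'cV[R]_d) (x : nat -> Omega -> X).

Fixpoint lsa (beta : R) (u : Omega -> 'cV[R]_d) (k : nat) (w : Omega) :
    'cV[R]_d :=
  if k is k'.+1 then
    lsa beta u k' w +
      beta *: (A (x k' w) *m lsa beta u k' w + b (x k' w))
  else u w.

Definition lsa_avg (beta : R) (u : Omega -> 'cV[R]_d) (k0 k : nat)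
    (w : Omega) : 'cV[R]_d :=
  (k - k0)%N%:R^-1 *: \sum_(k0 <= t < k) lsa beta u t w.

(* u and v are the initial iterates for the stepsizes alpha and 2 alpha. *)
Definition rr_extrapolate (alpha : R) (u v : Omega -> 'cV[R]_d)
    (k0 k : nat) (w : Omega) : 'cV[R]_d :=
  2 *: lsa_avg alpha u k0 k w - lsa_avg (2 * alpha) v k0 k w.

End iterates.

(* Main.v *)
(* With e_t = theta_t - theta_star and g = A theta_star + b, which has mean 0,
   e_(t+1) = e_t + beta (A(x_t) e_t + g(x_t)).  Uniform ergodicity makes the
   transition operator contract geometrically on bounded centered functions, so
   for zeta depending on the past up to time s the functionals
   f |-> E[zeta f(x_t) e_t] form a slow/fast linear recursion: the slow part
   f = 1 is driven by the mean matrix of A and the fast part, on centered f, is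
   of order beta.  For small beta this gives, with one vector B for all beta,
   E[zeta e_t] = beta E[zeta] B + O(beta^2) + exponentially small terms.
   Taking zeta = 1, the bias of the averages is beta B + O(beta^2), and the
   extrapolation cancels beta B; taking zeta = e_s - E[e_s], the covariances
   decay like (1 - c beta)^(t - s), whence the variance of the averages is
   O(1/n).  Stepsizes bounded away from 0 only need a bound on E|e_t|^2
   uniform in t, obtained from the drift of the Lyapunov function conditioned
   tau steps back, where A is nearly averaged. *)

(* The constant of the error terms may depend neither on the probability space nor on the stepsize.
   Hence the estimates are proved for abstract linear functionals of bounded functions on the state
   space and for real sequences, with constants fixed before the stepsize; a data stream enters only
   through the recursions that its moments satisfy. These recursions need a Markov property whose
   past contains the initial iterate, although this iterate may depend on x_0; deriving it from
   conditional independence given x_0 is the measure-theoretic core. The runs with stepsizes alpha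
   and 2 alpha are never studied jointly: the mean is linear, and (2 p - q)^2 <= 8 p^2 + 2 q^2
   separates the second moments. The exponents come from the rates, with g for gmax. The Lyapunov
   norm contracts at 1 - beta / (3 g), and the gap to 1 - beta / (4 g) pays for the exchange between
   slow and fast parts. Second moments decay at 1 - beta / (2 g), so that after k0 steps their
   exponential is the square of that of the means. *)
Require Import Defs.
From HB Require Import structures.
From mathcomp Require Import all_boot all_order all_algebra.
From mathcomp Require Import all_classical all_reals all_analysis.
From mathcomp Require Import measurable_realfun ring lra.

Set Implicit Arguments.
Unset Strict Implicit.
Unset Printing Implicit Defensive.
Import Order.TTheory GRing.Theory Num.Theory.
Import numFieldNormedType.Exports.
Local Open Scope classical_set_scope.
Local Open Scope ring_scope.

(** * Bounded and integrable functions *)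

Section bounded_measurable.
Context (R : realType) (dT : measure_display) (T : measurableType dT).

Definition bmeas (f : T -> R) (M : R) : Prop :=
  measurable_fun [set: T] f /\ forall x, `|f x| <= M.

Lemma bmeas_ge0 f M : bmeas f M -> 0 <= M.
Proof. by case=> _ /(_ point); apply: le_trans. Qed.

Lemma bmeasW f M N : M <= N -> bmeas f M -> bmeas f N.
Proof. by move=> MN [mf fM]; split=> // x; apply: le_trans MN. Qed.

Lemma bmeas_cst c : bmeas (fun=> c) `|c|.
Proof. by split. Qed.

Lemma bmeasD f g M N : bmeas f M -> bmeas g N ->
  bmeas (fun x => f x + g x) (M + N).
Proof.
move=> [mf fM] [mg gN]; split; first exact: measurable_funD.
by move=> x; apply: le_trans (ler_normD _ _) _; exact: lerD.
Qed.

Lemma bmeasM f g M N : bmeas f M -> bmeas g N ->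
  bmeas (fun x => f x * g x) (M * N).
Proof.
move=> [mf fM] [mg gN]; split; first exact: measurable_funM.
by move=> x; rewrite normrM ler_pM.
Qed.

Lemma bmeasZ c f M : bmeas f M -> bmeas (fun x => c * f x) (`|c| * M).
Proof. by move=> /(bmeasM (bmeas_cst c)). Qed.

Lemma bmeasB f g M N : bmeas f M -> bmeas g N ->
  bmeas (fun x => f x - g x) (M + N).
Proof.
move=> [mf fM] [mg gN]; split; first exact: measurable_funB.
by move=> x; apply: le_trans (ler_normB _ _) _; exact: lerD.
Qed.

Lemma bmeas_indic (B : set T) : measurable B -> bmeas (\1_B : T -> R) 1.
Proof.
move=> mB; split; first exact: measurable_indic.
by move=> x; rewrite indicE; case: (x \in B); rewrite /= ?normr0 ?normr1.
Qed.

(** Restricted to bounded measurable functions: the integrals to which it is applied are additive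
    there, but not on arbitrary functions. *)
Definition linear_on_bmeas (phi : (T -> R) -> R) : Prop :=
  forall f g a M N, bmeas f M -> bmeas g N ->
    phi (fun x => f x + a * g x) = phi f + a * phi g.

(** A function with values in [0, 1] is a series of indicators with weights 2^-k, which sum to 1, so
    the bound on indicators passes to it without loss. The constant c serves only to make the
    remainder after n digits vanish. *)
Lemma unit_functional_le (phi : (T -> R) -> R) (c delta : R) :
  linear_on_bmeas phi ->
  (forall f M, bmeas f M -> `|phi f| <= c * M) ->
  (forall B, measurable B -> `|phi \1_B| <= delta) ->
  forall f : T -> R, measurable_fun [set: T] f ->
  (forall x, 0 <= f x <= 1) ->
  `|phi f| <= delta.
Proof.
move=> lin bnd ind.
have c0 : 0 <= c.
  have := bnd _ _ (bmeas_cst 1); rewrite normr1 mulr1.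
  by apply: le_trans.
(* binary expansion: f = 1/2 1_{f >= 1/2} + 1/2 f' with f' again in [0, 1] *)
have key n : forall f : T -> R, measurable_fun [set: T] f -> (forall x, 0 <= f x <= 1) ->
    `|phi f| <= delta + c / 2 ^+ n.
  elim: n => [|n ih] f mf f01.
    have d0 : 0 <= delta by apply: le_trans (ind _ (@measurable0 _ _)).
    rewrite expr0 divr1; apply: le_trans (_ : c * 1 <= _); last by lra.
    by apply: bnd; split=> // x; have /andP[? ?] := f01 x; rewrite ger0_norm.
  pose B := f @^-1` `[2^-1, +oo[%classic.
  have mB : measurable B by rewrite -[B]setTI; exact: mf.
  pose f' := fun x => 2 * f x + (-1) * \1_B x.
  have mf' : measurable_fun [set: T] f'.
    by apply: measurable_funD; apply: measurable_funM => //;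
      exact: measurable_indic.
  have f'01 x : 0 <= f' x <= 1.
    have /andP[f0 f1] := f01 x; rewrite /f' indicE.
    have [xB|xB] := boolP (x \in B).
      have := set_mem xB; rewrite /B /= in_itv /= andbT => h.
      by apply/andP; split; lra.
    have : ~~ (2^-1 <= f x).
      apply: contra xB => h; apply: mem_set.
      by rewrite /B /= in_itv /= andbT.
    by rewrite -ltNge => h; apply/andP; split; rewrite mulr0 addr0; lra.
  have bf' : bmeas f' 1.
    by split=> // x; have /andP[? ?] := f'01 x; rewrite ger0_norm.
  have -> : phi f = 2^-1 * phi f' + 2^-1 * phi \1_B.
    have b1 := bmeas_indic mB.
    have bf : bmeas (fun x => 2^-1 * f' x) (`|2^-1| * 1) by exact: bmeasZ.
    have -> : f = (fun x => (fun x => 2^-1 * f' x) x + 2^-1 * \1_B x).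
      by apply/funext => x; rewrite /f'; lra.
    rewrite (lin _ _ _ _ _ bf b1); congr (_ + _).
    have b0 := bmeas_cst 0.
    have -> : (fun x => 2^-1 * f' x) = (fun x => (fun=> 0) x + 2^-1 * f' x).
      by apply/funext => x; rewrite add0r.
    rewrite (lin _ _ _ _ _ b0 bf').
    have := bnd _ _ b0; rewrite normr0 mulr0 normr_le0 => /eqP ->.
    by rewrite add0r.
  have := ih _ mf' f'01; have := ind _ mB.
  have := ler_normD (2^-1 * phi f') (2^-1 * phi \1_B).
  rewrite !normrM (@ger0_norm _ 2^-1) //.
  have -> : c / 2 ^+ n.+1 = 2^-1 * (c / 2 ^+ n) by rewrite exprS invfM; ring.
  by move: (c / _) => t h1 h2 h3; lra.
move=> f mf f01; apply/ler_addgt0Pr => e e0.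
have [n cn] : exists n, c / 2 ^+ n <= e.
  have ce : 0 <= c / e by rewrite divr_ge0 // ltW.
  exists (Num.truncn (c / e)).+1.
  rewrite ler_pdivrMr ?exprn_gt0 // mulrC -ler_pdivrMr //.
  apply: le_trans (ltW (truncnS_gt _)) _.
  by rewrite -natrX ler_nat ltnW // ltn_expl.
by apply: le_trans (key n f mf f01) _; rewrite lerD2l.
Qed.

(** Affine rescaling f = - M + 2 M g with g in [0, 1]: the constant contributes M delta and g
    contributes 2 M delta. Used with delta = 0, this is how identities known on sets are extended to
    functions below. *)
Lemma functional_le (phi : (T -> R) -> R) (c delta : R) :
  linear_on_bmeas phi ->
  (forall f M, bmeas f M -> `|phi f| <= c * M) ->
  (forall B, measurable B -> `|phi \1_B| <= delta) ->
  forall f M, bmeas f M -> `|phi f| <= 3 * M * delta.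
Proof.
move=> lin bnd ind f M bf.
have [M0|M0] := eqVneq M 0.
  by have := bnd _ _ bf; rewrite M0 !mulr0 mul0r.
have {M0}M0 : 0 < M by rewrite lt_def M0 (bmeas_ge0 bf).
pose g := fun x => (f x + M) / (2 * M).
have mg : measurable_fun [set: T] g.
  apply: measurable_funM => //; apply: measurable_funD => //.
  by case: bf.
have g01 x : 0 <= g x <= 1.
  have := bf.2 x; rewrite ler_norml => /andP[h1 h2].
  rewrite divr_ge0 /=; [|lra..].
  by rewrite ler_pdivrMr; lra.
have bg : bmeas g 1.
  by split=> // x; have /andP[? ?] := g01 x; rewrite ger0_norm.
have -> : phi f = phi (fun=> - M) + 2 * M * phi g.
  rewrite -(lin _ _ _ _ _ (bmeas_cst (- M)) bg); congr phi.
  by apply/funext => x; rewrite /g; field; rewrite gt_eqF.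
have := unit_functional_le lin bnd ind mg g01 => h1.
have h2 : `|phi (fun=> - M)| <= M * delta.
  have b0 := bmeas_cst 0; have b1 := bmeas_indic (@measurableT _ T).
  have -> : (fun=> - M) = (fun x => (fun=> 0) x + (- M) * \1_[set: T] x).
    by apply/funext => x; rewrite indicT add0r mulr1.
  rewrite (lin _ _ _ _ _ b0 b1).
  have := bnd _ _ b0; rewrite normr0 mulr0 normr_le0 => /eqP ->.
  rewrite add0r normrM normrN (gtr0_norm M0).
  by rewrite ler_pM2l //; exact: ind.
apply: le_trans (ler_normD _ _) _; rewrite normrM gtr0_norm; last by lra.
have : 2 * M * `|phi g| <= 2 * M * delta by apply: ler_wpM2l => //; lra.
by lra.
Qed.

End bounded_measurable.

Section square_integrable.
Context (R : realType) (dT : measure_display) (T : measurableType dT).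

Lemma bmeas_integrable (mu : {measure set T -> \bar R}) (f : T -> R) M :
  (mu [set: T] <= 1)%E -> bmeas f M -> mu.-integrable [set: T] (EFin \o f).
Proof.
move=> mu1 [mf fM]; apply: measurable_bounded_integrable => //.
  exact: le_lt_trans mu1 (ltry _).
exists M; split; first exact: num_real.
by move=> N MN x _; apply: le_trans (fM x) (ltW MN).
Qed.

Lemma bmeas_Rintegral_le (mu : {measure set T -> \bar R}) (f : T -> R) M :
  (mu [set: T] <= 1)%E -> bmeas f M -> `|\int[mu]_x f x| <= M.
Proof.
move=> mu1 bf; have M0 := bmeas_ge0 bf.
have fi := bmeas_integrable mu1 bf.
have nf : bmeas (fun x => `|f x|) M.
  split=> [|x]; last by rewrite normr_id; case: bf.
  by apply: measurableT_comp => //; case: bf.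
apply: le_trans (le_normr_Rintegral measurableT fi) _.
apply: le_trans (_ : \int[mu]_x M <= _).
  apply: le_Rintegral => //; first exact: (bmeas_integrable mu1 nf).
    exact: (bmeas_integrable mu1 (@bmeas_cst _ _ T M)).
  by move=> x _; case: bf.
rewrite Rintegral_cst // ler_piMr //.
by rewrite -lee_fin fineK // ge0_fin_numE //; exact: le_lt_trans mu1 (ltry _).
Qed.

Variable Pr : probability T R.
Implicit Types f g h : T -> R.

Let Pr1 : (Pr [set: T] <= 1)%E.
Proof. by rewrite probability_setT. Qed.

Definition L1 (f : T -> R) := Pr.-integrable [set: T] (EFin \o f).

Definition L2 (f : T -> R) : Prop :=
  measurable_fun [set: T] f /\ L1 (fun x => f x ^+ 2).

Definition Ex (f : T -> R) : R := \int[Pr]_x f x.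

Lemma L1_meas f : L1 f -> measurable_fun [set: T] f.
Proof. by move=> /measurable_int /measurable_EFinP. Qed.

Lemma L1_dominated f g : measurable_fun [set: T] f -> L1 g ->
  (forall x, `|f x| <= g x) -> L1 f.
Proof.
move=> mf ig fg; apply: le_integrable ig => //; first exact/measurable_EFinP.
move=> x _ /=; rewrite lee_fin; apply: le_trans (fg x) _.
by rewrite ler_norm.
Qed.

Lemma L1_bmeas f M : bmeas f M -> L1 f.
Proof. exact: bmeas_integrable. Qed.

Lemma L1D f g : L1 f -> L1 g -> L1 (fun x => f x + g x).
Proof. by move=> h1 h2; exact: (integrableD measurableT h1 h2). Qed.

Lemma L1Z c f : L1 f -> L1 (fun x => c * f x).
Proof. by move=> h; exact: (integrableZl measurableT c h). Qed.

Lemma L1_bM h f M : bmeas h M -> L1 f -> L1 (fun x => h x * f x).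
Proof.
move=> [mh hM] lf; have mf := L1_meas lf.
have lf' : L1 (fun x => M * `|f x|) by apply: L1Z; exact: integrable_norm lf.
apply: L1_dominated lf' _; first exact: measurable_funM.
by move=> x; rewrite normrM ler_wpM2r.
Qed.

Lemma L2_meas f : L2 f -> measurable_fun [set: T] f.
Proof. by case. Qed.

Lemma L2M f g : L2 f -> L2 g -> L1 (fun x => f x * g x).
Proof.
move=> [mf f2] [mg g2]; apply: L1_dominated (L1D f2 g2) _.
  exact: measurable_funM.
move=> x; rewrite ler_norml.
have := sqr_ge0 (f x + g x); have := sqr_ge0 (f x - g x).
by rewrite !expr2 => h1 h2; apply/andP; split; nra.
Qed.

Lemma L2_bmeas f M : bmeas f M -> L2 f.
Proof.
move=> bf; split; first by case: bf.
by apply: (@L1_bmeas _ (M * M)); exact: bmeasM.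
Qed.

Lemma L2_L1 f : L2 f -> L1 f.
Proof.
move=> hf; have := L2M (L2_bmeas (@bmeas_cst _ _ T 1)) hf.
by under [X in L1 X -> _]eq_fun do rewrite mul1r.
Qed.

Lemma L2D f g : L2 f -> L2 g -> L2 (fun x => f x + g x).
Proof.
move=> hf hg; have [mf f2] := hf; have [mg g2] := hg.
split; first exact: measurable_funD.
have fg := L1Z 2 (L2M hf hg).
have := L1D (L1D f2 g2) fg; rewrite /L1; congr (Pr.-integrable _ _).
by apply/funext => x /=; congr EFin; ring.
Qed.

Lemma L2_bM h f M : bmeas h M -> L2 f -> L2 (fun x => h x * f x).
Proof.
move=> bh [mf f2]; split; first by apply: measurable_funM => //; case: bh.
have := L1_bM (bmeasM bh bh) f2; rewrite /L1; congr (Pr.-integrable _ _).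
by apply/funext => x /=; congr EFin; ring.
Qed.

Lemma L2Z c f : L2 f -> L2 (fun x => c * f x).
Proof. exact: L2_bM (@bmeas_cst _ _ T c). Qed.

Lemma L2_cst c : L2 (fun=> c).
Proof. exact: L2_bmeas (@bmeas_cst _ _ T c). Qed.

Lemma L2_sum (I : Type) (s : seq I) (F : I -> T -> R) :
  (forall i, L2 (F i)) -> L2 (fun x => \sum_(i <- s) F i x).
Proof.
move=> h; elim: s => [|i s ih].
  by under eq_fun do rewrite big_nil; exact: L2_cst.
by under eq_fun do rewrite big_cons; exact: L2D.
Qed.

Lemma L1_sum (I : Type) (s : seq I) (F : I -> T -> R) :
  (forall i, L1 (F i)) -> L1 (fun x => \sum_(i <- s) F i x).
Proof.
move=> h; elim: s => [|i s ih].
  by under eq_fun do rewrite big_nil; exact: L1_bmeas (@bmeas_cst _ _ T 0).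
by under eq_fun do rewrite big_cons; exact: L1D.
Qed.

Lemma ExD f g : L1 f -> L1 g -> Ex (fun x => f x + g x) = Ex f + Ex g.
Proof. by move=> h1 h2; rewrite /Ex RintegralD. Qed.

Lemma ExZ c f : L1 f -> Ex (fun x => c * f x) = c * Ex f.
Proof. by move=> h; rewrite /Ex RintegralZl. Qed.

Lemma Ex_cst c : Ex (fun=> c) = c.
Proof. by rewrite /Ex Rintegral_cst //= probability_setT mulr1. Qed.

Lemma Ex_sum (I : Type) (s : seq I) (F : I -> T -> R) :
  (forall i, L1 (F i)) ->
  Ex (fun x => \sum_(i <- s) F i x) = \sum_(i <- s) Ex (F i).
Proof.
move=> h; elim: s => [|i s ih].
  by under eq_fun do rewrite big_nil; rewrite big_nil Ex_cst.
under eq_fun do rewrite big_cons.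
by rewrite big_cons ExD // ?ih //; exact: L1_sum.
Qed.

Lemma le_Ex f g : L1 f -> L1 g -> (forall x, f x <= g x) -> Ex f <= Ex g.
Proof. by move=> h1 h2 h; apply: le_Rintegral. Qed.

Lemma Ex_ge0 f : (forall x, 0 <= f x) -> 0 <= Ex f.
Proof. by move=> h; apply: Rintegral_ge0. Qed.

Lemma Ex_norm_le f g : L1 f -> L1 g -> (forall x, `|f x| <= g x) ->
  `|Ex f| <= Ex g.
Proof.
move=> h1 h2 h; apply: le_trans (le_normr_Rintegral measurableT h1) _.
by apply: le_Ex => //; exact: integrable_norm h1.
Qed.

Lemma Ex_bmeas_le f M : bmeas f M -> `|Ex f| <= M.
Proof. exact: bmeas_Rintegral_le. Qed.

End square_integrable.

(** * The transition operator *)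

Section transition_operator.
Context (R : realType) (dX : measure_display) (X : measurableType dX).
Variable P : R.-pker X ~> X.
Implicit Types f g : X -> R.

Definition op f (y : X) : R := \int[P y]_z f z.

Lemma kernelP1 y : (P y [set: X] <= 1)%E.
Proof. by rewrite prob_kernel. Qed.

Let P1 y : (P y [set: X] <= 1)%E.
Proof. by rewrite prob_kernel. Qed.

Lemma op_le f M y : bmeas f M -> `|op f y| <= M.
Proof. exact: bmeas_Rintegral_le. Qed.

Lemma op_cst c : op (fun=> c) = (fun=> c).
Proof.
by apply/funext => y; rewrite /op Rintegral_cst //= prob_kernel mulr1.
Qed.

Lemma opD f g a M N : bmeas f M -> bmeas g N ->
  op (fun x => f x + a * g x) = (fun y => op f y + a * op g y).
Proof.
move=> bf bg; apply/funext => y; have fi := bmeas_integrable (P1 y) bf.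
have gi := bmeas_integrable (P1 y) bg.
rewrite /op RintegralD //; last exact: bmeas_integrable (P1 y) (bmeasZ a bg).
by rewrite RintegralZl.
Qed.

Lemma op_indic (B : set X) y : measurable B -> op \1_B y = fine (P y B).
Proof. by move=> mB; rewrite /op /Rintegral integral_indic // setIT. Qed.

Lemma bmeas_op f M : bmeas f M -> bmeas (op f) M.
Proof.
move=> bf; split => [|y]; last exact: op_le.
(* Measurability of an integral against a kernel is a statement on nonnegative integrands, hence the
   shift by M. *)
pose g x := f x + M.
have M0 := bmeas_ge0 bf.
have bg : bmeas g (M + `|M|) by exact: bmeasD bf (@bmeas_cst _ _ X M).
have -> : op f = (fun y => op g y - M).
  apply/funext => y; rewrite /g.
  have /(congr1 (@^~ y)) := opD 1 bf (@bmeas_cst _ _ X M).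
  rewrite op_cst mul1r.
  by move=> ->; rewrite addrK.
apply: measurable_funB => //.
apply: measurableT_comp => //.
apply: measurable_fun_integral_kernel => //.
- by move=> B mB; exact: measurable_kernel.
- move=> z; rewrite lee_fin /g.
  by have := bf.2 z; rewrite ler_norml => /andP[]; lra.
- by apply/measurable_EFinP; case: bg.
Qed.

Lemma bmeas_iter_op n f M : bmeas f M -> bmeas (iter n op f) M.
Proof. by move=> bf; elim: n => // n ih; exact: bmeas_op. Qed.

Lemma iter_opD n f g a M N : bmeas f M -> bmeas g N ->
  iter n op (fun x => f x + a * g x) =
  (fun y => iter n op f y + a * iter n op g y).
Proof.
move=> bf bg; elim: n => //= n ->.
by rewrite (opD _ (bmeas_iter_op n bf) (bmeas_iter_op n bg)).
Qed.

Lemma iter_op_cst n c : iter n op (fun=> c) = (fun=> c).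
Proof. by elim: n => //= n ->; rewrite op_cst. Qed.

(** [kernel_iter] appends each new step at the end of the path, so f is averaged first over the last
    step; hence [iterSr]. On indicators the identity is the definition of kernel composition, and
    [functional_le] with delta = 0 carries it to f. *)
Lemma kernel_iter_op n f M y : bmeas f M ->
  \int[kernel_iter P n y]_z f z = iter n op f y.
Proof.
elim: n f M y => [|n ih] f M y bf /=.
  rewrite /Rintegral /kdirac integral_dirac //=.
    by rewrite indicT mul1r.
  by apply/measurable_EFinP; case: bf.
have K1 k : (kernel_iter P k y [set: X] <= 1)%E by exact: sprob_kernel_le1.
rewrite -iterS iterSr -(ih _ M) //; last exact: bmeas_op.
pose phi h := \int[kernel_iter P n.+1 y]_z h z - \int[kernel_iter P n y]_z op h z.
apply/eqP; rewrite -subr_eq0 -/(phi f) -normr_le0.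
rewrite [leRHS](_ : 0 = 3 * M * 0); last by rewrite mulr0.
apply: (@functional_le _ _ _ phi 2) bf => [g h a N1 N2 bg bh|g N bg|B mB].
- rewrite /phi.
  rewrite (opD _ bg bh).
  have i1 := bmeas_integrable (K1 n.+1) bg.
  have i2 := bmeas_integrable (K1 n.+1) bh.
  have i3 := bmeas_integrable (K1 n) (bmeas_op bg).
  have i4 := bmeas_integrable (K1 n) (bmeas_op bh).
  rewrite !RintegralD ?RintegralZl //; first by ring.
  + exact: bmeas_integrable (K1 n) (bmeasZ a (bmeas_op bh)).
  + exact: bmeas_integrable (K1 n.+1) (bmeasZ a bh).
- apply: le_trans (ler_normB _ _) _; rewrite mulr_natl mulr2n lerD //.
    exact: bmeas_Rintegral_le (K1 n.+1) bg.
  exact: bmeas_Rintegral_le (K1 n) (bmeas_op bg).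
- rewrite /phi [X in X - _]/Rintegral integral_indic // setIT /=.
  rewrite /mkcomp_noparam /kcomp_noparam normr_le0 subr_eq0; apply/eqP.
  congr fine; apply: eq_integral => z _.
  rewrite op_indic // fineK // ge0_fin_numE //.
  apply: le_lt_trans (le_trans _ (kernelP1 z)) (ltry _).
  by apply: le_measure; rewrite ?inE.
Qed.

Variable mu : probability X R.
Hypothesis hstat : stationary P mu.

(** On indicators this is stationarity; [functional_le] with delta = 0 extends it. *)
Lemma mean_op f M : bmeas f M -> Ex mu (op f) = Ex mu f.
Proof.
move=> bf; pose phi h := Ex mu (op h) - Ex mu h.
apply/eqP; rewrite -subr_eq0 -/(phi f) -normr_le0.
rewrite [leRHS](_ : 0 = 3 * M * 0); last by rewrite mulr0.
have mu1 : (mu [set: X] <= 1)%E by rewrite probability_setT.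
apply: (@functional_le _ _ _ phi 2) bf => [g h a N1 N2 bg bh|g N bg|B mB].
- rewrite /phi.
  rewrite (opD _ bg bh).
  have i1 := L1_bmeas mu bg; have i2 := L1_bmeas mu bh.
  have i3 := L1_bmeas mu (bmeas_op bg); have i4 := L1_bmeas mu (bmeas_op bh).
  by rewrite !ExD ?ExZ //; [ring|exact: L1Z..].
- apply: le_trans (ler_normB _ _) _; rewrite mulr_natl mulr2n lerD //.
    exact: bmeas_Rintegral_le mu1 (bmeas_op bg).
  exact: bmeas_Rintegral_le mu1 bg.
- rewrite /phi normr_le0 subr_eq0; apply/eqP.
  rewrite /Ex [RHS]/Rintegral integral_indic // setIT -hstat //.
  congr fine; apply: eq_integral => z _.
  rewrite op_indic // fineK // ge0_fin_numE //.
  apply: le_lt_trans (le_trans _ (kernelP1 z)) (ltry _).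
  by apply: le_measure; rewrite ?inE.
Qed.

Lemma mean_iter_op n f M : bmeas f M -> Ex mu (iter n op f) = Ex mu f.
Proof.
by move=> bf; elim: n => //= n <-; exact: mean_op (bmeas_iter_op n bf).
Qed.

Hypothesis herg : uniform_ergodicity P mu.

(** For large times the total variation distance is below 1/12, and the bound 3 M delta of
    [functional_le] is then M / 4. The time is made positive because [geometric_ergodicity] cuts n
    into blocks of that length. *)
Lemma contraction_time : exists2 m : nat, (0 < m)%N &
  forall f M, bmeas f M -> Ex mu f = 0 -> bmeas (iter m op f) (M / 4).
Proof.
have e12 : (0 < (12^-1)%:E :> \bar R)%E by rewrite lte_fin.
have [m _ hm] : \forall n \near \oo,
    (ereal_sup (range (fun x => tv_dist (kernel_iter P n x) mu)) < (12^-1)%:E)%E.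
  have /herg : nbhs 0%E [set z : \bar R | (z < (12^-1)%:E)%E].
    by apply: open_nbhs_nbhs; split => //=; exact: open_ereal_lt_ereal.
  by [].
exists (maxn m 1); first by rewrite leq_max orbT.
set k := maxn m 1 => f M bf f0.
have hk : forall x B, measurable B ->
    `|fine (kernel_iter P k x B) - fine (mu B)| <= 12^-1.
  move=> x B mB.
  have h : (tv_dist (kernel_iter P k x) mu <= (12^-1)%:E)%E.
    apply: ltW; apply: le_lt_trans (hm k _); last by rewrite /k /= leq_maxl.
    by apply: ereal_sup_ubound; exists x.
  have K1 : (kernel_iter P k x [set: X] <= 1)%E by exact: sprob_kernel_le1.
  have fK : kernel_iter P k x B \is a fin_num.
    rewrite ge0_fin_numE //; apply: le_lt_trans (le_trans _ K1) (ltry _).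
    by apply: le_measure; rewrite ?inE.
  have fm : mu B \is a fin_num by exact: fin_num_measure.
  rewrite -lee_fin -abse_EFin EFinB !fineK //.
  by apply: le_trans h; apply: ereal_sup_ubound; exists B.
split=> [|y]; first by case: (bmeas_iter_op k bf).
have mu1 : (mu [set: X] <= 1)%E by rewrite probability_setT.
pose phi h := iter k op h y - Ex mu h.
have -> : iter k op f y = phi f by rewrite /phi f0 subr0.
have -> : M / 4 = 3 * M * 12^-1 by field.
apply: (@functional_le _ _ _ phi 2) bf => [g h a N1 N2 bg bh|g N bg|B mB].
- have i1 := L1_bmeas mu bg; have i2 := L1_bmeas mu bh.
  rewrite /phi (iter_opD _ _ bg bh) ExD ?ExZ //; first by ring.
  exact: L1Z.
- apply: le_trans (ler_normB _ _) _; rewrite mulr_natl mulr2n lerD //.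
    by case: (bmeas_iter_op k bg).
  exact: bmeas_Rintegral_le mu1 bg.
- rewrite /phi -(kernel_iter_op _ _ (bmeas_indic R mB)) /Ex /Rintegral.
  by rewrite !integral_indic // !setIT; exact: hk.
Qed.

(** After q full blocks the bound is M / 4^q, at most M / 2^q. The rate rho = 1 - 1 / (2 m)
    satisfies rho^m >= 1/2 by Bernoulli's inequality, so each block costs at most rho^m, and the
    factor 2 pays for the last, incomplete block. *)
Lemma geometric_ergodicity : exists2 rho : R, 0 < rho < 1 &
  forall n f M, bmeas f M -> Ex mu f = 0 -> bmeas (iter n op f) (2 * M * rho ^+ n).
Proof.
have [m m0 hm] := contraction_time.
have m0R : 0 < m%:R :> R by rewrite ltr0n.
have m1 : 1 <= m%:R :> R by rewrite ler1n.
pose t : R := (2 * m%:R)^-1.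
have t0 : 0 < t by rewrite invr_gt0; lra.
have t1 : t <= 2^-1 by rewrite /t lef_pV2 ?posrE; lra.
pose rho : R := 1 - t.
have r0 : 0 < rho by rewrite /rho; lra.
have r1 : rho < 1 by rewrite /rho; lra.
have rhom : 2^-1 <= rho ^+ m.
  have bern k : 1 - k%:R * t <= rho ^+ k.
    elim: k => [|k ih]; first by rewrite mul0r subr0 expr0.
    rewrite exprS; apply: le_trans (ler_wpM2l (ltW r0) ih).
    by rewrite /rho -[in leLHS]natr1; have := ler0n R k; nra.
  apply: le_trans (bern m).
  by rewrite /t invfM mulrCA divff ?lt0r_neq0 //; lra.
have hq q f M : bmeas f M -> Ex mu f = 0 -> bmeas (iter (q * m) op f) (M / 4 ^+ q).
  elim: q f M => [|q ih] f M bf f0; first by rewrite expr0 divr1.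
  rewrite mulSn iterD.
  have -> : M / 4 ^+ q.+1 = M / 4 ^+ q / 4 by rewrite exprSr invfM; ring.
  by apply: hm; [exact: ih|rewrite (mean_iter_op _ bf)].
exists rho; first by rewrite r0 r1.
move=> n f M bf f0.
have M0 := bmeas_ge0 bf.
rewrite {1}(divn_eq n m) addnC iterD.
apply: bmeasW (bmeas_iter_op (n %% m) (hq (n %/ m)%N f M bf f0)).
rewrite -mulrA mulrCA ler_wpM2l //.
apply: (@le_trans _ _ (2 * (rho ^+ m) ^+ (n %/ m).+1)).
  apply: (@le_trans _ _ (2 * (2^-1) ^+ (n %/ m).+1)).
    rewrite exprS mulrA divff ?mul1r // -exprVn lerXn2r ?nnegrE //; lra.
  by rewrite ler_wpM2l // lerXn2r ?nnegrE // exprn_ge0 ?ltW.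
rewrite ler_wpM2l // -exprM ler_wiXn2l ?ltW //.
by rewrite mulnC {1}(divn_eq n m) mulSn addnC leq_add2r ltnW // ltn_mod.
Qed.

End transition_operator.

(** * Conditioning on the past of the chain *)

Section orthogonality.
Context (R : realType) (dT : measure_display) (T : measurableType dT).
Variable Pr : probability T R.
Variable G : set_system T.
Hypothesis mG : G `<=` measurable.

(** Changing the type of the domain turns functions of the past into ordinary measurable functions,
    to which [functional_le] applies. *)
Definition gmeas (f : T -> R) : Prop :=
  measurable_fun [set: g_sigma_algebraType G] (f : g_sigma_algebraType G -> R).

Lemma sub_g_sigma : <<s G >> `<=` (measurable : set (set T)).
Proof. by apply: smallest_sub => //; exact: sigma_algebra_measurable. Qed.

Lemma gmeas_measurable f : gmeas f -> measurable_fun [set: T] f.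
Proof.
move=> h _ Y mY; apply: sub_g_sigma.
exact: (h (@measurableT _ (g_sigma_algebraType G)) Y mY).
Qed.

Hypothesis GI : setI_closed G.
Hypothesis GT : G setT.

(** The sets over which W integrates to 0 form a Dynkin system: complements use that the whole space
    is one of them, by [GT], and disjoint unions use countable additivity of the integral. *)
Lemma dynkin_integral0 (W : T -> R) : L1 Pr W ->
  (forall D, G D -> \int[Pr]_(x in D) W x = 0) ->
  forall D, <<s G >> D -> \int[Pr]_(x in D) W x = 0.
Proof.
move=> iW W0.
have iWD D : measurable D -> Pr.-integrable D (EFin \o W).
  by move=> mD; exact: integrableS iW.
suff : <<s G >> `<=` [set D | measurable D /\ \int[Pr]_(x in D) W x = 0].
  by move=> h D /h[].
rewrite -(setI_closed_g_dynkin_g_sigma_algebra GI).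
apply: smallest_sub; last by move=> D GD; split; [exact: mG|exact: W0].
split.
- by split=> //; exact: W0.
- move=> D [mD D0]; split; first exact: measurableC.
  have := W0 _ GT; rewrite -(setUv D) Rintegral_setU //.
  + by rewrite D0 add0r.
  + exact: measurableC.
  + by rewrite setUv.
  + by apply/disj_set2P; rewrite setICr.
- move=> F tF hF; have mF n : measurable (F n) by case: (hF n).
  split; first exact: bigcup_measurable.
  rewrite /Rintegral integral_bigcup //; last exact: iWD (bigcup_measurable _).
  rewrite eseries0 // => n _ _.
  have [_] := hF n; rewrite /Rintegral => h.
  by rewrite -[LHS]fineK ?h //; exact: integrable_fin_num (iWD _ (mF n)).
Qed.

Lemma orthogonal_bmeas (W : T -> R) : L1 Pr W ->
  (forall D, G D -> \int[Pr]_(x in D) W x = 0) ->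
  forall (Z : T -> R) M, gmeas Z -> (forall x, `|Z x| <= M) ->
  Ex Pr (fun x => Z x * W x) = 0.
Proof.
move=> iW W0 Z M mZ ZM.
have W0' := dynkin_integral0 iW W0.
pose phi (f : g_sigma_algebraType G -> R) := Ex Pr (fun x => f x * W x).
have bm (f : g_sigma_algebraType G -> R) N : bmeas f N ->
    bmeas (f : T -> R) N.
  by case=> mf fN; split => //; exact: gmeas_measurable.
have i1 (f : g_sigma_algebraType G -> R) N : bmeas f N ->
    L1 Pr (fun x => f x * W x).
  by move=> /bm bf; exact: L1_bM bf iW.
apply/eqP; rewrite -normr_le0.
have -> : 0 = 3 * M * 0 :> R by rewrite mulr0.
(* On the type carrying <<s G>> the measurable sets are those of [dynkin_integral0], so the
   functional vanishes on indicators and delta is 0. *)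
apply: (@functional_le _ _ (g_sigma_algebraType G) phi (Ex Pr (fun x => `|W x|))).
- move=> f g a M1 M2 bf bg; rewrite /phi.
  rewrite -(ExZ _ (i1 _ _ bg)) -ExD; first by congr Ex; apply/funext => x; ring.
  + exact: i1 bf.
  + exact: L1Z (i1 _ _ bg).
- move=> f N bf; rewrite /phi mulrC -ExZ; last exact: integrable_norm iW.
  apply: Ex_norm_le; first exact: i1 bf.
    by apply: L1Z; exact: integrable_norm iW.
  by move=> x; rewrite normrM ler_wpM2r //; case: bf.
- move=> B mB; rewrite /phi.
  have -> : Ex Pr (fun x => \1_B x * W x) = \int[Pr]_(x in B) W x.
    rewrite Rintegral_mkcond; congr Ex; apply/funext => x.
    rewrite patchE indicE; case: (x \in B); first by rewrite mul1r.
    by rewrite mul0r.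
  by rewrite W0' // normr0.
- by split.
Qed.

(* Truncation of Z, passing to the limit by dominated convergence. *)
Lemma orthogonal_L1 (W : T -> R) N : bmeas W N ->
  (forall D, G D -> \int[Pr]_(x in D) W x = 0) ->
  forall Z : T -> R, gmeas Z -> L1 Pr Z ->
  Ex Pr (fun x => Z x * W x) = 0.
Proof.
move=> bW W0 Z mZ iZ.
have iW := L1_bmeas Pr bW.
pose B (n : nat) := (fun x => `|Z x|) @^-1` `]-oo, n%:R].
have mB n : measurable (B n : set (g_sigma_algebraType G)).
  have mZ' : measurable_fun [set: g_sigma_algebraType G]
      (fun x : g_sigma_algebraType G => `|Z x| : R).
    exact: measurableT_comp.
  by rewrite -[B n]setTI; exact: mZ'.
pose Zn (n : nat) x := Z x * \1_(B n) x.
have mZn n : gmeas (Zn n).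
  by apply: measurable_funM => //; exact: measurable_indic.
have BE n x : (x \in B n) = (`|Z x| <= n%:R).
  by apply/idP/idP => [/set_mem|h]; [|apply: mem_set]; rewrite /B /= in_itv.
have Zn_le n x : `|Zn n x| <= n%:R.
  rewrite /Zn indicE BE; case: (boolP (`|Z x| <= _)) => h.
    by rewrite mulr1.
  by rewrite mulr0 normr0.
have Zn_dom n x : `|Zn n x| <= `|Z x|.
  by rewrite /Zn indicE normrM; case: (x \in B n);
    rewrite ?normr1 ?normr0 ?mulr1 ?mulr0.
have Z0 n : Ex Pr (fun x => Zn n x * W x) = 0.
  exact: orthogonal_bmeas (Zn_le n).
have mW : measurable_fun [set: T] W by case: bW.
have iZn n : L1 Pr (fun x => Zn n x * W x).
  apply: L1_bM iW; split; last exact: Zn_le.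
  exact: gmeas_measurable.
have cv : Ex Pr (fun x => Zn n x * W x) @[n --> \oo] -->
    Ex Pr (fun x => Z x * W x).
  apply: fine_cvg.
  rewrite fineK; last first.
    apply: integrable_fin_num => //.
    have := L1_bM bW iZ; rewrite /L1; congr (Pr.-integrable _ _).
    by apply/funext => x /=; rewrite mulrC.
  apply: (@dominated_cvg _ _ _ Pr setT measurableT
    (fun n x => (Zn n x * W x)%:E) (fun x => (Z x * W x)%:E)
    (fun x => (`|Z x| * N)%:E)).
  - by move=> n; apply/measurable_EFinP; exact: L1_meas (iZn n).
  - move=> x _; apply: cvg_near_cst.
    exists (Num.truncn `|Z x|).+1 => // n /= hn.
    rewrite /Zn indicE BE (le_trans (ltW (truncnS_gt _))) ?mulr1 //.
    by rewrite ler_nat.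
  - by [].
  - have := L1Z N (integrable_norm iZ); rewrite /L1.
    by congr (Pr.-integrable _ _); apply/funext => x /=; rewrite mulrC.
  - move=> n x _; rewrite lee_fin normrM ler_pM //.
    by case: bW.
rewrite -(cvg_lim (@Rhausdorff R) cv); apply: cvg_lim => //.
by under eq_fun do rewrite Z0; exact: cvg_cst.
Qed.

End orthogonality.

(** * Conditional probabilities given one random variable *)

Section conditional_probability.
Context (R : realType) (dX : measure_display) (X : measurableType dX).
Context (dO : measure_display) (Omega : measurableType dO).
Variables (Pr : probability Omega R) (Y : {RV Pr >-> X}) (E : set Omega).
Hypothesis mE : measurable E.

Let mY (B : set X) : measurable B -> measurable (Y @^-1` B).
Proof. by move=> mB; rewrite -[X in measurable X]setTI; exact: measurable_funPT. Qed.

(** The law of Y restricted to the event E; its density with respect to the law of Y is the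
    conditional probability of E. *)
Definition joint_part (B : set X) : \bar R := Pr (E `&` Y @^-1` B).

Let joint_part0 : joint_part set0 = 0%E.
Proof. by rewrite /joint_part preimage_set0 setI0 measure0. Qed.

Let joint_part_ge0 B : (0 <= joint_part B)%E.
Proof. exact: measure_ge0. Qed.

Let joint_part_additive : semi_sigma_additive joint_part.
Proof.
move=> F mF tF mUF; rewrite /joint_part preimage_bigcup setI_bigcupr.
apply: measure_semi_sigma_additive.
- by move=> n; apply: measurableI => //; exact: mY.
- apply/trivIsetP => /= i j _ _ ij; rewrite setIACA -preimage_setI.
  by move/trivIsetP : tF => /(_ _ _ _ _ ij) -> //; rewrite preimage_set0 setI0.
- by apply: bigcupT_measurable => n; apply: measurableI => //; exact: mY.
Qed.

HB.instance Definition _ := isMeasure.Build _ _ _ joint_part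
  joint_part0 joint_part_ge0 joint_part_additive.

Let joint_part_fin : fin_num_fun joint_part.
Proof.
move=> B mB; rewrite /joint_part ge0_fin_numE //.
apply: le_lt_trans (probability_le1 _ _) (ltry _).
by apply: measurableI => //; exact: mY.
Qed.

HB.instance Definition _ := Measure_isFinite.Build _ _ _ joint_part
  joint_part_fin.

Let joint_part_le (B : set X) : measurable B ->
  (joint_part B <= distribution Pr Y B)%E.
Proof.
move=> mB; apply: le_measure; rewrite ?inE; [|exact: mY|exact: subIsetr].
by apply: measurableI => //; exact: mY.
Qed.

(** [cond_independent] speaks of all versions, so a version must be exhibited before it can be used.
    It is the Radon-Nikodym density of [joint_part]; this density is at most 1 only almost
    everywhere, and is truncated to be bounded everywhere. *)
Lemma cond_prob_exists :
  exists2 h : X -> R, is_cond_prob Y E h & forall y, 0 <= h y <= 1.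
Proof.
have dom : joint_part `<< distribution Pr Y.
  apply/null_content_dominatesP => B mB B0.
  by apply/eqP; rewrite eq_le measure_ge0 andbT -B0; exact: joint_part_le.
have [f [f0 ffin fi fE]] := radon_nikodym_sigma_finite dom.
have mf : measurable_fun [set: X] f by exact: measurable_int fi.
(* On D the integral of f - 1 is [joint_part] D minus the law of D, which is at most 0, while f - 1
   is positive there: D is a null set. *)
pose D := [set y | (1%:E < f y)%E].
have mD : measurable D.
  by rewrite /D -[X in measurable X]setTI; exact: emeasurable_fun_o_infty.
have D0 : distribution Pr Y D = 0%E.
  have mfD : measurable_fun D (fun y => f y - 1%:E)%E.
    by apply: measurable_funTS; apply: emeasurable_funB.
  have int0 : (\int[distribution Pr Y]_(y in D) `|f y - 1%:E| = 0)%E.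
    transitivity (\int[distribution Pr Y]_(y in D) (f y - 1%:E))%E.
      apply: eq_integral => y /set_mem Dy; rewrite gee0_abs // sube_ge0 //.
      exact: ltW.
    apply/eqP; rewrite eq_le; apply/andP; split; last first.
      by apply: integral_ge0 => y Dy; rewrite sube_ge0 // ltW.
    rewrite integralB //; last 2 first.
    - exact: integrableS fi.
    - exact: finite_measure_integrable_cst.
    rewrite -fE // integral_cst // mul1e sube_le0.
    exact: joint_part_le.
  have [N [mN N0 sub]] := (ae_eq_integral_abs _ mD mfD).1 int0.
  apply/eqP; rewrite eq_le measure_ge0 andbT -N0.
  apply: le_measure; rewrite ?inE // => y Dy; apply: sub => /= /(_ Dy) h.
  move: Dy; rewrite /D /= -(fineK (ffin y)) lte_fin => h1.
  move: h; rewrite -(fineK (ffin y)) -EFinB => -[] h2.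
  by move: h1; rewrite -subr_gt0 h2 ltxx.
pose h y := Num.min 1 (fine (f y)).
have mh : measurable_fun [set: X] h.
  by apply: measurable_minr => //; exact: measurableT_comp.
have h01 y : 0 <= h y <= 1.
  by rewrite /h le_min ler01 /= fine_ge0 //= ge_min lexx.
exists h => //; split => // B mB.
transitivity (\int[distribution Pr Y]_(y in B) (h y)%:E)%E.
  rewrite /distribution ge0_integral_pushforward //.
  - by apply: measurable_funTS; exact/measurable_EFinP.
  - by move=> y _; rewrite lee_fin; case/andP: (h01 y).
rewrite -/(joint_part B) fE //; apply: ge0_ae_eq_integral => //.
- by apply: measurable_funTS; exact/measurable_EFinP.
- exact: measurable_funTS.
- by move=> y _; rewrite lee_fin; case/andP: (h01 y).
exists D; split=> // y /= /not_implyP[_ hy].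
rewrite /D /= ltNge; apply/negP => f1; apply: hy.
rewrite /h -[RHS](fineK (ffin y)); congr EFin; apply/min_idPr.
by rewrite -lee_fin fineK.
Qed.

End conditional_probability.

Lemma sigma_setI (T : pointedType) (H : set_system T) : setI_closed <<s H >>.
Proof. by move=> A B; exact: (@measurableI _ (g_sigma_algebraType H)). Qed.

Lemma sigma_setT (T : pointedType) (H : set_system T) : <<s H >> setT.
Proof. exact: (@measurableT _ (g_sigma_algebraType H)). Qed.

Lemma g_sigma_preimage_mem (Omega : Type) dT (T : measurableType dT) n
    (f : 'I_n -> Omega -> T) (i : 'I_n) (B : set T) :
  measurable B -> g_sigma_preimage f (f i @^-1` B).
Proof.
move=> mB; apply: sub_sigma_algebra; rewrite (bigD1 i) //=; left.
by exists B => //; rewrite setTI.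
Qed.

Lemma g_sigma_preimage_sub (Omega : pointedType) dT (T : measurableType dT) n
    (f : 'I_n -> Omega -> T) (H : set_system Omega) :
  (forall i B, measurable B -> <<s H >> (f i @^-1` B)) ->
  g_sigma_preimage f `<=` <<s H >>.
Proof.
move=> h; apply: smallest_sub; first exact: (@sigma_algebra_measurable _ (g_sigma_algebraType H)).
elim/big_ind: _ => //= [A1 A2 h1 h2 D [/h1|/h2] //|i _ D [B mB <-]].
by rewrite setTI; exact: h.
Qed.

Lemma gmeas_comp (R : realType) dT (T : measurableType dT) dO
    (Omega : measurableType dO) (H : set_system Omega) (Y : Omega -> T)
    (f : T -> R) :
  (forall B, measurable B -> <<s H >> (Y @^-1` B)) ->
  measurable_fun [set: T] f -> gmeas H (f \o Y).
Proof.
move=> hY mf _ B mB; rewrite setTI; apply: (hY (f @^-1` B)).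
by rewrite -[X in measurable X]setTI; exact: mf.
Qed.

Lemma indic_setI (R : realType) T (A B : set T) x :
  \1_(A `&` B) x = \1_A x * \1_B x :> R.
Proof. by rewrite !indicE in_setI -mulnb natrM. Qed.

Lemma Rintegral_indicM (R : realType) dO (Omega : measurableType dO)
    (Pr : probability Omega R) (D : set Omega) (f : Omega -> R) :
  \int[Pr]_(w in D) f w = Ex Pr (fun w => \1_D w * f w).
Proof.
rewrite Rintegral_mkcond; congr Ex; apply/funext => w.
by rewrite patchE indicE; case: (w \in D); rewrite ?mul1r ?mul0r.
Qed.

Section conditional_orthogonality.
Context (R : realType) (dX : measure_display) (X : measurableType dX).
Context (dO : measure_display) (Omega : measurableType dO).
Variables (Pr : probability Omega R) (Y : {RV Pr >-> X}).

Lemma bmeas_RV (f : X -> R) M : bmeas f M -> bmeas (fun w => f (Y w)) M.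
Proof.
move=> [mf fM]; split=> [|w]; last exact: fM.
exact: measurableT_comp.
Qed.

Lemma mRV (B : set X) : measurable B -> measurable (Y @^-1` B).
Proof.
by move=> mB; rewrite -[X in measurable X]setTI; exact: measurable_funPT.
Qed.

Lemma is_cond_prob_Ex (F : set Omega) (h : X -> R) (B : set X) :
  measurable F -> is_cond_prob Y F h -> measurable B ->
  Ex Pr (fun w => \1_B (Y w) * h (Y w)) =
  Ex Pr (fun w => \1_B (Y w) * \1_F w).
Proof.
move=> mF [_ hF] mB.
have <- : \int[Pr]_(w in Y @^-1` B) h (Y w) = Ex Pr (fun w => \1_B (Y w) * h (Y w)).
  exact: Rintegral_indicM.
rewrite /Rintegral hF // /Ex.
have -> : (fun w => \1_B (Y w) * \1_F w : R) = \1_(F `&` Y @^-1` B).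
  by apply/funext => w; rewrite indic_setI mulrC.
rewrite /Rintegral integral_indic ?setIT //.
by apply: measurableI => //; exact: mRV.
Qed.

(** 1_F - h (Y) integrates to 0 over the events of Y, and [orthogonal_bmeas] replaces these events
    by bounded functions of Y. *)
Lemma is_cond_prob_orthogonal (F : set Omega) (h : X -> R) :
  measurable F -> is_cond_prob Y F h -> (forall y, 0 <= h y <= 1) ->
  forall psi M, bmeas psi M ->
  Ex Pr (fun w => psi (Y w) * (\1_F w - h (Y w))) = 0.
Proof.
move=> mF hF h01 psi M bpsi.
have bh : bmeas h 1.
  split=> [|y]; first by case: hF.
  by have /andP[? ?] := h01 y; rewrite ger0_norm.
pose G : set_system Omega := [set D | exists2 B, measurable B & D = Y @^-1` B].
have iF : L1 Pr (\1_F : Omega -> R) by exact: L1_bmeas (bmeas_indic R mF).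
have ih : L1 Pr (fun w => h (Y w)) by exact: L1_bmeas (bmeas_RV bh).
have iW : L1 Pr (fun w => \1_F w - h (Y w)).
  exact: L1_bmeas (bmeasB (bmeas_indic R mF) (bmeas_RV bh)).
apply: (@orthogonal_bmeas _ _ _ Pr G _ _ _ _ iW) (fun w => bpsi.2 (Y w)).
- by move=> _ [B mB ->]; exact: mRV.
- move=> _ _ [B mB ->] [C mC ->]; exists (B `&` C) => //; exact: measurableI.
- by exists setT.
- move=> _ [B mB ->]; rewrite RintegralB //; last 3 first.
  + exact: mRV.
  + by apply: integrableS iF => //; exact: mRV.
  + by apply: integrableS ih => //; exact: mRV.
  rewrite !Rintegral_indicM; apply/eqP; rewrite subr_eq0; apply/eqP.
  exact/esym/is_cond_prob_Ex.
- apply: gmeas_comp; last by case: bpsi.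
  by move=> B mB; apply: sub_sigma_algebra; exists B.
Qed.

End conditional_orthogonality.

(** * Markov property with the initial iterate in the past *)

Section history.
Context (R : realType) (dX : measure_display) (X : measurableType dX).
Context (P : R.-pker X ~> X) (d : nat).
Context (dO : measure_display) (Omega : measurableType dO).
Context (Pr : probability Omega R) (x : nat -> {RV Pr >-> X}).
Context (u : Omega -> 'cV[R]_d).
Hypothesis markov : markov_chain P x.
Hypothesis mu_ : measurable_mx u.
Hypothesis cindep : cond_independent (x 0%N) (sigma_vec u) (sigma_future x).

Definition past (n : nat) : set_system Omega :=
  g_sigma_preimage (fun i : 'I_n.+1 => x i : Omega -> X).

(** Only a pi-system: on the intersection of E and C the initial iterate and the chain can be
    treated one after the other, and Dynkin's theorem reaches the sigma-algebra that they
    generate. *)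
Definition hist (n : nat) : set_system Omega :=
  [set D | exists E C, [/\ sigma_vec u E, past n C & D = E `&` C]].

Lemma past_mem n i (B : set X) : (i <= n)%N -> measurable B ->
  past n (x i @^-1` B).
Proof.
rewrite -ltnS => hi mB.
by have := @g_sigma_preimage_mem Omega _ X _
  (fun i : 'I_n.+1 => x i : Omega -> X) (Ordinal hi) B mB.
Qed.

Lemma past_measurable n : past n `<=` measurable.
Proof.
have h := @sigma_algebra_measurable _ Omega.
apply: smallest_sub => //.
elim/big_ind: _ => //= [A1 A2 h1 h2 D [/h1|/h2] //|i _ D [B mB <-]].
by rewrite setTI; exact: mRV.
Qed.

Lemma past_S n : past n `<=` past n.+1.
Proof.
by apply: g_sigma_preimage_sub => i B mB; apply: past_mem => //; exact: ltnW.
Qed.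

Lemma sigma_vec_measurable : sigma_vec u `<=` measurable.
Proof.
have h := @sigma_algebra_measurable _ Omega.
apply: smallest_sub => //.
elim/big_ind: _ => //= [A1 A2 h1 h2 D [/h1|/h2] //|i _ D [B mB <-]].
by apply: mu_.
Qed.

Lemma hist_measurable n : hist n `<=` measurable.
Proof.
move=> _ [E [C [/sigma_vec_measurable ? /past_measurable ? ->]]].
exact: measurableI.
Qed.

Lemma histI n : setI_closed (hist n).
Proof.
move=> _ _ [E [C [hE hC ->]]] [E' [C' [hE' hC' ->]]].
exists (E `&` E'), (C `&` C'); split; last by rewrite setIACA.
- exact: sigma_setI.
- exact: sigma_setI.
Qed.

Lemma histT n : hist n setT.
Proof.
exists setT, setT; split; last by rewrite setIT.
- exact: sigma_setT.
- exact: sigma_setT.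
Qed.

Lemma sub_hist_S n : <<s hist n >> `<=` <<s hist n.+1 >>.
Proof.
apply: sub_smallest2r => // _ [E [C [hE hC ->]]].
by exists E, C; split => //; exact: past_S.
Qed.

Lemma sub_hist m n : (m <= n)%N -> <<s hist m >> `<=` <<s hist n >>.
Proof.
move=> /subnK <-; elim: (n - m)%N => // k ih.
by apply: subset_trans ih _; exact: sub_hist_S.
Qed.

Lemma hist_x n i (B : set X) : (i <= n)%N -> measurable B ->
  <<s hist n >> (x i @^-1` B).
Proof.
move=> hi mB; apply: sub_sigma_algebra; exists setT, (x i @^-1` B).
split; [|exact: past_mem|by rewrite setTI].
exact: sigma_setT.
Qed.

Lemma hist_u n i : gmeas (hist n) (fun w => u w i 0).
Proof.
move=> _ B mB; rewrite setTI; apply: sub_sigma_algebra.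
exists ((fun w => u w i 0) @^-1` B), setT; split; last by rewrite setIT.
- by have := @g_sigma_preimage_mem Omega _ R _
    (fun (i : 'I_d) (w : Omega) => u w i 0) i B mB.
- exact: sigma_setT.
Qed.

(** Martingale increment of the chain for the set B; [jump_hist] shows that it stays centered when
    the initial iterate is added to the past. *)
Let jump n (B : set X) (w : Omega) : R := \1_B (x n.+1 w) - op P \1_B (x n w).

Let bmeas_jump n B : measurable B -> bmeas (jump n B) (1 + 1).
Proof.
move=> mB; have b1 := bmeas_indic R mB.
by apply: bmeasB; apply: bmeas_RV => //; exact: bmeas_op.
Qed.

Let jump_past n B C : measurable B -> past n C ->
  \int[Pr]_(w in C) jump n B w = 0.
Proof.
move=> mB hC; have mC := past_measurable hC.
have b1 := bmeas_indic R mB.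
have i1 : L1 Pr (fun w => \1_B (x n.+1 w) : R).
  exact: L1_bmeas (bmeas_RV (x n.+1) b1).
have i2 : L1 Pr (fun w => op P \1_B (x n w)).
  exact: L1_bmeas (bmeas_RV (x n) (bmeas_op P b1)).
rewrite /jump RintegralB //; [|exact: integrableS i1|exact: integrableS i2].
apply/eqP; rewrite subr_eq0; apply/eqP.
transitivity (fine (Pr (C `&` x n.+1 @^-1` B))).
  rewrite /Rintegral -[fun w => (\1_B (x n.+1 w))%:E]/(fun w => (\1_(x n.+1 @^-1` B) w)%:E).
  by rewrite integral_indic //; [rewrite setIC|exact: mRV].
rewrite markov // /Rintegral; congr fine; apply: eq_integral => w _.
rewrite op_indic // fineK // ge0_fin_numE //.
apply: le_lt_trans (le_trans _ (kernelP1 P (x n w))) (ltry _).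
by apply: le_measure; rewrite ?inE.
Qed.

(* Given x_0, the initial iterate is independent of the future: the indicator of
   an event E about it may be replaced by the conditional probability h (x_0),
   which belongs to the past of the chain. *)
Let jump_hist n B D : measurable B -> <<s hist n >> D ->
  \int[Pr]_(w in D) jump n B w = 0.
Proof.
move=> mB; apply: (dynkin_integral0 (@hist_measurable n) (@histI n) (@histT n)).
  exact: L1_bmeas (bmeas_jump n mB).
move=> _ [E [C [hE hC ->]]].
have mE := sigma_vec_measurable hE.
have [h hcp h01] := cond_prob_exists (x 0%N) mE.
have bh : bmeas h 1.
  split=> [|y]; first by case: hcp.
  by have /andP[? ?] := h01 y; rewrite ger0_norm.
have b1C : bmeas (\1_C : Omega -> R) 1.
  by apply: bmeas_indic; exact: past_measurable hC.
(* A pi-system that generates the sigma-algebra of the whole chain: an event of x_0 meets a future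
   event, to which conditional independence given x_0 applies. *)
pose Q : set_system Omega :=
  [set D | exists B0 F, [/\ measurable B0, sigma_future x F &
                            D = x 0%N @^-1` B0 `&` F]].
have mfut : sigma_future x `<=` measurable.
  apply: smallest_sub; first exact: (@sigma_algebra_measurable _ Omega).
  by move=> _ [k _ [B0 mB0 <-]]; rewrite setTI; exact: mRV.
have Qx i B0 : measurable B0 -> <<s Q >> (x i @^-1` B0).
  move=> mB0; apply: sub_sigma_algebra; case: i => [|i].
    by exists B0, setT; split => //; [exact: sigma_setT|rewrite setIT].
  exists setT, (x i.+1 @^-1` B0); split => //; last by rewrite setTI.
  by apply: sub_sigma_algebra; exists i.+1 => //; exists B0; rewrite ?setTI.
have step2 : Ex Pr (fun w => (h (x 0%N w) * \1_C w) * jump n B w) = 0.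
  apply: (@orthogonal_bmeas _ _ _ Pr (past n) _ _ _ _ _ _ _ (1 * 1)).
  - exact: past_measurable.
  - exact: sigma_setI.
  - exact: sigma_setT.
  - exact: L1_bmeas (bmeas_jump n mB).
  - by move=> D0 hD; exact: jump_past.
  - apply: measurable_funM.
      apply: (@gmeas_comp _ _ X _ _ _ (x 0%N) h); last by case: bh.
      by move=> B' mB'; apply: sub_sigma_algebra; exact: past_mem.
    by apply: measurable_indic; apply: sub_sigma_algebra.
  - by move=> w; case: (bmeasM (bmeas_RV (x 0%N) bh) b1C).
(* 1_E - h (x_0) is orthogonal to all bounded functions of the whole chain, in particular to 1_C
   times the jump. *)
have step1 : Ex Pr (fun w => (\1_C w * jump n B w) * (\1_E w - h (x 0%N w))) = 0.
  apply: (@orthogonal_bmeas _ _ _ Pr Q _ _ _ _ _ _ _ (1 * (1 + 1))).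
  - by move=> _ [B0 [F [mB0 /mfut mF ->]]]; apply: measurableI => //; exact: mRV.
  - move=> _ _ [B0 [F [mB0 hF ->]]] [B1 [F1 [mB1 hF1 ->]]].
    exists (B0 `&` B1), (F `&` F1); split; last by rewrite setIACA.
      exact: measurableI.
    exact: sigma_setI.
  - by exists setT, setT; split => //; [exact: sigma_setT|rewrite setIT].
  - exact: L1_bmeas (bmeasB (bmeas_indic R mE) (bmeas_RV (x 0%N) bh)).
  - move=> _ [B0 [F [mB0 hF ->]]].
    have mF := mfut _ hF.
    have [h2 hcp2 h201] := cond_prob_exists (x 0%N) mF.
    have hcp12 := cindep hE hF hcp hcp2.
    have b0 := bmeas_indic R mB0.
    have e1 := is_cond_prob_orthogonal mF hcp2 h201 (bmeasM b0 bh).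
    have e2 := is_cond_prob_Ex (measurableI _ _ mE mF) hcp12 mB0.
    have bE := bmeas_indic R mE; have bF := bmeas_indic R mF.
    have bh2 : bmeas h2 1.
      split=> [|y]; first by case: hcp2.
      by have /andP[? ?] := h201 y; rewrite ger0_norm.
    have r0 := bmeas_RV (x 0%N) b0; have rh := bmeas_RV (x 0%N) bh.
    have rh2 := bmeas_RV (x 0%N) bh2.
    have j1 := L1_bmeas Pr (bmeasM r0 (bmeasM rh rh2)).
    have j2 := L1_bmeas Pr (bmeasM r0 (bmeas_indic R (measurableI _ _ mE mF))).
    have j3 := L1Z (-1) (L1_bmeas Pr (bmeasM (bmeasM r0 rh) (bmeasB bF rh2))).
    have j4 := L1Z (-1) j1.
    rewrite Rintegral_indicM.
    (* 1_F (1_E - h) = (1_E 1_F - h h2) - h (1_F - h2), integrated over an event of x_0: the first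
       part vanishes by conditional independence, the second because h2 is a conditional probability
       of F. *)
    have -> : (fun w => \1_(x 0%N @^-1` B0 `&` F) w * (\1_E w - h (x 0%N w))) =
        (fun w => (\1_B0 (x 0%N w) * \1_(E `&` F) w +
         (-1) * (\1_B0 (x 0%N w) * (h (x 0%N w) * h2 (x 0%N w)))) +
         (-1) * (\1_B0 (x 0%N w) * h (x 0%N w) * (\1_F w - h2 (x 0%N w)))).
      apply/funext => w; rewrite !indic_setI.
      rewrite -[\1_(x 0%N @^-1` B0) w]/(\1_B0 (x 0%N w)); ring.
    rewrite ExD //; last exact: L1D.
    rewrite ExD // !ExZ //; last 1 first.
      exact: L1_bmeas (bmeasM (bmeasM r0 rh) (bmeasB bF rh2)).
    by rewrite e1 e2 mulr0 addr0 mulN1r subrr.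
  - apply: measurable_funM.
      apply: measurable_indic.
      by apply: (g_sigma_preimage_sub _ hC) => i B0; exact: Qx.
    apply: measurable_funB.
      apply: (@gmeas_comp _ _ X _ _ _ (x n.+1)); first exact: Qx.
      exact: measurable_indic.
    apply: (@gmeas_comp _ _ X _ _ _ (x n)); first exact: Qx.
    by case: (bmeas_op P (bmeas_indic R mB)).
  - by move=> w; case: (bmeasM b1C (bmeas_jump n mB)).
rewrite Rintegral_indicM.
have k1 := L1_bmeas Pr (bmeasM (bmeasM b1C (bmeas_jump n mB))
  (bmeasB (bmeas_indic R mE) (bmeas_RV (x 0%N) bh))).
have k2 := L1_bmeas Pr (bmeasM (bmeasM (bmeas_RV (x 0%N) bh) b1C)
  (bmeas_jump n mB)).
rewrite -[RHS](addr0 0) -{1}step1 -step2 -ExD //; congr Ex.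
by apply/funext => w; rewrite !indic_setI; ring.
Qed.

(** The error at time n + 1 is a function of the initial iterate and of x_0, ..., x_n, so that it
    and its products are admissible as Z. For an indicator f the difference of the two sides is the
    mean of Z times a jump, which is 0 by [orthogonal_L1]. *)
Theorem markov_hist n (f : X -> R) M (Z : Omega -> R) :
  bmeas f M -> gmeas (hist n) Z -> L1 Pr Z ->
  Ex Pr (fun w => f (x n.+1 w) * Z w) = Ex Pr (fun w => op P f (x n w) * Z w).
Proof.
move=> bf mZ iZ.
pose phi g := Ex Pr (fun w => g (x n.+1 w) * Z w) -
              Ex Pr (fun w => op P g (x n w) * Z w).
apply/eqP; rewrite -subr_eq0 -/(phi f) -normr_le0.
rewrite [leRHS](_ : 0 = 3 * M * 0); last by rewrite mulr0.
have i1 g N : bmeas g N -> L1 Pr (fun w => g (x n.+1 w) * Z w).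
  by move=> bg; exact: L1_bM (bmeas_RV (x n.+1) bg) iZ.
have i2 g N : bmeas g N -> L1 Pr (fun w => op P g (x n w) * Z w).
  by move=> bg; exact: L1_bM (bmeas_RV (x n) (bmeas_op P bg)) iZ.
have inZ : L1 Pr (fun w => `|Z w|) by exact: integrable_norm iZ.
apply: (@functional_le _ _ _ phi (2 * Ex Pr (fun w => `|Z w|))) bf
    => [g h a N1 N2 bg bh|g N bg|B mB].
- have h1 := i1 _ _ bg; have h2 := i1 _ _ bh.
  have h3 := i2 _ _ bg; have h4 := i2 _ _ bh.
  rewrite /phi (opD P a bg bh).
  have -> : (fun w => (g (x n.+1 w) + a * h (x n.+1 w)) * Z w) =
    (fun w => g (x n.+1 w) * Z w + a * (h (x n.+1 w) * Z w)).
    by apply/funext => w; ring.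
  have -> : (fun w => (op P g (x n w) + a * op P h (x n w)) * Z w) =
    (fun w => op P g (x n w) * Z w + a * (op P h (x n w) * Z w)).
    by apply/funext => w; ring.
  by rewrite !ExD ?ExZ //; [ring|exact: L1Z..].
- apply: le_trans (ler_normB _ _) _.
  have -> : 2 * Ex Pr (fun w => `|Z w|) * N =
      N * Ex Pr (fun w => `|Z w|) + N * Ex Pr (fun w => `|Z w|) by ring.
  rewrite -!ExZ //; apply: lerD; apply: Ex_norm_le; rewrite ?L1Z //.
  + exact: i1 bg.
  + by move=> w; rewrite normrM ler_wpM2r //; case: bg.
  + exact: i2 bg.
  + by move=> w; rewrite normrM ler_wpM2r //; case: (bmeas_op P bg).
- have := orthogonal_L1 (@hist_measurable n) (@histI n) (@histT n)
    (bmeas_jump n mB) _ mZ iZ.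
  rewrite normr_le0 /phi => h.
  have b1 := bmeas_indic R mB.
  rewrite subr_eq0 -subr_eq0 -mulN1r -ExZ; last exact: i2 b1.
  rewrite -ExD; [|exact: i1 b1|exact: L1Z (i2 _ _ b1)].
  rewrite -[X in _ == X]h; last first.
    by move=> D hD; apply: jump_hist => //; exact: sub_sigma_algebra.
  apply/eqP; congr Ex; apply/funext => w; rewrite /jump; ring.
Qed.

End history.

(** * Quadratic forms and norms *)

Section quadratic_forms.
Context (R : realType) (d : nat).
Implicit Types (u v w : 'cV[R]_d) (Q M : 'M[R]_d).

Definition qf Q v w : R := (v^T *m Q *m w) 0 0.

Lemma qfDl Q u v w : qf Q (u + v) w = qf Q u w + qf Q v w.
Proof. by rewrite /qf linearD /= !mulmxDl mxE. Qed.

Lemma qfDr Q u v w : qf Q w (u + v) = qf Q w u + qf Q w v.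
Proof. by rewrite /qf mulmxDr mxE. Qed.

Lemma qfZl Q a v w : qf Q (a *: v) w = a * qf Q v w.
Proof. by rewrite /qf linearZ /= -!scalemxAl mxE. Qed.

Lemma qfZr Q a v w : qf Q v (a *: w) = a * qf Q v w.
Proof. by rewrite /qf -scalemxAr mxE. Qed.

Lemma qf_mulr Q M v w : qf Q v (M *m w) = qf (Q *m M) v w.
Proof. by rewrite /qf !mulmxA. Qed.

Lemma qf_mull Q M v w : qf Q (M *m v) w = qf (M^T *m Q) v w.
Proof. by rewrite /qf trmx_mul !mulmxA. Qed.

Lemma qf_mxD Q M v w : qf (Q + M) v w = qf Q v w + qf M v w.
Proof. by rewrite /qf mulmxDr mulmxDl mxE. Qed.

Lemma qf_mxN Q v w : qf (- Q) v w = - qf Q v w.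
Proof. by rewrite /qf mulmxN mulNmx mxE. Qed.

Lemma qf_mxZ a Q v w : qf (a *: Q) v w = a * qf Q v w.
Proof. by rewrite /qf -scalemxAr -scalemxAl mxE. Qed.

Lemma qfE Q v w : qf Q v w = \sum_i \sum_j Q i j * (v i 0 * w j 0).
Proof.
rewrite /qf mxE exchange_big /=; apply: eq_bigr => j _.
by rewrite mxE mulr_suml; apply: eq_bigr => i _; rewrite !mxE; ring.
Qed.

Lemma qfC Q v w : Q^T = Q -> qf Q v w = qf Q w v.
Proof.
move=> hQ; rewrite !qfE exchange_big /=; apply: eq_bigr => i _.
by apply: eq_bigr => j _; rewrite -[in LHS]hQ mxE; ring.
Qed.

Lemma qf1 v : qf 1%:M v v = \sum_i v i 0 ^+ 2.
Proof. by rewrite /qf mulmx1 mxE; apply: eq_bigr => i _; rewrite mxE expr2. Qed.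

(** Semidefinite and not definite, because lam I - Gamma in [qf_le_gmax] is a limiting case;
    Cauchy-Schwarz must therefore handle vectors on which the form vanishes. *)
Definition psd Q : Prop := Q^T = Q /\ forall v, 0 <= qf Q v v.

Lemma psd1 : psd 1%:M.
Proof.
split; first exact: trmx1.
by move=> v; rewrite qf1 sumr_ge0 // => i _; exact: sqr_ge0.
Qed.

Lemma qf_cauchy_schwarz Q v w : psd Q ->
  qf Q v w ^+ 2 <= qf Q v v * qf Q w w.
Proof.
move=> [sQ pQ].
have h t : 0 <= qf Q v v + 2 * t * qf Q v w + t ^+ 2 * qf Q w w.
  have := pQ (v + t *: w).
  rewrite qfDl !qfDr !qfZl !qfZr (qfC w v sQ).
  by move: (qf Q v v) (qf Q v w) (qf Q w w) => a b c; lra.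
have := pQ v; have := pQ w.
move: (qf Q v v) (qf Q v w) (qf Q w w) h => a b c h c0 a0.
have [c00|cn0] := eqVneq c 0.
  have [->|b0] := eqVneq b 0; first by rewrite expr0n /= mulr_ge0.
  (* At c = 0 the quadratic in t is affine and takes the value -1 at this t. *)
  have := h (- (a + 1) / (2 * b)).
  rewrite c00 mulr0 addr0.
  have -> : 2 * (- (a + 1) / (2 * b)) * b = - (a + 1) by field.
  by lra.
have := h (- b / c).
have -> : a + 2 * (- b / c) * b + (- b / c) ^+ 2 * c = (a * c - b ^+ 2) / c by field.
by rewrite pmulr_lge0 ?invr_gt0 ?lt_def ?cn0 // subr_ge0.
Qed.

Definition qnorm Q v : R := Num.sqrt (qf Q v v).

Lemma qnorm_ge0 Q v : 0 <= qnorm Q v.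
Proof. exact: sqrtr_ge0. Qed.

Lemma sqr_qnorm Q v : psd Q -> qnorm Q v ^+ 2 = qf Q v v.
Proof. by move=> [_ pQ]; rewrite sqr_sqrtr. Qed.

Lemma qf_le_qnorm Q v w : psd Q -> `|qf Q v w| <= qnorm Q v * qnorm Q w.
Proof.
move=> pQ; rewrite -ler_sqr ?nnegrE ?mulr_ge0 ?qnorm_ge0 //.
by rewrite exprMn !sqr_qnorm // real_normK ?num_real // qf_cauchy_schwarz.
Qed.

Lemma qnormD Q v w : psd Q -> qnorm Q (v + w) <= qnorm Q v + qnorm Q w.
Proof.
move=> pQ; rewrite -ler_sqr ?nnegrE ?addr_ge0 ?qnorm_ge0 //.
rewrite sqr_qnorm // sqrrD !sqr_qnorm // qfDl !qfDr (qfC w v pQ.1).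
have := qf_le_qnorm v w pQ; rewrite ler_norml => /andP[_ h].
by rewrite -mulr_natl; lra.
Qed.

Lemma qnormZ Q a v : qnorm Q (a *: v) = `|a| * qnorm Q v.
Proof.
by rewrite /qnorm qfZl qfZr mulrA -expr2 sqrtrM ?sqr_ge0 // sqrtr_sqr.
Qed.

Lemma l2norm_qnorm v : l2norm v = qnorm 1%:M v.
Proof. by rewrite /l2norm /qnorm qf1. Qed.

Lemma l2norm_ge0 v : 0 <= l2norm v.
Proof. exact: sqrtr_ge0. Qed.

Lemma sqr_l2norm v : l2norm v ^+ 2 = \sum_i v i 0 ^+ 2.
Proof. by rewrite l2norm_qnorm sqr_qnorm ?qf1 //; exact: psd1. Qed.

Lemma l2normD v w : l2norm (v + w) <= l2norm v + l2norm w.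
Proof. by rewrite !l2norm_qnorm qnormD //; exact: psd1. Qed.

Lemma l2normZ a v : l2norm (a *: v) = `|a| * l2norm v.
Proof. by rewrite !l2norm_qnorm qnormZ. Qed.

Lemma l2normN v : l2norm (- v) = l2norm v.
Proof. by rewrite -scaleN1r l2normZ normrN normr1 mul1r. Qed.

Lemma l2norm0 : l2norm (0 : 'cV[R]_d) = 0.
Proof. by rewrite -(scale0r (0 : 'cV[R]_d)) l2normZ normr0 mul0r. Qed.

Lemma l2norm_eq0 v : l2norm v = 0 -> v = 0.
Proof.
move=> h; have := sqr_l2norm v; rewrite h expr0n /=.
move/esym/eqP; rewrite psumr_eq0 => [/allP h0|i _]; last exact: sqr_ge0.
apply/colP => i; rewrite mxE; apply/eqP; rewrite -sqrf_eq0.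
by apply: h0; rewrite mem_index_enum.
Qed.

Lemma ler_abs_l2norm v i : `|v i 0| <= l2norm v.
Proof.
rewrite -ler_sqr ?nnegrE ?l2norm_ge0 // sqr_l2norm real_normK ?num_real //.
by rewrite (bigD1 i) //= lerDl sumr_ge0 // => j _; exact: sqr_ge0.
Qed.

Lemma l2norm_le_sum v : l2norm v <= \sum_i `|v i 0|.
Proof.
have s0 : 0 <= \sum_i `|v i 0| by apply: sumr_ge0.
rewrite -ler_sqr ?nnegrE ?l2norm_ge0 // sqr_l2norm expr2 mulr_suml.
apply: ler_sum => i _; rewrite -real_normK ?num_real // expr2.
by apply: ler_wpM2l => //; rewrite (bigD1 i) //= lerDl sumr_ge0.
Qed.

Lemma l2norm_le_bound v c : (forall i, `|v i 0| <= c) -> l2norm v <= d%:R * c.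
Proof.
move=> h; apply: le_trans (l2norm_le_sum v) _.
apply: le_trans (ler_sum _ (fun i _ => h i)) _.
by rewrite sumr_const card_ord mulr_natl.
Qed.

End quadratic_forms.

(** * Spectral norm *)

Section operator_norm.
Context (R : realType) (m n : nat).
Implicit Types (M : 'M[R]_(m, n)) (v : 'cV[R]_n).

(** A crude majorant of [opnorm]. It shows first that the set under the supremum is bounded:
    otherwise [sup] would return 0. *)
Definition entry_sum M : R := \sum_i \sum_j `|M i j|.

Lemma entry_sum_ge0 M : 0 <= entry_sum M.
Proof. by apply: sumr_ge0 => i _; apply: sumr_ge0. Qed.

Lemma l2norm_mulmx_le M v : l2norm (M *m v) <= entry_sum M * l2norm v.
Proof.
apply: le_trans (l2norm_le_sum _) _; rewrite mulr_suml.
apply: ler_sum => i _; rewrite mxE mulr_suml.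
apply: le_trans (ler_norm_sum _ _ _) _; apply: ler_sum => j _.
by rewrite normrM ler_wpM2l // ler_abs_l2norm.
Qed.

Let opset M := [set l2norm (M *m v) | v in [set v : 'cV[R]_n | l2norm v <= 1]].

Let opset_ub M : ubound (opset M) (entry_sum M).
Proof.
move=> _ [v /= hv <-]; apply: le_trans (l2norm_mulmx_le _ _) _.
by rewrite ler_piMr // entry_sum_ge0.
Qed.

Let opset_sup M : has_sup (opset M).
Proof.
split; last by exists (entry_sum M); exact: opset_ub.
by exists (l2norm (M *m 0)); exists 0 => //=; rewrite l2norm0.
Qed.

Lemma opnorm_ge0 M : 0 <= opnorm M.
Proof.
apply: (ub_le_sup (opset_sup M).2); exists 0; rewrite /= ?l2norm0 //.
by rewrite mulmx0 l2norm0.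
Qed.

Lemma opnorm_le M c : 0 <= c ->
  (forall v, l2norm (M *m v) <= c * l2norm v) -> opnorm M <= c.
Proof.
move=> c0 h; apply: ge_sup (opset_sup M).1 _ => _ [v /= hv <-].
by apply: le_trans (h v) _; rewrite ler_piMr.
Qed.

Lemma l2norm_opnorm M v : l2norm (M *m v) <= opnorm M * l2norm v.
Proof.
have [v0|vn0] := eqVneq (l2norm v) 0.
  by rewrite (l2norm_eq0 v0) mulmx0 !l2norm0 mulr0.
have vpos : 0 < l2norm v by rewrite lt_def vn0 l2norm_ge0.
rewrite -ler_pdivrMr //.
have -> : l2norm (M *m v) / l2norm v = l2norm (M *m ((l2norm v)^-1 *: v)).
  by rewrite -scalemxAr l2normZ ger0_norm ?invr_ge0 ?l2norm_ge0 // mulrC.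
apply: (ub_le_sup (opset_sup M).2); exists ((l2norm v)^-1 *: v) => //=.
by rewrite l2normZ ger0_norm ?invr_ge0 ?l2norm_ge0 // mulVf.
Qed.

Lemma opnorm_le_entry_sum M : opnorm M <= entry_sum M.
Proof.
by apply: opnorm_le; [exact: entry_sum_ge0|exact: l2norm_mulmx_le].
Qed.

Lemma l2norm_delta j : l2norm (delta_mx j 0 : 'cV[R]_n) = 1.
Proof.
rewrite /l2norm (bigD1 j) //= big1 => [|i ij]; last first.
  by rewrite mxE (negbTE ij) expr0n.
by rewrite mxE !eqxx addr0 expr1n sqrtr1.
Qed.

Lemma ler_abs_opnorm M i j : `|M i j| <= opnorm M.
Proof.
have := l2norm_opnorm M (delta_mx j 0); rewrite l2norm_delta mulr1.
apply: le_trans; rewrite -colE.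
by have := ler_abs_l2norm (col j M) i; rewrite mxE.
Qed.

End operator_norm.

(** * The Lyapunov norm and its contraction by the mean matrix *)

Section lyapunov.
Context (R : realType) (d : nat).
Implicit Types (v w : 'cV[R]_d) (M Q : 'M[R]_d).

(** Without diagonalization: invertibility gives |v| <= K |M v|, and Cauchy-Schwarz for the form of
    M, between v and M v, gives |M v|^4 <= L |M v|^2 times the value of the form at v. *)
Lemma psd_unit_lower M : psd M -> M \in unitmx ->
  exists2 c : R, 0 < c & forall v, c * l2norm v ^+ 2 <= qf M v v.
Proof.
move=> pM uM.
pose K := entry_sum (invmx M) + 1; pose L := entry_sum M + 1.
have K0 : 0 < K by have := entry_sum_ge0 (invmx M); rewrite /K; lra.
have L0 : 0 < L by have := entry_sum_ge0 M; rewrite /L; lra.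
exists (K ^+ 2 * L)^-1; first by rewrite invr_gt0 mulr_gt0 // exprn_gt0.
move=> v; rewrite mulrC ler_pdivrMr ?mulr_gt0 ?exprn_gt0 //.
have h1 : l2norm v <= K * l2norm (M *m v).
  rewrite -[in leLHS](mul1mx v) -(mulVmx uM) -mulmxA.
  apply: le_trans (l2norm_mulmx_le _ _) _.
  by rewrite ler_wpM2r ?l2norm_ge0 // /K lerDl.
have h2 : qf M (M *m v) (M *m v) <= L * l2norm (M *m v) ^+ 2.
  apply: (@le_trans _ _ (`|qf 1%:M (M *m v) (M *m (M *m v))|)).
    by rewrite [in leRHS]qf_mulr mul1mx ler_norm.
  apply: le_trans (qf_le_qnorm _ _ (psd1 _ _)) _; rewrite -!l2norm_qnorm.
  rewrite mulrC expr2 mulrA ler_wpM2r ?l2norm_ge0 //.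
  apply: le_trans (l2norm_mulmx_le _ _) _.
  by rewrite ler_wpM2r ?l2norm_ge0 // /L lerDl.
have h3 : l2norm (M *m v) ^+ 2 <= L * qf M v v.
  set t := l2norm (M *m v) ^+ 2 in h2 *.
  have e : qf M v (M *m v) = t.
    by rewrite /t l2norm_qnorm sqr_qnorm ?qf_mull ?pM.1 ?mulmx1; [rewrite /qf mulmxA|exact: psd1].
  have := qf_cauchy_schwarz v (M *m v) pM; rewrite e => h.
  have [t0|tn0] := eqVneq t 0; first by rewrite t0 mulr_ge0 ?(pM.2 v) // ltW.
  have tp : 0 < t by rewrite lt_def tn0 /t sqr_ge0.
  rewrite -(ler_pM2r tp) -expr2; apply: le_trans h _.
  by rewrite (mulrC L) -mulrA; apply: ler_wpM2l => //; exact: pM.2.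
apply: (@le_trans _ _ ((K * l2norm (M *m v)) ^+ 2)).
  by rewrite ler_sqr ?nnegrE ?l2norm_ge0 ?mulr_ge0 ?l2norm_ge0 // ltW.
rewrite [leRHS]mulrC -mulrA exprMn; apply: ler_wpM2l h3; exact: sqr_ge0.
Qed.

Lemma not_unit_eigenvalue M a : M - a%:M \notin unitmx -> eigenvalue M a.
Proof. by rewrite /eigenvalue /eigenspace kermx_eq0 -row_free_unit. Qed.

Variables (Gamma : 'M[R]_d) (gmax : R).
Hypothesis hGsym : Gamma^T = Gamma.
Hypothesis hGpos : posdefmx Gamma.
Hypothesis hgmax : max_eigenvalue Gamma gmax.

Lemma psd_posdef : psd Gamma.
Proof.
split=> // v; have [->|v0] := eqVneq v 0; last exact/ltW/hGpos.
by rewrite -(scale0r (0 : 'cV[R]_d)) qfZl mul0r.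
Qed.

Lemma posdef_unit : Gamma \in unitmx.
Proof.
apply: contraT; rewrite -row_free_unit -kermx_eq0 => /rowV0Pn[v /sub_kermxP vG v0].
have := hGpos (v := v^T); rewrite trmxK vG mul0mx mxE ltxx => h.
by have : false by apply: h; apply: contra v0 => /eqP e; rewrite -(trmxK v) e trmx0.
Qed.

Lemma posdef_lower :
  exists2 c : R, 0 < c & forall v, c * l2norm v ^+ 2 <= qf Gamma v v.
Proof. exact: psd_unit_lower psd_posdef posdef_unit. Qed.

(* If the supremum lam of the quadratic form on the unit ball were not an
   eigenvalue, lam I - Gamma would be invertible, hence bounded below. *)
Lemma qf_le_gmax v : qf Gamma v v <= gmax * l2norm v ^+ 2.
Proof.
pose S := [set qf Gamma v v | v in [set v : 'cV[R]_d | l2norm v <= 1]].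
have qle v' : qf Gamma v' v' <= entry_sum Gamma * l2norm v' ^+ 2.
  apply: (@le_trans _ _ (`|qf 1%:M v' (Gamma *m v')|)).
    by rewrite [in leRHS]qf_mulr mul1mx ler_norm.
  apply: le_trans (qf_le_qnorm _ _ (psd1 _ _)) _; rewrite -!l2norm_qnorm.
  by rewrite mulrC expr2 mulrA ler_wpM2r ?l2norm_ge0 // l2norm_mulmx_le.
have hS : has_sup S.
  split; first by exists (qf Gamma 0 0); exists 0 => //=; rewrite l2norm0.
  exists (entry_sum Gamma) => _ [w /= hw <-]; apply: le_trans (qle w) _.
  by rewrite ler_piMr ?entry_sum_ge0 // expr_le1 // l2norm_ge0.
pose lam := sup S.
have lamle w : qf Gamma w w <= lam * l2norm w ^+ 2.
  have [w0|wn0] := eqVneq (l2norm w) 0.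
    by have := qle w; rewrite w0 expr0n /= !mulr0.
  have wp : 0 < l2norm w by rewrite lt_def wn0 l2norm_ge0.
  rewrite -ler_pdivrMr ?exprn_gt0 //.
  apply: (ub_le_sup hS.2); exists ((l2norm w)^-1 *: w).
    by rewrite /= l2normZ ger0_norm ?invr_ge0 ?l2norm_ge0 // mulVf.
  by rewrite qfZl qfZr mulrA -expr2 exprVn mulrC.
suff : eigenvalue Gamma lam.
  move=> /hgmax.2 h; apply: le_trans (lamle v) _.
  by rewrite ler_wpM2r // sqr_ge0.
have lam0 : 0 < lam.
  have [/eigenvalueP[w _ w0] _] := hgmax.
  have w0' : w^T != 0 by apply: contra w0 => /eqP e; rewrite -(trmxK w) e trmx0.
  have h1 := hGpos w0'; have h2 := lamle w^T.
  have h3 : 0 <= l2norm w^T ^+ 2 by exact: sqr_ge0.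
  rewrite ltNge; apply/negP => l0.
  have : lam * l2norm w^T ^+ 2 <= 0 by exact: mulr_le0_ge0.
  by move: h1 h2; rewrite -/(qf Gamma w^T w^T); lra.
apply: not_unit_eigenvalue; apply/negP => uM.
pose M := lam%:M - Gamma.
have qM w : qf M w w = lam * l2norm w ^+ 2 - qf Gamma w w.
  rewrite /M qf_mxD qf_mxN -(scalemx1 _ lam) qf_mxZ; congr (_ * _ - _).
  by rewrite l2norm_qnorm sqr_qnorm //; exact: psd1.
have pM : psd M.
  split; first by rewrite /M linearB /= tr_scalar_mx hGsym.
  by move=> w; rewrite qM subr_ge0.
have uM' : M \in unitmx by rewrite /M -opprB -scaleN1r unitmxZ ?unitrN1.
have [c c0 hc] := psd_unit_lower pM uM'.
(* A lower bound c |w|^2 on the form of lam I - Gamma would bring the supremum of the form of Gamma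
   down to one of these two values, both below lam; the 0 covers the case lam < c. *)
have : lam <= Num.max (lam - c) 0.
  apply: ge_sup hS.1 _ => _ [w /= hw <-].
  have h1 := hc w; rewrite qM in h1.
  have h2 : qf Gamma w w <= (lam - c) * l2norm w ^+ 2 by lra.
  have h3 : 0 <= l2norm w ^+ 2 by exact: sqr_ge0.
  have h4 : l2norm w ^+ 2 <= 1 by rewrite expr_le1 // l2norm_ge0.
  apply: le_trans h2 _; rewrite le_max.
  by have [lc|lc] := leP 0 (lam - c); apply/orP; [left|right]; nra.
by rewrite le_max; lra.
Qed.

Lemma qnorm_le_l2norm v : qnorm Gamma v <= Num.sqrt gmax * l2norm v.
Proof.
rewrite -(@ger0_norm _ (l2norm v)) ?l2norm_ge0 // -sqrtr_sqr.
have [g0|g0] := leP 0 gmax.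
  by rewrite -sqrtrM // ler_wsqrtr // qf_le_gmax.
have := qf_le_gmax v; have := psd_posdef.2 v.
have := sqr_ge0 (l2norm v) => h1 h2 h3.
have -> : qnorm Gamma v = 0.
  rewrite /qnorm; have -> : qf Gamma v v = 0 by nra.
  by rewrite sqrtr0.
by rewrite mulr_ge0 // sqrtr_ge0.
Qed.

Variable Abar : 'M[R]_d.
Hypothesis hGlyap : Abar^T *m Gamma + Gamma *m Abar = - 1%:M.
Hypothesis hAbar : forall v, l2norm (Abar *m v) <= l2norm v.

(** The Lyapunov equation gives |v|^2 = - 2 v^T Gamma Abar v, at most 2 gmax |v|^2 because Abar does
    not increase norms. This keeps quantities such as beta / (4 gmax) below 1 and turns bounds on
    gmax beta into bounds on beta. *)
Lemma gmax_ge : 2^-1 <= gmax.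
Proof.
have [/eigenvalueP[w _ w0] _] := hgmax.
have w0' : w^T != 0 by apply: contra w0 => /eqP e; rewrite -(trmxK w) e trmx0.
set v := w^T in w0'.
have vp : 0 < l2norm v.
  rewrite lt_def l2norm_ge0 andbT; apply: contra w0' => /eqP.
  by move=> /l2norm_eq0 ->.
have g0 : 0 <= gmax.
  have h1 := hGpos w0'; have h2 := qf_le_gmax v; rewrite /qf in h2.
  have h3 : 0 < l2norm v ^+ 2 by rewrite exprn_gt0.
  rewrite leNgt; apply/negP => g0; have : gmax * l2norm v ^+ 2 < 0 by nra.
  by lra.
have : 2 * qf Gamma v (Abar *m v) = - l2norm v ^+ 2.
  rewrite l2norm_qnorm sqr_qnorm; last exact: psd1.
  rewrite -qf_mxN -hGlyap qf_mxD -qf_mull -qf_mulr.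
  rewrite (qfC (Abar *m v)) //; ring.
have := qf_le_qnorm v (Abar *m v) psd_posdef; rewrite ler_norml => /andP[h1 _].
have h2 := qnorm_le_l2norm v; have h3 := qnorm_le_l2norm (Abar *m v).
have h4 : qnorm Gamma v * qnorm Gamma (Abar *m v) <= gmax * l2norm v ^+ 2.
  have -> : gmax * l2norm v ^+ 2 =
      (Num.sqrt gmax * l2norm v) * (Num.sqrt gmax * l2norm v).
    by rewrite -[in LHS](sqr_sqrtr g0); ring.
  apply: ler_pM => //; rewrite ?qnorm_ge0 //; apply: le_trans h3 _.
  by rewrite ler_wpM2l // sqrtr_ge0.
have : 0 < l2norm v ^+ 2 by rewrite exprn_gt0.
move: h1 h4; move: (qnorm _ _ * qnorm _ _) (l2norm v ^+ 2) (qf _ _ _).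
by move=> a s q h1 h4 s0 e; nra.
Qed.

Lemma lyapunov_cross v : 2 * qf Gamma v (Abar *m v) = - l2norm v ^+ 2.
Proof.
rewrite l2norm_qnorm sqr_qnorm; last exact: psd1.
rewrite -qf_mxN -hGlyap qf_mxD -qf_mull -qf_mulr (qfC (Abar *m v) v hGsym).
ring.
Qed.

Lemma lyapunov_step (a : R) v :
  qf Gamma (v + a *: (Abar *m v)) (v + a *: (Abar *m v)) =
  qf Gamma v v - a * l2norm v ^+ 2 + a ^+ 2 * qf Gamma (Abar *m v) (Abar *m v).
Proof.
rewrite -mulrN -lyapunov_cross qfDl !qfDr !qfZl !qfZr (qfC (Abar *m v) v hGsym).
ring.
Qed.

(* sqrt (1 - a / g (1 - a g)) <= 1 - a / (3 g) for small a. *)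
Lemma lyapunov_contraction (a : R) v : 0 < a -> a * gmax <= 9^-1 ->
  qnorm Gamma (v + a *: (Abar *m v)) <= (1 - a / (3 * gmax)) * qnorm Gamma v.
Proof.
move=> a0 ag; have g2 := gmax_ge.
have g0 : 0 < gmax by lra.
have ag' : a / (3 * gmax) <= 27^-1 * 4.
  rewrite ler_pdivrMr; last by lra.
  nra.
have t0 : 0 < a / (3 * gmax) by rewrite divr_gt0 //; lra.
rewrite -ler_sqr ?nnegrE ?mulr_ge0 ?qnorm_ge0 //; [|lra].
rewrite exprMn !sqr_qnorm; [|exact: psd_posdef..].
rewrite lyapunov_step.
have h1 := qf_le_gmax v; have h2 := qf_le_gmax (Abar *m v).
have h3 : l2norm (Abar *m v) ^+ 2 <= l2norm v ^+ 2.
  by rewrite ler_sqr ?nnegrE ?l2norm_ge0.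
set t := a / (3 * gmax) in ag' t0 *.
have ea : a = t * (3 * gmax) by rewrite /t; field; rewrite gt_eqF.
have := psd_posdef.2 v; have := sqr_ge0 (l2norm v).
rewrite ea in ag *.
move: t0 ag' ag h1 h2 h3; rewrite {ea a0}; move: t => {a} t.
move: (qf Gamma v v) (qf Gamma (Abar *m v) (Abar *m v)) => q q'.
move: (l2norm v ^+ 2) (l2norm (Abar *m v) ^+ 2) => s s'.
move=> t0 t1 t2 h1 h2 h3 s0 q0.
have h4 : q' <= gmax * s by apply: le_trans h2 _; rewrite ler_pM2l.
have h5 : (t * (3 * gmax)) ^+ 2 * q' <= gmax * t * s / 3.
  apply: (@le_trans _ _ ((t * (3 * gmax)) ^+ 2 * (gmax * s))).
    by rewrite ler_wpM2l // sqr_ge0.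
  have -> : (t * (3 * gmax)) ^+ 2 * (gmax * s) =
     (t * (3 * gmax) * gmax) * (3 * (gmax * t * s)) by ring.
  have : 0 <= gmax * t * s by rewrite !mulr_ge0 // ltW.
  move: t2; move: (t * (3 * gmax) * gmax) (gmax * t * s) => y z.
  by move=> h z0; nra.
have h6 : t * q <= gmax * t * s.
  by rewrite (mulrC gmax) -mulrA ler_wpM2l // ltW.
have h7 : 0 <= t ^+ 2 * q by rewrite mulr_ge0 // sqr_ge0.
have h8 : 0 <= gmax * t * s by rewrite !mulr_ge0 // ltW.
have -> : (1 - t) ^+ 2 * q = q - 2 * (t * q) + t ^+ 2 * q by ring.
have -> : t * (3 * gmax) * s = 3 * (gmax * t * s) by ring.
by lra.
Qed.

End lyapunov.

(** * Deterministic recursions *)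

Section sequences.
Context (R : realType).
Implicit Types (x y : nat -> R).

Lemma affine_recursion y (p c s : R) : 0 <= p < 1 -> 0 <= s ->
  (forall n, y n.+1 <= p * y n + s) -> s <= c * (1 - p) ->
  forall n, y n <= p ^+ n * y 0%N + c.
Proof.
move=> /andP[p0 p1] s0 hy hc.
have c0 : 0 <= c by rewrite -(@pmulr_lge0 _ (1 - p)) ?subr_gt0 //; lra.
elim=> [|n ih]; first by rewrite expr0 mul1r lerDl.
apply: le_trans (hy n) _; rewrite exprS.
have := ler_wpM2l p0 ih; rewrite -mulrA; lra.
Qed.

(** The partial sums shifted down and up by the tail bound K rho^n / (1 - rho) are the ends of
    nested intervals. Taking as limit the supremum of the lower ends gives the rate at once. *)
Lemma geometric_limit (u : nat -> R) (K rho : R) : 0 < rho < 1 ->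
  (forall k, `|u k| <= K * rho ^+ k) ->
  exists l : R, forall n, `|\sum_(k < n) u k - l| <= K / (1 - rho) * rho ^+ n.
Proof.
move=> /andP[r0 r1] hu.
have K0 : 0 <= K by have := hu 0%N; rewrite expr0 mulr1; apply: le_trans.
pose K' := K / (1 - rho).
have K'0 : 0 <= K' by rewrite divr_ge0 // subr_ge0 ltW.
have K'E : K = K' * (1 - rho) by rewrite /K' divfK // subr_eq0 gt_eqF.
pose S n := \sum_(k < n) u k.
have SS n : S n.+1 = S n + u n by rewrite /S big_ord_recr.
pose a n := S n - K' * rho ^+ n; pose b n := S n + K' * rho ^+ n.
have stp n : a n <= a n.+1 /\ b n.+1 <= b n.
  have := hu n; rewrite ler_norml => /andP[h1 h2].
  rewrite /a /b SS exprS; rewrite K'E in h1 h2.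
  by split; move: h1 h2; move: (rho ^+ n) (S n) (u n) => *; lra.
have am m n : a m <= a (m + n)%N.
  elim: n => [|n ih]; rewrite ?addn0 // addnS.
  exact: le_trans ih (stp _).1.
have bm m n : b (m + n)%N <= b m.
  elim: n => [|n ih]; rewrite ?addn0 // addnS.
  exact: le_trans (stp _).2 ih.
have ab m n : a m <= b n.
  apply: le_trans (am m n) _; apply: (@le_trans _ _ (b (m + n)%N)).
    have : 0 <= K' * rho ^+ (m + n) by rewrite mulr_ge0 // exprn_ge0 // ltW.
    by rewrite /a /b; move: (K' * _) (S _) => *; lra.
  by rewrite addnC; exact: bm.
have hs : has_sup (range a).
  split; first by exists (a 0%N); exists 0%N.
  by exists (b 0%N) => _ [m _ <-]; exact: ab.
exists (sup (range a)) => n.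
have h1 : a n <= sup (range a) by apply: (ub_le_sup hs.2); exists n.
have h2 : sup (range a) <= b n by apply: ge_sup hs.1 _ => _ [m _ <-]; exact: ab.
rewrite ler_norml -/(S n) -/K'; move: h1 h2; rewrite /a /b.
by move: (K' * _) (S n) (sup _) => *; apply/andP; split; lra.
Qed.

(* The slow sequence E contracts at rate 1 - beta / (3 g), the fast one U at
   rate rho; 2 r ^ n - rho ^ n absorbs the source rho ^ n of E, which is not
   of order beta. *)
Lemma slow_fast_bound (K rho g : R) : 0 < K -> 0 < rho < 1 -> 0 < g ->
  exists beta0 C : R, [/\ 0 < beta0, 0 <= C &
    forall (beta S tau : R) (E U : nat -> R), 0 < beta <= beta0 ->
    0 <= S -> 0 <= tau ->
    E 0%N <= K * S -> U 0%N <= K * S ->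
    (forall n, E n.+1 <= (1 - beta / (3 * g)) * E n + beta * K * U n +
                         K * S * rho ^+ n) ->
    (forall n, U n.+1 <= rho * U n + beta * K * (E n + U n) +
                         K * (S * (1 - beta / (4 * g)) ^+ n + tau)) ->
    forall n, E n <= C * (S * (1 - beta / (4 * g)) ^+ n + tau) /\
              U n <= C * (S * (1 - beta / (4 * g)) ^+ n + tau)].
Proof.
move=> K0 /andP[r0 r1] g0.
(* U will be bounded by D2, and E by D1, times the same sequence. In D2 the K + 1 pays for the
   source and for the coupling, which beta0 makes at most 1. Then D1 absorbs K D2, and beta0 comes
   last, with beta K (D1 + D2) <= 1. *)
pose D2 := 2 * (K + 1) / (1 - rho) + K.
pose D1 := 12 * g * K * D2 + 2 * K / (1 - rho) + K.
have r1' : 0 < 1 - rho by lra.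
have D20 : 0 < D2.
  rewrite /D2; apply: addr_gt0 => //; apply: divr_gt0 => //; lra.
have D2K : K + 1 <= D2 * (1 - rho) / 2.
  have -> : D2 * (1 - rho) / 2 = K + 1 + K * (1 - rho) / 2.
    by rewrite /D2; field; rewrite gt_eqF.
  have : 0 < K * (1 - rho) by exact: mulr_gt0.
  lra.
have f1 : 0 < 12 * g * K * D2 by rewrite !mulr_gt0.
have f2 : 0 < 2 * K / (1 - rho) by apply: divr_gt0 => //; lra.
have D10 : 0 < D1 by rewrite /D1; lra.
have D1a : K * D2 <= D1 / (12 * g).
  rewrite ler_pdivlMr ?mulr_gt0 //.
  have -> : K * D2 * (12 * g) = 12 * g * K * D2 by ring.
  by rewrite /D1; lra.
have D1b : K <= D1 * (1 - rho) / 2.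
  have -> : K = 2 * K / (1 - rho) * (1 - rho) / 2 by field; rewrite gt_eqF.
  rewrite ler_pM2r // ler_pM2r //; rewrite /D1; lra.
pose beta0 := Num.min (Num.min 1 (3 * g * ((1 - rho) / 2)))
                      (K * (D1 + D2))^-1.
have b00 : 0 < beta0.
  rewrite /beta0 !lt_min ltr01 /= invr_gt0 !mulr_gt0 //; lra.
exists beta0, (2 * (D1 + D2)); split=> //; first by lra.
move=> beta S tau E U /andP[b0]; rewrite /beta0 !le_min => /andP[/andP[b1 bg] bD].
move=> S0 t0 hE0 hU0 hE hU.
have bKD : beta * K * (D1 + D2) <= 1.
  by rewrite -mulrA -ler_pdivlMr ?mulr_gt0 ?mul1r //; lra.
set q := 1 - beta / (3 * g) in hE; set r := 1 - beta / (4 * g) in hU *.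
have qrho : (1 + rho) / 2 <= q.
  have : beta / (3 * g) <= (1 - rho) / 2.
    by rewrite ler_pdivrMr ?mulr_gt0 // mulrC.
  rewrite /q; lra.
(* The gap between the two rates: q = 1 - 4 t and r = 1 - 3 t. *)
pose t := beta / (12 * g).
have t0' : 0 < t by rewrite divr_gt0 // mulr_gt0.
have qE : q = 1 - 4 * t by rewrite /q /t; field; rewrite gt_eqF.
have rE : r = 1 - 3 * t by rewrite /r /t; field; rewrite gt_eqF.
have q0 : 0 < q by lra.
pose s n := 2 * r ^+ n - rho ^+ n.
have rn n : 0 <= rho ^+ n <= r ^+ n.
  by rewrite exprn_ge0 ?(ltW r0) //= lerXn2r ?nnegrE; lra.
have sr n : r ^+ n <= s n <= 2 * r ^+ n.
  by have /andP[h1 h2] := rn n; rewrite /s; apply/andP; split; lra.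
(* Since r - q = t and q - rho >= (1 - rho) / 2, the sequence s decays slower than rate q by a
   multiple of t r^n, available for the coupling, and a multiple of rho^n, available for the
   source. *)
have ss n : q * s n + 2 * t * r ^+ n + (1 - rho) / 2 * rho ^+ n <= s n.+1.
  have /andP[h1 h2] := rn n.
  rewrite /s !exprS rE qE; rewrite qE in qrho.
  move: h1 h2; rewrite rE; move: (rho ^+ n) ((1 - 3 * t) ^+ n) => x y h1 h2.
  have : 0 <= (1 - 4 * t - (1 + rho) / 2) * x by rewrite mulr_ge0 // subr_ge0.
  lra.
have bt : beta * K * D2 <= D1 * t.
  have -> : beta * K * D2 = beta * (K * D2) by ring.
  have -> : D1 * t = beta * (D1 / (12 * g)) by rewrite /t; field; rewrite gt_eqF.
  by rewrite ler_pM2l.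
have q1 : q <= 1 by rewrite qE; lra.
suff main n : E n <= D1 * (S * s n + tau) /\ U n <= D2 * (S * s n + tau).
  move=> n; have [h1 h2] := main n.
  have h3 : S * s n + tau <= 2 * (S * r ^+ n + tau).
    have /andP[_ h] := sr n; have := ler_wpM2l S0 h; lra.
  have h0 : 0 <= S * r ^+ n + tau.
    have /andP[k1 k2] := rn n; have : 0 <= S * r ^+ n by apply: mulr_ge0 => //; lra.
    lra.
  split.
    apply: le_trans h1 _; have := ler_wpM2l (ltW D10) h3.
    have : 0 <= D2 * (S * r ^+ n + tau) by apply: mulr_ge0 => //; lra.
    lra.
  apply: le_trans h2 _; have := ler_wpM2l (ltW D20) h3.
  have : 0 <= D1 * (S * r ^+ n + tau) by apply: mulr_ge0 => //; lra.
  lra.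
elim: n => [|n [ihE ihU]].
  rewrite /s !expr0 mulr1; split.
    apply: le_trans hE0 _; have : 0 <= (D1 - K) * S.
      by apply: mulr_ge0 => //; rewrite /D1; lra.
    have : 0 <= D1 * tau by apply: mulr_ge0 => //; lra.
    lra.
  apply: le_trans hU0 _; have : 0 <= (D2 - K) * S.
    apply: mulr_ge0 => //; rewrite /D2.
    have : 0 < 2 * (K + 1) / (1 - rho) by apply: divr_gt0 => //; lra.
    lra.
  have : 0 <= D2 * tau by apply: mulr_ge0 => //; lra.
  lra.
have /andP[k1 k2] := rn n; have /andP[k3 k4] := sr n; have k5 := ss n.
have bK0 : 0 <= beta * K by rewrite ltW // mulr_gt0.
have k6 := ler_wpM2l S0 k5.
have k7 : 0 <= S * rho ^+ n by exact: mulr_ge0.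
have k8 : S * rho ^+ n <= S * r ^+ n by exact: ler_wpM2l.
have k9 : S * r ^+ n <= S * s n by exact: ler_wpM2l.
have k10 : S * s n <= 2 * (S * r ^+ n) by have := ler_wpM2l S0 k4; lra.
have k6' : q * (S * s n) + 2 * (t * (S * r ^+ n)) +
    (1 - rho) / 2 * (S * rho ^+ n) <= S * s n.+1.
  apply: le_trans k6; rewrite le_eqVlt; apply/orP; left; apply/eqP.
  by move: (s n) => sn; ring.
have hEn := hE n; have hUn := hU n; rewrite -(mulrA K S) in hEn.
clear hE hU hE0 hU0 k5 k6 k1 k2 k3 k4 ss sr rn.
move: ihE ihU hEn hUn k6' k7 k8 k9 k10.
move: (S * s n) (S * r ^+ n) (S * rho ^+ n) (S * s n.+1) => x y z x'.
move: (E n) (U n) (E n.+1) (U n.+1) => e u e' u' ihE ihU hEn hUn k6' k7 k8 k9 k10.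
clear s bg bD E U; clear beta0 b00 f1 f2 D1a.
clearbody q r t D1 D2.
have ty : 0 <= t * y by apply: mulr_ge0; lra.
split.
- have a1 := ler_wpM2l (ltW q0) ihE; have a2 := ler_wpM2l bK0 ihU.
  have a3 : beta * K * D2 * (x + tau) <= D1 * t * (x + tau).
    by apply: ler_wpM2r => //; lra.
  have a4 : K * z <= D1 * (1 - rho) / 2 * z by exact: ler_wpM2r.
  have a5 := ler_wpM2l (ltW D10) k6'.
  have a6 : D1 * t * x <= D1 * t * (2 * y).
    by apply: ler_wpM2l k10; rewrite mulr_ge0 // ltW.
  have a7 : 0 <= D1 * t * tau by rewrite !mulr_ge0 // ltW.
  rewrite qE in a1 a5 hEn; clear - hEn a1 a2 a3 a4 a5 a6 a7; lra.
- have bK1 : beta * K * ((D1 + D2) * (x + tau)) <= 1 * (x + tau).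
    by rewrite mulrA; apply: ler_wpM2r => //; lra.
  have a1 := ler_wpM2l (ltW r0) ihU.
  have a2 : beta * K * (e + u) <= beta * K * ((D1 + D2) * (x + tau)).
    by apply: ler_wpM2l => //; lra.
  have a3 : K * y <= K * x by rewrite ler_pM2l.
  have a4 : (K + 1) * (x + tau) <= D2 * (1 - rho) / 2 * (x + tau).
    by apply: ler_wpM2r => //; lra.
  have a5 : D2 * (((1 + rho) / 2) * x) <= D2 * x'.
    apply: ler_wpM2l; first exact: ltW.
    have : (1 + rho) / 2 * x <= q * x by apply: ler_wpM2r => //; lra.
    have : 0 <= (1 - rho) / 2 * z by apply: mulr_ge0 => //; lra.
    lra.
  have a6 : 0 <= D2 * ((1 - rho) / 2) * tau.
    by rewrite !mulr_ge0 ?(ltW D20) //; lra.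
  clear - hUn a1 a2 a3 a4 a5 a6 bK1 k9; lra.
Qed.

End sequences.

(** * The coupled recursion for the first moments *)

Section moment_system.
Context (R : realType) (d : nat) (Gamma : 'M[R]_d) (gmax : R) (Abar : 'M[R]_d).
Hypothesis hGsym : Gamma^T = Gamma.
Hypothesis hGpos : posdefmx Gamma.
Hypothesis hgmax : max_eigenvalue Gamma gmax.
Hypothesis hGlyap : Abar^T *m Gamma + Gamma *m Abar = - 1%:M.
Hypothesis hAbar : forall v : 'cV[R]_d, l2norm (Abar *m v) <= l2norm v.

Lemma l2norm_le_qnorm :
  exists2 c : R, 0 < c & forall v : 'cV[R]_d, l2norm v <= c * qnorm Gamma v.
Proof.
have pG := psd_posdef hGsym hGpos.
have [c c0 hc] := posdef_lower hGsym hGpos.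
exists (Num.sqrt c)^-1; first by rewrite invr_gt0 sqrtr_gt0.
move=> v; rewrite mulrC ler_pdivlMr ?sqrtr_gt0 //.
rewrite -ler_sqr ?nnegrE ?qnorm_ge0 //; last first.
  by rewrite mulr_ge0 ?l2norm_ge0 // sqrtr_ge0.
by rewrite exprMn (sqr_sqrtr (ltW c0)) (sqr_qnorm v pG) mulrC.
Qed.

Variables (rho G KG : R) (B : 'cV[R]_d).
Hypothesis rho01 : 0 < rho < 1.
Hypothesis G0 : 0 <= G.
Hypothesis KG0 : 0 <= KG.

(** [slow_fast_bound] is used twice. The first pass, with tau = beta |kappa|, bounds y and its fast
    part U. The second is for y - beta kappa B and the fast part U2 freed of its leading term: its
    source is beta times the first bound, so there tau = beta^2 |kappa|. *)
Lemma moment_system_bound : exists beta0 C : R, [/\ 0 < beta0, 0 <= C &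
  forall (beta z z' kappa : R) (y : nat -> 'cV[R]_d) (U U2 : nat -> R)
    (e e2 : nat -> 'cV[R]_d),
  0 < beta <= beta0 -> 0 <= z' -> `|kappa| <= z ->
  (forall n, 0 <= U n /\ 0 <= U2 n) /\ (U 0%N = z' /\ U2 0%N = z') ->
  (forall n, U n.+1 = rho * U n +
    beta * (d%:R * (l2norm (y n) + 4 * U n) +
            G * (`|kappa| + 4 * z * rho ^+ n))) ->
  (forall n, U2 n.+1 = rho * U2 n +
    beta * (d%:R * (l2norm (y n) + 4 * U n) + 4 * G * z * rho ^+ n)) ->
  (forall n, y n.+1 = y n + beta *: (Abar *m y n) + beta *: e n) ->
  (forall n, y n.+1 - (beta * kappa) *: B =
    (y n - (beta * kappa) *: B) +
    beta *: (Abar *m (y n - (beta * kappa) *: B)) + beta *: e2 n) ->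
  (forall n, l2norm (e n) <= d%:R * (4 * d%:R * U n + 4 * G * z * rho ^+ n)) ->
  (forall n, beta <= 1 -> l2norm (e2 n) <=
    d%:R * (4 * d%:R * U2 n + (4 * G + KG) * z * rho ^+ n)) ->
  l2norm (y 0%N) <= d%:R * z' ->
  forall n, l2norm (y n - (beta * kappa) *: B) <=
    C * ((z' + beta * z) * (1 - beta / (4 * gmax)) ^+ n +
         beta ^+ 2 * `|kappa|)].
Proof.
have /andP[r0 r1] := rho01.
have pG := psd_posdef hGsym hGpos.
have g2 := gmax_ge hGsym hGpos hgmax hGlyap hAbar.
have gp : 0 < gmax by lra.
have [cl cl0 lo] := l2norm_le_qnorm.
have [cu [cu0 up]] : exists cu : R, 0 < cu /\
    forall v : 'cV[R]_d, qnorm Gamma v <= cu * l2norm v.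
  exists (Num.sqrt gmax); split; first by rewrite sqrtr_gt0.
  exact: qnorm_le_l2norm hGsym hGpos hgmax.
have [D [D0 DE]] : exists D : R, 0 <= D /\ D = d%:R by exists d%:R.
have G0' : 0 <= G := G0; have KG0' : 0 <= KG := KG0.
have p1 : 0 <= cu * D by rewrite mulr_ge0 // ltW.
have p2 : 0 <= cu * D * (4 * D) by rewrite !mulr_ge0 // ltW.
have p3 : 0 <= cu * D * (4 * G) by rewrite !mulr_ge0 // ltW.
have p4 : 0 <= D * cl by rewrite mulr_ge0 // ltW.
pose K := 1 + cu * D + cu * D * (4 * D) + cu * D * (4 * G) + D * cl + 4 * D + 4 * G.
have [K0 [q1 [q2 [q3 [q4 [q5 [q6 q7]]]]]]] : 0 < K /\ (1 <= K /\ (cu * D <= K /\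
    (cu * D * (4 * D) <= K /\ (cu * D * (4 * G) <= K /\
    (D * cl <= K /\ (4 * D <= K /\ 4 * G <= K)))))).
  by move: p1 p2 p3 p4 D0 G0'; rewrite /K; do 7 (split; first lra); lra.
clearbody K.
have [b1 [C1 [b10 C10 sf1]]] := slow_fast_bound K0 rho01 gp.
have p5 : 0 <= cu * D * (4 * G + KG)
  by rewrite mulr_ge0 // addr_ge0 // mulr_ge0.
have p6 : 0 <= cu * (D + l2norm B).
  by rewrite mulr_ge0 ?addr_ge0 ?l2norm_ge0 // ltW.
have p7 : 0 <= D * ((cl + 4) * C1) by rewrite mulr_ge0 // mulr_ge0 // addr_ge0 // ltW.
pose L := 1 + cu * D * (4 * D) + cu * D * (4 * G + KG) + cu * (D + l2norm B) +
   D * ((cl + 4) * C1) + 4 * G.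
have [L0 [t1 [t2 [t3 [t4 t5]]]]] : 0 < L /\ (1 <= L /\ (cu * D * (4 * D) <= L /\
    (cu * D * (4 * G + KG) <= L /\
    (cu * (D + l2norm B) <= L /\ D * ((cl + 4) * C1) + 4 * G <= L)))).
  by move: p2 p5 p6 p7 G0'; rewrite /L; do 5 (split; first lra); lra.
clearbody L.
have [b2 [C2 [b20 C20 sf2]]] := slow_fast_bound L0 rho01 gp.
(* beta <= 1 is asked by the bound on e2, beta gmax <= 1/9 by [lyapunov_contraction], and the last
   condition gives rho <= 1 - beta / (4 gmax). *)
pose b3 := Num.min (Num.min 1 (9^-1 / gmax)) ((1 - rho) * gmax).
have b30 : 0 < b3.
  by rewrite /b3 !lt_min ltr01 /= divr_gt0 // mulr_gt0 // subr_gt0.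
exists (Num.min b3 (Num.min b1 b2)), (cl * C2); split.
- by rewrite lt_min b30 lt_min b10.
- by rewrite mulr_ge0 // ltW.
move=> beta z z' kappa y U U2 e e2 /andP[be0]; rewrite le_min => /andP[be3].
rewrite le_min => /andP[be1 be2].
move: be3; rewrite /b3 !le_min => /andP[/andP[bone bg9] brho].
rewrite -DE => z'0 kz [U_ge0 [U0 U20]] hU hU2 hy hy2 he he2' y0 n.
have bg9' : beta * gmax <= 9^-1 by rewrite -ler_pdivlMr.
have he2 k := he2' k bone.
have z0 : 0 <= z := le_trans (normr_ge0 _) kz.
have rhor : rho <= 1 - beta / (4 * gmax).
  have : beta / (4 * gmax) <= 1 - rho.
    rewrite ler_pdivrMr ?mulr_gt0 //; apply: le_trans brho _.
    by rewrite ler_pM2l ?subr_gt0 //; lra.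
  lra.
have step v v' err : v' = v + beta *: (Abar *m v) + beta *: err ->
    qnorm Gamma v' <= (1 - beta / (3 * gmax)) * qnorm Gamma v +
      beta * (cu * l2norm err).
  move=> ->; apply: le_trans (qnormD _ _ pG) _; apply: lerD.
    exact: (lyapunov_contraction hGsym hGpos hgmax hGlyap hAbar).
  by rewrite qnormZ gtr0_norm // ler_pM2l // up.
set r := 1 - beta / (4 * gmax) in rhor *.
have rhon k : 0 <= rho ^+ k <= r ^+ k.
  rewrite exprn_ge0 ?(ltW r0) //= lerXn2r ?nnegrE ?(ltW r0) //.
  exact: le_trans (ltW r0) rhor.
(* The weight z enters the recursions with a factor beta, so beta z can be counted with the initial
   size z'. *)
set S := z' + beta * z.
have bz0 : 0 <= beta * z by rewrite mulr_ge0 // ltW.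
have S0 : 0 <= S by rewrite addr_ge0.
have zS : z' <= S by rewrite lerDl.
have bzS : beta * z <= S by rewrite lerDr.
have bk0 : 0 <= beta * `|kappa| by rewrite mulr_ge0 // ltW.
have bk0' : 0 <= beta ^+ 2 * `|kappa| by rewrite mulr_ge0 // sqr_ge0.
have bzr k : 0 <= beta * z * rho ^+ k <= S * rho ^+ k.
  by have /andP[h _] := rhon k; rewrite mulr_ge0 //= ler_wpM2r.
have Sr k : 0 <= S * rho ^+ k <= S * r ^+ k.
  by have /andP[h h'] := rhon k; rewrite mulr_ge0 //= ler_wpM2l.
have cD : 0 <= cu * D by rewrite mulr_ge0 // ltW.
have E_step (V W : nat -> R) (err : 'cV[R]_d) c k M : 0 <= W k ->
    l2norm err <= D * (4 * D * W k + c * z * rho ^+ k) ->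
    V k.+1 <= (1 - beta / (3 * gmax)) * V k + beta * (cu * l2norm err) ->
    cu * D * (4 * D) <= M -> cu * D * c <= M -> 0 <= cu * D * c ->
    V k.+1 <= (1 - beta / (3 * gmax)) * V k + beta * M * W k + M * S * rho ^+ k.
  move=> W0 herr hV hM1 hM2 cc; apply: le_trans hV _; rewrite -addrA lerD2l.
  apply: (@le_trans _ _ (beta * (cu * (D * (4 * D * W k + c * z * rho ^+ k))))).
    by rewrite ler_pM2l // ler_pM2l.
  have -> : beta * (cu * (D * (4 * D * W k + c * z * rho ^+ k))) =
    (cu * D * (4 * D)) * (beta * W k) + (cu * D * c) * (beta * z * rho ^+ k) by ring.
  have -> : beta * M * W k + M * S * rho ^+ k =
    M * (beta * W k) + M * (S * rho ^+ k) by ring.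
  apply: lerD.
    by apply: ler_wpM2r => //; rewrite mulr_ge0 // ltW.
  by have /andP[h1 h2] := bzr k; apply: ler_pM.
have bd1 k : l2norm (y k) + 4 * U k <=
    (cl + 4) * C1 * (S * r ^+ k + beta * `|kappa|).
  have [|||||||h1 h2] := sf1 beta S (beta * `|kappa|) (fun k => qnorm Gamma (y k)) U
    _ _ _ _ _ _ _ k => //.
  - by rewrite be0.
  - apply: le_trans (up _) _; apply: le_trans (_ : cu * (D * z') <= _).
      by rewrite ler_pM2l.
    by rewrite mulrA; apply: ler_pM.
  - by rewrite U0; apply: le_trans zS _; rewrite ler_peMl.
  - move=> j; apply: (E_step (fun k => qnorm Gamma (y k)) U (e j) (4 * G)) => //; first by case: (U_ge0 j).
    exact: step.
  - move=> j; rewrite hU -addrA lerD2l -/r.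
    have Uj0 : 0 <= U j by case: (U_ge0 j).
    have /andP[k1 k2] := bzr j; have /andP[k3 k4] := Sr j.
    have -> : beta * (D * (l2norm (y j) + 4 * U j) + G * (`|kappa| + 4 * z * rho ^+ j)) =
      (beta * (D * l2norm (y j)) + beta * (4 * D * U j)) +
      (G * (beta * `|kappa|) + (4 * G) * (beta * z * rho ^+ j)) by ring.
    apply: lerD.
      rewrite -(mulrA beta) -mulrDr ler_pM2l // mulrDr lerD //; last exact: ler_wpM2r.
      apply: (@le_trans _ _ (D * (cl * qnorm Gamma (y j)))); first exact: ler_wpM2l.
      by rewrite mulrA ler_wpM2r // qnorm_ge0.
    rewrite mulrDr addrC lerD //.
      by apply: ler_pM => //; [rewrite mulr_ge0|exact: le_trans k2 k4].
    by apply: ler_wpM2r => //; lra.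
  have w1 := lo (y k); have w2 := ler_wpM2l (ltW cl0) h1.
  have -> : (cl + 4) * C1 * (S * r ^+ k + beta * `|kappa|) =
    cl * (C1 * (S * r ^+ k + beta * `|kappa|)) + 4 * (C1 * (S * r ^+ k + beta * `|kappa|)) by ring.
  by apply: lerD; [exact: le_trans w1 w2|rewrite ler_pM2l].
have [|||||||h1 _] := sf2 beta S (beta ^+ 2 * `|kappa|)
  (fun k => qnorm Gamma (y k - (beta * kappa) *: B)) U2 _ _ _ _ _ _ _ n => //.
- by rewrite be0.
- apply: le_trans (up _) _.
  apply: (@le_trans _ _ (cu * ((D + l2norm B) * S))); last first.
    by rewrite mulrA; apply: ler_wpM2r.
  rewrite ler_pM2l // mulrDl; apply: le_trans (l2normD _ _) _; apply: lerD.
    by apply: le_trans y0 _; exact: ler_wpM2l.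
  rewrite l2normN l2normZ mulrC; apply: ler_wpM2l; first exact: l2norm_ge0.
  by apply: le_trans bzS; rewrite normrM gtr0_norm // ler_pM2l.
- by rewrite U20; apply: le_trans zS _; rewrite ler_peMl.
- move=> j; apply: (E_step (fun k => qnorm Gamma (y k - (beta * kappa) *: B)) U2
    (e2 j) (4 * G + KG)) => //; first by case: (U_ge0 j).
  exact: step.
- move=> j; rewrite hU2 -!addrA lerD2l -/r.
  have [_ Uj0] := U_ge0 j.
  have /andP[k1 k2] := bzr j; have /andP[k3 k4] := Sr j.
  set x := S * r ^+ j in k4 *; set w := beta ^+ 2 * `|kappa| in bk0' *.
  apply: (@le_trans _ _ (L * (x + w))); last first.
    rewrite lerDr mulr_ge0 ?addr_ge0 ?qnorm_ge0 //.
    by rewrite mulr_ge0 // ltW.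
  apply: (@le_trans _ _ ((D * ((cl + 4) * C1) + 4 * G) * (x + w))); last first.
    by apply: ler_wpM2r => //; rewrite addr_ge0 // (le_trans k3).
  have b1' := ler_wpM2l D0 (bd1 j).
  have b2' : beta * (D * (l2norm (y j) + 4 * U j)) <=
      D * ((cl + 4) * C1) * (x + w).
    apply: (@le_trans _ _ (beta * (D * ((cl + 4) * C1 * (x + beta * `|kappa|))))).
      by rewrite ler_pM2l.
    have -> : beta * (D * ((cl + 4) * C1 * (x + beta * `|kappa|))) =
      D * ((cl + 4) * C1) * (beta * x + w) by rewrite /w; ring.
    apply: ler_wpM2l => //; rewrite lerD2r ler_piMl //.
    exact: le_trans k3 k4.
  have b3' : beta * (4 * G * z * rho ^+ j) <= 4 * G * (x + w).
    have -> : beta * (4 * G * z * rho ^+ j) = 4 * G * (beta * z * rho ^+ j) by ring.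
    apply: ler_wpM2l; first by rewrite mulr_ge0.
    by apply: le_trans k2 _; apply: le_trans k4 _; rewrite lerDl.
  by rewrite [leLHS]mulrDr [leRHS]mulrDl; exact: lerD.
apply: le_trans (lo _) _; rewrite -mulrA ler_pM2l //.
Qed.

End moment_system.

(** V + N beta X contracts: N makes the loss (1 - rho) / 2 of N beta X equal to the coupling beta K
    X, and half of the drift beta v absorbs beta^2 Q v once beta Q <= 1/2. The other half is at
    least beta / (2 g) times V, whence the rate. *)
Lemma second_moment_sequence (R : realType) (K rho g c : R) :
  0 < K -> 0 < rho < 1 -> 0 < g -> 0 < c ->
  exists beta0 C : R, [/\ 0 < beta0, 0 <= C &
    forall (beta : R) (v V X : nat -> R), 0 < beta <= beta0 ->
    (forall n, [/\ 0 <= v n, 0 <= X n, c * v n <= V n & V n <= g * v n]) ->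
    X 0%N <= 1 + v 0%N ->
    (forall n, X n.+1 <= rho * X n + beta * (K * (1 + v n))) ->
    (forall n, V n.+1 <= V n - beta * v n + beta * (K * X n) +
                         beta ^+ 2 * (K * (1 + v n))) ->
    forall n, v n <= C * (1 + v 0%N) * (beta + (1 - beta / (2 * g)) ^+ n)].
Proof.
move=> K0 /andP[r0 r1] g0 c0; have r1' : 0 < 1 - rho by lra.
pose N := 2 * K / (1 - rho).
have N0 : 0 < N by rewrite divr_gt0 // mulr_gt0.
have NE : N * (1 - rho) / 2 = K by rewrite /N; field; rewrite gt_eqF.
pose Q := K + N * K.
have Q0 : 0 < Q by rewrite addr_gt0 // mulr_gt0.
pose b0 := Num.min (Num.min 1 (g * (1 - rho))) (2 * Q)^-1.
have gr0 : 0 < g * (1 - rho) by rewrite mulr_gt0.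
have Qi : 0 < (2 * Q)^-1 by rewrite invr_gt0 mulr_gt0.
have b00 : 0 < b0 by rewrite /b0 !lt_min ltr01 gr0 Qi.
exists b0, ((g + N + 2 * g * Q) / c).
have gQ : 0 < 2 * g * Q by rewrite !mulr_gt0.
split=> //; first by rewrite divr_ge0 ?(ltW c0) //; lra.
move=> beta v V X /andP[be0]; rewrite /b0 !le_min => /andP[/andP[be1 beg] beQ].
move=> hv X0 hX hV n.
have bQ : beta * Q <= 2^-1.
  have : beta * (2 * Q) <= 1 by rewrite -ler_pdivlMr ?mul1r // mulr_gt0.
  by rewrite mulrCA -ler_pdivlMl // mulr1.
have bg : beta / (2 * g) <= (1 - rho) / 2.
  rewrite ler_pdivrMr ?mulr_gt0 //; move: beg; rewrite mulrC; lra.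
have bg0 : 0 < beta / (2 * g) by rewrite divr_gt0 // mulr_gt0.
have bgE : beta = beta / (2 * g) * (2 * g) by field; rewrite gt_eqF.
set p := 1 - beta / (2 * g).
have p01 : 0 <= p < 1 by rewrite /p; apply/andP; split; lra.
pose Y n := V n + N * beta * X n.
have stp k : Y k.+1 <= p * Y k + beta ^+ 2 * Q.
  have [v0 x0 _ Vg] := hv k.
  have h1 := hX k; have h2 := hV k.
  have h3 : N * beta * X k.+1 <= N * beta * (rho * X k + beta * (K * (1 + v k))).
    by rewrite ler_pM2l // mulr_gt0.
  have h4 : beta * (beta * Q) * v k <= beta * 2^-1 * v k.
    by apply: ler_wpM2r => //; rewrite ler_pM2l.
  have h5 : beta / (2 * g) * V k <= beta / (2 * g) * (g * v k).
    by rewrite ler_pM2l.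
  have h6 : beta / (2 * g) * (g * v k) = beta * 2^-1 * v k.
    by field; rewrite gt_eqF.
  have h7 : (rho + beta / (2 * g)) * (N * beta * X k) <=
      (rho + (1 - rho) / 2) * (N * beta * X k).
    have y0 : 0 <= N * beta * X k by rewrite mulr_ge0 // ltW // mulr_gt0.
    by apply: ler_wpM2r => //; lra.
  have h8 : beta * (K * X k) = (1 - rho) / 2 * (N * beta * X k).
    by rewrite -NE; ring.
  have h9 : N * beta * (rho * X k + beta * (K * (1 + v k))) =
    rho * (N * beta * X k) + beta ^+ 2 * (N * K) * (1 + v k) by ring.
  rewrite h8 in h2; rewrite h9 in h3; rewrite h6 in h5.
  clear h1 h6 h8 h9 hv hX hV X0.
  move: h2 h3 h4 h5 h7; rewrite /Y /p /Q.
  move: (beta / (2 * g)) => t.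
  move: (N * beta * X k) (N * beta * X k.+1) (V k) (V k.+1) (v k).
  by clear; move=> y y' V0 V1 v0 h2 h3 h4 h5 h7; lra.
have L0 : Y 0%N <= (g + N) * (1 + v 0%N).
  have [v0 x0 _ Vg] := hv 0%N.
  have : N * beta * X 0%N <= N * (1 + v 0%N).
    apply: ler_pM => //; first by rewrite mulr_ge0 // ltW.
    by rewrite ler_piMr // ltW.
  by rewrite /Y mulrDl mulrDr; lra.
have := @affine_recursion _ Y p (2 * g * beta * Q) (beta ^+ 2 * Q) p01.
have s0 : 0 <= beta ^+ 2 * Q by rewrite mulr_ge0 ?sqr_ge0 // ltW.
move=> /(_ s0 stp) h.
have {}h : Y n <= p ^+ n * Y 0%N + 2 * g * beta * Q.
  apply: h; rewrite /p le_eqVlt; apply/orP; left; apply/eqP.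
  by field; rewrite gt_eqF.
have [v0 x0 cV _] := hv n; have [v00 _ _ _] := hv 0%N.
have pn0 : 0 <= p ^+ n by rewrite exprn_ge0 //; case/andP: p01.
have e1 : c * v n <= Y n.
  by rewrite /Y; apply: le_trans cV _; rewrite lerDl mulr_ge0 // ltW // mulr_gt0.
have e2 : p ^+ n * Y 0%N <= (g + N) * (1 + v 0%N) * p ^+ n.
  by rewrite mulrC ler_wpM2r.
have -> : (g + N + 2 * g * Q) / c * (1 + v 0%N) * (beta + p ^+ n) =
  (g + N + 2 * g * Q) * (1 + v 0%N) * (beta + p ^+ n) / c by ring.
rewrite ler_pdivlMr // mulrC; apply: le_trans e1 _; apply: le_trans h _.
have e3 : 0 <= 2 * g * Q * beta * v 0%N by rewrite !mulr_ge0 // ltW // mulr_gt0.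
have e4 : 0 <= 2 * g * Q * (1 + v 0%N) * p ^+ n.
  by rewrite mulr_ge0 // mulr_ge0 ?(ltW gQ) //; lra.
have e5 : 0 <= (g + N) * (1 + v 0%N) * beta.
  by rewrite mulr_ge0 ?(ltW be0) // mulr_ge0; lra.
move: e2 e3 e4 e5; move: (p ^+ n * Y 0%N) => x; move: (p ^+ n) (v 0%N) => y w.
by clear; lra.
Qed.

(** * Functionals of the chain with memory of its past *)

Section moment_functionals.
Context (R : realType) (dX : measure_display) (X : measurableType dX).
Context (P : R.-pker X ~> X) (mu : probability X R) (rho : R).
Hypothesis rho01 : 0 < rho < 1.
Hypothesis hgeo : forall n f M, bmeas f M -> Ex mu f = 0 ->
  bmeas (iter n (op P) f) (2 * M * rho ^+ n).
Implicit Types (f : X -> R) (psi : (X -> R) -> R).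

Lemma bmeas_center f M : bmeas f M -> bmeas (fun x => f x - Ex mu f) (2 * M).
Proof.
move=> bf; have := bmeasB bf (@bmeas_cst _ _ X (Ex mu f)).
apply: bmeasW; rewrite mulr_natl mulr2n lerD2l.
exact: Ex_bmeas_le bf.
Qed.

Lemma Ex_center f M : bmeas f M -> Ex mu (fun x => f x - Ex mu f) = 0.
Proof.
move=> bf; have := ExD (L1_bmeas mu bf) (L1_bmeas mu (@bmeas_cst _ _ X (- Ex mu f))).
by rewrite Ex_cst subrr.
Qed.

Lemma linear_center psi f M : linear_on_bmeas psi -> bmeas f M ->
  psi f = psi (fun x => f x - Ex mu f) + Ex mu f * psi (fun=> 1).
Proof.
move=> lin bf; rewrite -(lin _ _ _ _ _ (bmeas_center bf) (@bmeas_cst _ _ X 1)).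
by congr psi; apply/funext => x; rewrite mulr1 subrK.
Qed.

(* psi nearly annihilates centered functions, the more so after some steps of
   the chain. *)
Definition mixing_bound psi (B : R) : Prop :=
  forall k f M, bmeas f M -> Ex mu f = 0 ->
  `|psi (iter k (op P) f)| <= 2 * M * rho ^+ k * B.

Lemma mixing_bound0 psi B : (forall f M, bmeas f M -> `|psi f| <= M * B) ->
  mixing_bound psi B.
Proof. by move=> h k f M bf f0; apply: h; exact: hgeo. Qed.

(** Up to delta, psi' is psi after one more step of the chain, so k steps become k + 1 and a factor
    rho is gained. Carrying all k at once matters: one step alone need not contract, and the factor
    2 of the geometric bound would be compounded at each time. *)
Lemma mixing_boundS psi psi' B delta : mixing_bound psi B ->
  (forall f M, bmeas f M -> `|psi' f - psi (op P f)| <= delta * M) ->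
  mixing_bound psi' (rho * B + delta).
Proof.
move=> h hs k f M bf f0; rewrite -[psi' _](subrK (psi (op P (iter k (op P) f)))).
apply: le_trans (ler_normD _ _) _.
have h1 := hs _ _ (hgeo k bf f0); have := h k.+1 f M bf f0; rewrite exprS /=.
by move: h1; lra.
Qed.

Lemma mixing_bound_center psi B f M : mixing_bound psi B -> bmeas f M ->
  `|psi (fun x => f x - Ex mu f)| <= 4 * M * B.
Proof.
move=> h bf; have := h 0%N _ _ (bmeas_center bf) (Ex_center bf).
by rewrite /= expr0; lra.
Qed.

Lemma mixing_bound_le psi B f M : linear_on_bmeas psi -> mixing_bound psi B ->
  bmeas f M -> `|psi f| <= M * (`|psi (fun=> 1)| + 4 * B).
Proof.
move=> lin h bf; rewrite (linear_center lin bf).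
apply: le_trans (ler_normD _ _) _.
have h1 := mixing_bound_center h bf.
have h2 : `|Ex mu f * psi (fun=> 1)| <= M * `|psi (fun=> 1)|.
  rewrite normrM ler_wpM2r //.
  exact: Ex_bmeas_le bf.
lra.
Qed.

Context (d : nat) (A : X -> 'M[R]_d) (g : X -> 'cV[R]_d) (G : R).
Context (Gamma : 'M[R]_d) (gmax : R).
Local Notation Abar := (mx_mean mu A).
Hypothesis bA : forall i j, bmeas (fun x => A x i j) 1.
Hypothesis bg : forall i, bmeas (fun x => g x i 0) G.
Hypothesis g_mean : forall i, Ex mu (fun x => g x i 0) = 0.
Hypothesis hGsym : Gamma^T = Gamma.
Hypothesis hGpos : posdefmx Gamma.
Hypothesis hgmax : max_eigenvalue Gamma gmax.
Hypothesis hGlyap : Abar^T *m Gamma + Gamma *m Abar = - 1%:M.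
Hypothesis hAbar : forall v : 'cV[R]_d, l2norm (Abar *m v) <= l2norm v.

Let F i j x : R := A x i j - Abar i j.

Let bF i j : bmeas (F i j) 2.
Proof.
have := bmeas_center (bA i j); rewrite mulr1.
by congr bmeas; apply/funext => x; rewrite /F mxE.
Qed.

Let F_mean i j : Ex mu (F i j) = 0.
Proof.
rewrite -[RHS](Ex_center (bA i j)); congr Ex; apply/funext => x.
by rewrite /F mxE.
Qed.

Lemma Abar_unit : Abar \in unitmx.
Proof.
rewrite -unitmx_tr; apply: contraT.
rewrite -row_free_unit -kermx_eq0 => /rowV0Pn[v /sub_kermxP vA v0].
have vA' : Abar *m v^T = 0 by rewrite -[Abar]trmxK -trmx_mul vA trmx0.
have : qf (- 1%:M) v^T v^T = 0.
  rewrite -hGlyap qf_mxD -qf_mull -qf_mulr vA' -(scale0r (0 : 'cV[R]_d)).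
  by rewrite qfZl qfZr !mul0r addr0.
rewrite qf_mxN => /eqP; rewrite oppr_eq0.
rewrite -sqr_qnorm; last exact: psd1.
rewrite sqrf_eq0 -l2norm_qnorm => /eqP /l2norm_eq0 e.
by move: v0; rewrite -(trmxK v) e trmx0 eqxx.
Qed.

(** Stationary correlation of the noise with A, k + 1 steps later. Summed over j and k these give
    the drift h0 which the memory of the chain adds at order beta. *)
Let gop k i j : R := Ex mu (fun x => g x j 0 * iter k.+1 (op P) (F i j) x).

Let gop_le k i j : `|gop k i j| <= 4 * G * rho ^+ k.
Proof.
have bk := bmeasM (bg j) (hgeo k.+1 (bF i j) (F_mean i j)).
apply: le_trans (Ex_bmeas_le mu bk) _.
have /andP[r0 r1] := rho01; have G0 := bmeas_ge0 (bg j).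
have : 0 <= G * rho ^+ k by rewrite mulr_ge0 // exprn_ge0 // ltW.
rewrite exprS => h; have := ler_wpM2r h (ltW r1); lra.
Qed.

Let drift_limit : exists h0 : 'cV[R]_d, forall n i,
  `|\sum_j \sum_(k < n) gop k i j - h0 i 0| <= d%:R * (4 * G / (1 - rho)) * rho ^+ n.
Proof.
have [l hl] : exists l : 'I_d -> 'I_d -> R, forall i j n,
    `|\sum_(k < n) gop k i j - l i j| <= 4 * G / (1 - rho) * rho ^+ n.
  have h i j := geometric_limit rho01 (fun k => gop_le k i j).
  have [l hl] := choice (fun ij => h ij.1 ij.2).
  by exists (fun i j => l (i, j)) => i j n; exact: (hl (i, j)).
exists (\col_i \sum_j l i j) => n i; rewrite mxE -sumrB.
apply: le_trans (ler_norm_sum _ _ _) _.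
apply: le_trans (ler_sum _ (fun j _ => hl i j n)) _.
by rewrite sumr_const card_ord -[leLHS]mulr_natl !mulrA.
Qed.

Let G0 : 0 <= `|G|. Proof. by []. Qed.

(* m n i f stands for E[zeta f(x_n) e_n,i] and m0 n f for E[zeta f(x_n)]. *)
Definition first_moments (beta z z' : R) (m0 : nat -> (X -> R) -> R)
    (m : nat -> 'I_d -> (X -> R) -> R) : Prop :=
  [/\ (forall n, linear_on_bmeas (m0 n)) /\ (forall n i, linear_on_bmeas (m n i)),
      forall f M, bmeas f M -> `|m0 0%N f| <= M * z,
      forall i f M, bmeas f M -> `|m 0%N i f| <= M * z',
      forall n f M, bmeas f M -> m0 n.+1 f = m0 n (op P f) &
      forall n i f M, bmeas f M ->
        m n.+1 i f = m n i (op P f) +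
          beta * (\sum_j m n j (fun x => A x i j * op P f x) +
                  m0 n (fun x => g x i 0 * op P f x))].

Definition total_moment (m : nat -> 'I_d -> (X -> R) -> R) n : 'cV[R]_d :=
  \col_i m n i (fun=> 1).

Section first_moments.
Variables (beta z z' : R) (m0 : nat -> (X -> R) -> R).
Variable m : nat -> 'I_d -> (X -> R) -> R.
Hypothesis hm : first_moments beta z z' m0 m.
Hypothesis beta0 : 0 < beta.

Local Notation y := (total_moment m).
Local Notation kappa := (m0 0%N (fun=> 1)).

Let m0_iter n f M : bmeas f M -> m0 n f = m0 0%N (iter n (op P) f).
Proof.
case: hm => _ _ _ h _; elim: n f M => // n ih f M bf.
by rewrite (h _ _ _ bf) (ih _ _ (bmeas_op P bf)) iterSr.
Qed.

Lemma m0_mass_le : `|m0 0%N (fun=> 1)| <= z.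
Proof.
case: hm => _ h _ _ _; have := h _ _ (@bmeas_cst _ _ X 1).
by rewrite normr1 mul1r.
Qed.

Let z_ge0 : 0 <= z. Proof. exact: le_trans m0_mass_le. Qed.

Let m0_close n f M : bmeas f M ->
  `|m0 n f - Ex mu f * kappa| <= 4 * M * z * rho ^+ n.
Proof.
move=> bf; have [[lin _] hz _ _ _] := hm.
rewrite (m0_iter n bf).
have -> : iter n (op P) f = (fun x => iter n (op P) (fun x => f x - Ex mu f) x + Ex mu f * 1).
  have b1 := @bmeas_cst _ _ X (- Ex mu f).
  have := iter_opD P n 1 bf b1.
  rewrite iter_op_cst => e; apply/funext => x.
  have := congr1 (@^~ x) e => /= e'.
  have -> : (fun x => f x - Ex mu f) = (fun x => f x + 1 * - Ex mu f).
    by apply/funext => t; rewrite mul1r.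
  by rewrite e'; ring.
have bc := hgeo n (bmeas_center bf) (Ex_center bf).
rewrite (lin _ _ _ _ _ _ bc (@bmeas_cst _ _ X 1)) addrK.
apply: le_trans (hz _ _ bc) _; lra.
Qed.

Let m0_le n f M : bmeas f M -> `|m0 n f| <= M * (`|kappa| + 4 * z * rho ^+ n).
Proof.
move=> bf; rewrite -[m0 n f](subrK (Ex mu f * kappa)).
apply: le_trans (ler_normD _ _) _.
have h1 := m0_close n bf.
have h2 : `|Ex mu f * kappa| <= M * `|kappa|.
  by rewrite normrM ler_wpM2r //; exact: Ex_bmeas_le bf.
lra.
Qed.

Let g_le n f M i : bmeas f M ->
  `|m0 n (fun x => g x i 0 * op P f x)| <=
  `|G| * M * (`|kappa| + 4 * z * rho ^+ n).
Proof.
move=> bf; apply: m0_le; apply: bmeasW (bmeasM (bg i) (bmeas_op P bf)).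
by rewrite ler_wpM2r ?(bmeas_ge0 bf) // ler_norm.
Qed.

Let A_le n f M N i : bmeas f M ->
  (forall j f M, bmeas f M -> `|m n j f| <= M * N) ->
  `|\sum_j m n j (fun x => A x i j * op P f x)| <= d%:R * M * N.
Proof.
move=> bf hN; apply: le_trans (ler_norm_sum _ _ _) _.
apply: (@le_trans _ _ (\sum_(j < d) M * N)); last first.
  by rewrite sumr_const card_ord -[leLHS]mulr_natl !mulrA.
apply: ler_sum => j _; rewrite -(mul1r M); apply: hN.
exact: bmeasM (bA i j) (bmeas_op P bf).
Qed.

(* Solves the recursion of mixing_boundS for the functionals m n i. *)
Fixpoint mem (n : nat) : R :=
  if n is n'.+1 then
    rho * mem n' + beta * (d%:R * (l2norm (y n') + 4 * mem n') +
                           `|G| * (`|kappa| + 4 * z * rho ^+ n'))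
  else z'.

Let mem_bound n i : mixing_bound (m n i) (mem n).
Proof.
have [[_ lin] _ hz' _ hrec] := hm.
elim: n i => [|n ih] i; first by apply: mixing_bound0; exact: hz'.
have -> : mem n.+1 = rho * mem n + beta * (d%:R * (l2norm (y n) + 4 * mem n) +
  `|G| * (`|kappa| + 4 * z * rho ^+ n)) by [].
apply: mixing_boundS (ih i) _ => f M bf.
rewrite (hrec _ _ _ _ bf) addrC addKr normrM gtr0_norm // -mulrA ler_pM2l //.
apply: le_trans (ler_normD _ _) _.
have hN j f' M' : bmeas f' M' -> `|m n j f'| <= M' * (l2norm (y n) + 4 * mem n).
  move=> bf'; apply: le_trans (mixing_bound_le (lin n j) (ih j) bf') _.
  rewrite ler_wpM2l ?(bmeas_ge0 bf') // lerD2r.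
  by have := ler_abs_l2norm (y n) j; rewrite mxE.
have h1 := A_le i bf hN; have h2 := g_le n i bf.
by move: h1 h2; lra.
Qed.

Let m_le n i f M : bmeas f M -> `|m n i f| <= M * (l2norm (y n) + 4 * mem n).
Proof.
have [[_ lin] _ _ _ _] := hm.
move=> bf; apply: le_trans (mixing_bound_le (lin n i) (@mem_bound n i) bf) _.
rewrite ler_wpM2l ?(bmeas_ge0 bf) // lerD2r.
by have := ler_abs_l2norm (y n) i; rewrite mxE.
Qed.

Let y_rec n : y n.+1 = y n + beta *: (Abar *m y n) +
  beta *: \col_i (\sum_j m n j (F i j) + m0 n (fun x => g x i 0)).
Proof.
have [[_ lin] _ _ _ hrec] := hm.
apply/colP => i; rewrite !mxE (hrec _ _ _ _ (@bmeas_cst _ _ X 1)) op_cst.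
rewrite -addrA -mulrDr addrA -big_split /=; congr (_ + beta * (_ + _)).
  apply: eq_bigr => j _; rewrite mxE addrC.
  have -> : (fun x => A x i j * 1) = (fun x => F i j x + Abar i j * 1).
    by apply/funext => x; rewrite /F !mulr1 subrK.
  by rewrite (lin n j _ _ _ _ _ (bF i j) (@bmeas_cst _ _ X 1)) !mxE.
by congr m0; apply/funext => x; rewrite mulr1.
Qed.

Let g_small n i : `|m0 n (fun x => g x i 0)| <= 4 * `|G| * z * rho ^+ n.
Proof.
have := m0_close n (bg i); rewrite g_mean mul0r subr0 => h.
apply: le_trans h _; have /andP[r0 _] := rho01.
apply: ler_wpM2r; first by rewrite exprn_ge0 // ltW.
by apply: ler_wpM2r => //; rewrite ler_pM2l // ler_norm.
Qed.

Let rn0 n : 0 <= rho ^+ n.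
Proof. by have /andP[r0 _] := rho01; rewrite exprn_ge0 // ltW. Qed.

Hypothesis z'0 : 0 <= z'.

Let mem_ge0 n : 0 <= mem n.
Proof.
elim: n => [|n ih] //=; have /andP[r0 _] := rho01.
apply: addr_ge0; first by rewrite mulr_ge0 // ltW.
rewrite mulr_ge0 ?(ltW beta0) // addr_ge0 //.
  by rewrite mulr_ge0 // addr_ge0 ?l2norm_ge0 // mulr_ge0.
by rewrite mulr_ge0 // addr_ge0 // !mulr_ge0.
Qed.

Let y0_le : l2norm (y 0%N) <= d%:R * z'.
Proof.
apply: l2norm_le_bound => i; rewrite mxE.
case: hm => _ _ h _ _; have := h i _ _ (@bmeas_cst _ _ X 1).
by rewrite normr1 mul1r.
Qed.

Variables (h0 : 'cV[R]_d) (KG : R).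
Hypothesis h0P : forall n i,
  `|\sum_j \sum_(k < n) gop k i j - h0 i 0| <= KG * rho ^+ n.

(* The part of m n i that does not become small: its leading bias. *)
Let H n i f : R :=
  kappa * \sum_(k < n) Ex mu (fun x => g x i 0 * iter k.+1 (op P) f x).

(** The recursion of [mem] without its source of size |G| |kappa|: subtracting beta H removes
    exactly the stationary mean of the noise term, and what is left of this term decays like
    rho^n. *)
Fixpoint mem2 (n : nat) : R :=
  if n is n'.+1 then
    rho * mem2 n' + beta * (d%:R * (l2norm (y n') + 4 * mem n') +
                            4 * `|G| * z * rho ^+ n')
  else z'.

Let mem2_ge0 n : 0 <= mem2 n.
Proof.
elim: n => [|n ih] //=; have /andP[r0 _] := rho01.
apply: addr_ge0; first by rewrite mulr_ge0 // ltW.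
rewrite mulr_ge0 ?(ltW beta0) // addr_ge0 //; last by rewrite !mulr_ge0.
by rewrite mulr_ge0 // addr_ge0 ?l2norm_ge0 // mulr_ge0.
Qed.

Let mem2_bound n i : mixing_bound (fun f => m n i f - beta * H n i f) (mem2 n).
Proof.
have [_ _ hz' _ hrec] := hm.
elim: n i => [|n ih] i.
  apply: mixing_bound0 => f M bf; rewrite /H big_ord0 !mulr0 subr0.
  exact: hz'.
have -> : mem2 n.+1 = rho * mem2 n + beta * (d%:R * (l2norm (y n) + 4 * mem n) +
  4 * `|G| * z * rho ^+ n) by [].
apply: mixing_boundS (ih i) _ => f M bf.
have -> : H n.+1 i f = H n i (op P f) +
    kappa * Ex mu (fun x => g x i 0 * op P f x).
  pose w k := Ex mu (fun x => g x i 0 * iter k.+1 (op P) f x).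
  have hw : \sum_(k < n) Ex mu (fun x => g x i 0 * iter k.+1 (op P) (op P f) x) =
      \sum_(k < n) w k.+1 by apply: eq_bigr => k _; rewrite -iterSr.
  have w0 : Ex mu (fun x => g x i 0 * op P f x) = w 0%N by [].
  rewrite /H hw w0 -[\sum_(k < n.+1) _]/(\sum_(k < n.+1) w k).
  by clearbody w; rewrite big_ord_recl mulrDr addrC.
rewrite (hrec _ _ _ _ bf).
set a := m n i _; set s := \sum_j _; set t := m0 n _; set h := H n i _.
set e := Ex mu _.
have -> : a + beta * (s + t) - beta * (h + kappa * e) - (a - beta * h) =
    beta * (s + (t - e * kappa)) by ring.
rewrite normrM gtr0_norm // -mulrA ler_pM2l //.
apply: le_trans (ler_normD _ _) _.
have h1 := A_le i bf (fun j f' M' => @m_le n j f' M').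
have h2 : `|t - e * kappa| <= 4 * (`|G| * M) * z * rho ^+ n.
  apply: m0_close; apply: bmeasW (bmeasM (bg i) (bmeas_op P bf)).
  by rewrite ler_wpM2r ?(bmeas_ge0 bf) // ler_norm.
by move: h1 h2; rewrite -/s; lra.
Qed.

Lemma first_moments_recursion : exists (U U2 : nat -> R) (e e2 : nat -> 'cV[R]_d),
  [/\ (forall n, 0 <= U n /\ 0 <= U2 n) /\ (U 0%N = z' /\ U2 0%N = z'),
      (forall n, U n.+1 = rho * U n +
        beta * (d%:R * (l2norm (y n) + 4 * U n) +
                `|G| * (`|kappa| + 4 * z * rho ^+ n))) /\
      (forall n, U2 n.+1 = rho * U2 n +
        beta * (d%:R * (l2norm (y n) + 4 * U n) + 4 * `|G| * z * rho ^+ n)),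
      (forall n, y n.+1 = y n + beta *: (Abar *m y n) + beta *: e n) /\
      (forall B, Abar *m B = - h0 -> forall n,
        y n.+1 - (beta * kappa) *: B =
        (y n - (beta * kappa) *: B) +
        beta *: (Abar *m (y n - (beta * kappa) *: B)) + beta *: e2 n),
      (forall n, l2norm (e n) <=
        d%:R * (4 * d%:R * U n + 4 * `|G| * z * rho ^+ n)) /\
      (forall n, beta <= 1 -> l2norm (e2 n) <=
        d%:R * (4 * d%:R * U2 n + (4 * `|G| + KG) * z * rho ^+ n)) &
      l2norm (y 0%N) <= d%:R * z'].
Proof.
have sum_le (psi : 'I_d -> (X -> R) -> R) B i : (forall j, mixing_bound (psi j) B) ->
    `|\sum_j psi j (F i j)| <= 4 * d%:R * B.
  move=> hB; apply: le_trans (ler_norm_sum _ _ _) _.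
  apply: (@le_trans _ _ (\sum_(j < d) 4 * B)).
    apply: ler_sum => j _; have := hB j 0%N _ _ (bF i j) (F_mean i j).
    by rewrite /= expr0; lra.
  by rewrite sumr_const card_ord -[leLHS]mulr_natl mulrA (mulrC 4).
exists mem, mem2, (fun n => \col_i (\sum_j m n j (F i j) + m0 n (fun x => g x i 0))),
  (fun n => \col_i (\sum_j (m n j (F i j) - beta * H n j (F i j)) +
          m0 n (fun x => g x i 0) + beta * kappa *
          (\sum_j \sum_(k < n) gop k i j - h0 i 0))).
split; [by []|by []|split|split|exact: y0_le].
- exact: y_rec.
- move=> B hB n; rewrite y_rec mulmxBr -scalemxAr hB.
  apply/colP => i; rewrite !mxE.
  have -> : \sum_j (m n j (F i j) - beta * H n j (F i j)) =
      \sum_j m n j (F i j) - beta * kappa * \sum_j \sum_(k < n) gop k i j.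
    by rewrite sumrB -mulr_sumr /H -mulr_sumr mulrA.
  ring.
- move=> n; apply: l2norm_le_bound => i; rewrite mxE.
  apply: le_trans (ler_normD _ _) (lerD _ (g_small n i)).
  exact: sum_le (@mem_bound n).
- move=> n b1; apply: l2norm_le_bound => i; rewrite mxE.
  apply: le_trans (ler_normD _ _) _.
  have -> : 4 * d%:R * mem2 n + (4 * `|G| + KG) * z * rho ^+ n =
    (4 * d%:R * mem2 n + 4 * `|G| * z * rho ^+ n) + KG * z * rho ^+ n by ring.
  apply: lerD.
    apply: le_trans (ler_normD _ _) (lerD _ (g_small n i)).
    exact: (sum_le (fun j f => m n j f - beta * H n j f)) (@mem2_bound n).
  rewrite normrM; have h := h0P n i.
  have -> : KG * z * rho ^+ n = z * (KG * rho ^+ n) by ring.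
  apply: ler_pM => //; rewrite normrM gtr0_norm //.
  by apply: le_trans (ler_piMl _ b1) m0_mass_le.
Qed.

End first_moments.

(** B = - Abar^-1 h0 balances the drift h0 against Abar. It is chosen before the stepsize, the
    weight and the functionals, hence is the same for both runs of the extrapolation. *)
Theorem first_moment_bound : exists (B : 'cV[R]_d) (beta0 C : R),
  [/\ 0 < beta0, 0 <= C &
    forall (beta z z' : R) m0 m, 0 < beta <= beta0 -> 0 <= z' ->
    first_moments beta z z' m0 m ->
    forall n, l2norm (total_moment m n - (beta * m0 0%N (fun=> 1)) *: B)
      <= C * ((z' + beta * z) * (1 - beta / (4 * gmax)) ^+ n +
              beta ^+ 2 * `|m0 0%N (fun=> 1)|)].
Proof.
have [h0 h0P] := drift_limit.
set KG := d%:R * (4 * G / (1 - rho)) in h0P.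
have h0P' n i : `|\sum_j \sum_(k < n) gop k i j - h0 i 0| <= `|KG| * rho ^+ n.
  apply: le_trans (h0P n i) _; rewrite ler_wpM2r ?ler_norm // exprn_ge0 //.
  by have /andP[r0 _] := rho01; exact: ltW.
pose B := - (invmx Abar *m h0).
have hB : Abar *m B = - h0 by rewrite /B mulmxN mulKVmx //; exact: Abar_unit.
have [b0 [C [b00 C0 main]]] := moment_system_bound hGsym hGpos hgmax hGlyap hAbar
  B rho01 G0 (normr_ge0 KG).
exists B, b0, C; split=> // beta z z' m0 m /andP[be0 be] z'0 hm.
have [U [U2 [e [e2 [hU0 [hU hU2] [hy hy2] [he he2] y0]]]]] :=
  first_moments_recursion hm be0 z'0 h0P'.
apply: (main beta z z' (m0 0%N (fun=> 1)) (total_moment m) U U2 e e2) => //.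
- by rewrite be0.
- exact: m0_mass_le hm.
- exact: hy2.
Qed.

(** The cross terms in the drift of the Lyapunov function pair the error with A - Abar and with the
    noise, both centered, so only the size [Xs] of q and l on centered functions matters. It is fed
    by beta (1 + v), which makes these terms of order beta^2 (1 + v) up to a decaying part. *)
Theorem second_moment_bound (K c : R) : 0 < K -> 0 < c ->
  exists beta0 C : R, [/\ 0 < beta0, 0 <= C &
    forall (beta : R) (v V : nat -> R) (q : nat -> 'I_d -> 'I_d -> (X -> R) -> R)
      (l : nat -> 'I_d -> (X -> R) -> R),
    0 < beta <= beta0 ->
    (forall n, [/\ 0 <= v n, c * v n <= V n & V n <= gmax * v n]) ->
    (forall i j f M, bmeas f M -> `|q 0%N i j f| <= M * (1 + v 0%N)) ->
    (forall i f M, bmeas f M -> `|l 0%N i f| <= M * (1 + v 0%N)) ->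
    (forall n i j f M, bmeas f M ->
      `|q n.+1 i j f - q n i j (op P f)| <= beta * (K * (1 + v n)) * M) ->
    (forall n i f M, bmeas f M ->
      `|l n.+1 i f - l n i (op P f)| <= beta * (K * (1 + v n)) * M) ->
    (forall n, V n.+1 <= V n - beta * v n +
      2 * beta * (\sum_i \sum_j Gamma i j *
        (\sum_k q n i k (fun x => A x j k - Abar j k) +
         l n i (fun x => g x j 0))) + beta ^+ 2 * (K * (1 + v n))) ->
    forall n, v n <= C * (1 + v 0%N) * (beta + (1 - beta / (2 * gmax)) ^+ n)].
Proof.
move=> K0 c0.
have gp : 0 < gmax by have := gmax_ge hGsym hGpos hgmax hGlyap hAbar; lra.
pose s := entry_sum Gamma; have s0 : 0 <= s := entry_sum_ge0 Gamma.
pose K' := K + 2 * (s * (4 * d%:R + 2 * `|G|)).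
have K'0 : 0 <= 2 * (s * (4 * d%:R + 2 * `|G|)).
  by rewrite !mulr_ge0 // addr_ge0 // mulr_ge0.
have KK' : K <= K' by rewrite lerDl.
have K'p : 0 < K' := lt_le_trans K0 KK'.
have [b0 [C [b00 C0 main]]] := second_moment_sequence K'p rho01 gp c0.
exists b0, C; split=> // beta v V q l be hv hq0 hl0 hq hl hV.
have be0 : 0 < beta by case/andP: be.
(* Solves the recursion of [mixing_boundS] with equality. *)
pose Xs := fix Xs n : R := if n is n'.+1 then
  rho * Xs n' + beta * (K * (1 + v n')) else 1 + v 0%N.
have XsS n : Xs n.+1 = rho * Xs n + beta * (K * (1 + v n)) by [].
have v1 n : 0 <= 1 + v n by have [h _ _] := hv n; lra.
have Xs0 n : 0 <= Xs n.
  have /andP[r0 _] := rho01.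
  elim: n => [|n ih]; first exact: v1.
  rewrite XsS; apply: addr_ge0; first by rewrite mulr_ge0 // ltW.
  by rewrite mulr_ge0 ?(ltW be0) // mulr_ge0 ?(ltW K0).
have mq n i j : mixing_bound (q n i j) (Xs n).
  elim: n => [|n ih]; first by apply: mixing_bound0; exact: hq0.
  by rewrite XsS; apply: mixing_boundS ih _; exact: hq.
have ml n i : mixing_bound (l n i) (Xs n).
  elim: n => [|n ih]; first by apply: mixing_bound0; exact: hl0.
  by rewrite XsS; apply: mixing_boundS ih _; exact: hl.
apply: (main beta v V Xs) => //.
- by move=> n; have [h1 h2 h3] := hv n; split.
- move=> n; rewrite XsS lerD2l ler_pM2l //; exact: ler_wpM2r.
move=> n; apply: le_trans (hV n) _; rewrite -!addrA !lerD2l.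
have hs : \sum_i \sum_j Gamma i j *
    (\sum_k q n i k (fun x => A x j k - Abar j k) + l n i (fun x => g x j 0))
    <= s * ((4 * d%:R + 2 * `|G|) * Xs n).
  rewrite mulr_suml; apply: ler_sum => i _.
  rewrite mulr_suml; apply: ler_sum => j _.
  apply: le_trans (ler_norm _) _; rewrite normrM ler_wpM2l //.
  apply: le_trans (ler_normD _ _) _; rewrite mulrDl lerD //.
    apply: le_trans (ler_norm_sum _ _ _) _.
    apply: (@le_trans _ _ (\sum_(k < d) 4 * Xs n)).
      apply: ler_sum => k _; have := mq n i k 0%N _ _ (bF j k) (F_mean j k).
      by rewrite /= expr0; lra.
    by rewrite sumr_const card_ord -[leLHS]mulr_natl mulrA (mulrC 4).
  have := ml n i 0%N _ _ (bg j) (g_mean j); rewrite /= expr0 mulr1 => h.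
  by apply: le_trans h _; rewrite ler_wpM2r // ler_pM2l // ler_norm.
have h2 := ler_wpM2l (ltW be0) hs.
have h3 : beta ^+ 2 * (K * (1 + v n)) <= beta ^+ 2 * (K' * (1 + v n)).
  by rewrite ler_wpM2l ?sqr_ge0 // ler_wpM2r.
have h4 : beta * (2 * (s * (4 * d%:R + 2 * `|G|)) * Xs n) <= beta * (K' * Xs n).
  by rewrite ler_pM2l // ler_wpM2r // /K' lerDr ltW.
apply: lerD h3; apply: le_trans h4.
move: h2; move: (\sum_i _) => t h2.
have -> : beta * (2 * (s * (4 * d%:R + 2 * `|G|)) * Xs n) =
  2 * (beta * (s * ((4 * d%:R + 2 * `|G|) * Xs n))) by ring.
by rewrite -mulrA ler_pM2l.
Qed.

End moment_functionals.

(** * Moments of the iterates *)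

Lemma sum_geom_after_le (R : realType) (r : R) (i n : nat) : 0 <= r < 1 ->
  \sum_(j < n) (if (i <= j)%N then r ^+ (j - i) else 0) <= (1 - r)^-1.
Proof.
move=> /andP[r0 r1]; rewrite -[leRHS]mul1r ler_pdivlMr ?subr_gt0 // mulrC.
have : (1 - r) * (\sum_(j < n) (if (i <= j)%N then r ^+ (j - i) else 0)) <=
    1 - (if (i <= n)%N then r ^+ (n - i) else 1).
  elim: n => [|n ih].
    by rewrite big_ord0 mulr0 leqn0 sub0n expr0; case: eqP => _; rewrite subrr.
  rewrite big_ord_recr /= mulrDr; apply: le_trans (lerD ih (lexx _)) _.
  have [le_in|lt_ni] := leqP i n.
    rewrite leqW // subSn // exprS; move: (r ^+ _) => p.
    by rewrite le_eqVlt; apply/orP; left; apply/eqP; ring.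
  rewrite mulr0 addr0; have [le_in|_] := leqP i n.+1; last by [].
  have -> : i = n.+1 by apply/eqP; rewrite eqn_leq le_in lt_ni.
  by rewrite subnn expr0.
move=> h; apply: le_trans h _; rewrite gerBl; case: ifP => // _.
by rewrite exprn_ge0.
Qed.

Lemma sum_geom_le (R : realType) (r : R) (n : nat) : 0 <= r < 1 ->
  \sum_(j < n) r ^+ j <= (1 - r)^-1.
Proof.
move=> r01; apply: le_trans (sum_geom_after_le 0 n r01).
by apply: ler_sum => j _; rewrite subn0.
Qed.

(** Each covariance is charged to its earlier index i, where the lags sum to at most a i / (1 - r).
    The square contains both orders of a pair, hence the factor 2. *)
Lemma second_moment_sum (R : realType) (dO : measure_display)
    (Omega : measurableType dO) (Pr : probability Omega R)
    (Y : nat -> Omega -> R) (a : nat -> R) (r : R) (n : nat) :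
  0 <= r < 1 -> (forall i, 0 <= a i) -> (forall i, L2 Pr (Y i)) ->
  (forall i m, `|Ex Pr (fun w => Y (i + m)%N w * Y i w)| <= a i * r ^+ m) ->
  Ex Pr (fun w => (\sum_(i < n) Y i w) ^+ 2) <= 2 * (\sum_(i < n) a i) / (1 - r).
Proof.
move=> r01 a0 L2Y hY.
have i2 i j : L1 Pr (fun w => Y i w * Y j w) by exact: L2M.
under eq_fun do rewrite expr2 mulr_suml.
rewrite Ex_sum => [|i]; last first.
  by under eq_fun do rewrite mulr_sumr; exact: L1_sum.
under eq_bigr => i _.
  rewrite (_ : Ex _ _ = \sum_(j < n) Ex Pr (fun w => Y i w * Y j w)); last first.
    by under eq_fun do rewrite mulr_sumr; rewrite Ex_sum.
  over.
pose h (i j : nat) : R := a i * (if (i <= j)%N then r ^+ (j - i) else 0).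
have h0 i j : 0 <= h i j.
  rewrite mulr_ge0 //; case: ifP => // _; rewrite exprn_ge0 //.
  by case/andP: r01.
have hle i j : (i <= j)%N -> `|Ex Pr (fun w => Y i w * Y j w)| <= h i j.
  move=> ij; rewrite /h ij; have := hY i (j - i)%N; rewrite subnKC //.
  by under [X in `|Ex Pr X|]eq_fun do rewrite mulrC.
have cle i j : Ex Pr (fun w => Y i w * Y j w) <= h i j + h j i.
  have [ij|/ltnW ji] := leqP i j.
    by apply: le_trans (ler_norm _) _; apply: le_trans (hle _ _ ij) _; rewrite lerDl.
  under eq_fun do rewrite mulrC.
  by apply: le_trans (ler_norm _) _; apply: le_trans (hle _ _ ji) _; rewrite lerDr.
have hsum : \sum_(i < n) \sum_(j < n) h i j <= (\sum_(i < n) a i) / (1 - r).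
  rewrite mulr_suml; apply: ler_sum => i _; rewrite -mulr_sumr.
  by rewrite ler_wpM2l // sum_geom_after_le.
apply: (@le_trans _ _ (\sum_(i < n) \sum_(j < n) (h i j + h j i))).
  by apply: ler_sum => i _; apply: ler_sum => j _; exact: cle.
under eq_bigr do rewrite big_split.
rewrite big_split /= [X in _ + X]exchange_big /=.
by rewrite -mulrA mulr_natl mulr2n lerD.
Qed.

Lemma sqr_sum_le (R : realType) (n : nat) (a : nat -> R) :
  (\sum_(j < n) a j) ^+ 2 <= n%:R * \sum_(j < n) a j ^+ 2.
Proof.
rewrite expr2 mulr_suml.
apply: (@le_trans _ _ (\sum_(i < n) \sum_(j < n) (a i ^+ 2 + a j ^+ 2) / 2)).
  apply: ler_sum => i _; rewrite mulr_sumr; apply: ler_sum => j _.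
  by have := sqr_ge0 (a i - a j); rewrite !expr2; lra.
rewrite le_eqVlt; apply/orP; left; apply/eqP.
have inner i : \sum_(j < n) (a i ^+ 2 + a j ^+ 2) / 2 =
    n%:R * (a i ^+ 2 / 2) + (\sum_(j < n) a j ^+ 2) / 2.
  rewrite -mulr_suml big_split /= sumr_const card_ord mulrDl; congr (_ + _).
  by rewrite -[X in X / 2 = _]mulr_natl mulrA.
rewrite (eq_bigr _ (fun i _ => inner (nat_of_ord i))) big_split /= sumr_const card_ord.
rewrite -mulr_sumr -mulr_suml -[X in _ + X = _]mulr_natl.
by move: (\sum_(j < n) _) => Q; field.
Qed.

(* The condition on k0 makes the exponential at most alpha tau: this is why the
   third error term of the second moment can be taken to be 0. *)
Lemma lag_tail_bound (R : realType) (g alpha : R) (k0 tau n : nat) :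
  0 < g -> 0 < alpha -> (1 <= tau)%N -> (tau <= n)%N ->
  4 * g / alpha * ln (1 / (alpha * tau%:R)) <= k0%:R ->
  (expR (- (alpha * k0%:R / (4 * g))) / (alpha * n%:R)) ^+ 2 <= tau%:R / n%:R.
Proof.
move=> g0 a0 tau1 taun hk.
have t0 : 0 < tau%:R :> R by rewrite ltr0n.
have n0 : 0 < n%:R :> R by rewrite ltr0n; apply: leq_trans taun.
have at0 : 0 < alpha * tau%:R by rewrite mulr_gt0.
have hE : expR (- (alpha * k0%:R / (4 * g))) <= alpha * tau%:R.
  rewrite -[leRHS]lnK ?posrE // ler_expR lerNl -lnV ?posrE //.
  rewrite ler_pdivlMr ?mulr_gt0 //; move: hk; rewrite div1r.
  rewrite mulrAC ler_pdivrMr // => hk.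
  by rewrite mulrC [leRHS]mulrC.
have E0 := expR_ge0 (- (alpha * k0%:R / (4 * g))).
apply: (@le_trans _ _ ((tau%:R / n%:R) ^+ 2)).
  rewrite ler_sqr ?nnegrE ?divr_ge0 ?mulr_ge0 ?(ltW a0) ?(ltW n0) ?(ltW t0) //.
  rewrite [leRHS](_ : _ = alpha * tau%:R / (alpha * n%:R)); last first.
    by rewrite -mulf_div divff ?mul1r // gt_eqF.
  by rewrite ler_wpM2r // invr_ge0 ltW // mulr_gt0.
rewrite expr2 ler_piMl ?divr_ge0 ?(ltW t0) ?(ltW n0) //.
by rewrite ler_pdivrMr // mul1r ler_nat.
Qed.

(** Here s is alpha^2, and T, t are the tails for alpha and 2 alpha; 4 s is (2 alpha)^2. *)
Lemma extrapolated_mean_le (R : realFieldType) (D s T t p q : R) :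
  0 <= D -> 0 <= T -> t <= T -> p <= D * (s + T) -> q <= D * (4 * s + t) ->
  2 * p + q <= 6 * D * (s + T).
Proof.
by move=> D0 T0 tT; have := mulr_ge0 D0 T0; have := ler_wpM2l D0 tT; lra.
Qed.

(** Here s is alpha^4, i is 1 / n, m is tau / n, and T, t are squared tails. z1 is the squared mean
    and z2, z3 are the variances of the two averages, with the weights of [sqr_extrapolated_le]; 20
    = 2 (8 + 2). *)
Lemma extrapolated_square_le (R : realFieldType) (D D2 s T t i m z1 z2 z3 : R) :
  0 <= D -> 0 <= D2 -> 0 <= s -> i <= m -> T <= m -> t <= T ->
  z1 <= 72 * D2 * (s + T) -> z2 <= D * (i + T) -> z3 <= D * (i + t) ->
  z1 + (8 * z2 + 2 * z3) <= (72 * D2 + 20 * D) * (s + m).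
Proof.
move=> D0 E0 s0 im Tm tT.
have := mulr_ge0 D0 s0; have := ler_wpM2l D0 im; have := ler_wpM2l D0 Tm.
by have := ler_wpM2l D0 tT; have := ler_wpM2l E0 Tm; lra.
Qed.

Lemma sqr_extrapolated_le (R : realFieldType) (p q : R) :
  (2 * p - q) ^+ 2 <= 8 * p ^+ 2 + 2 * q ^+ 2.
Proof. by have := sqr_ge0 (2 * p + q); rewrite !expr2; lra. Qed.

Lemma sqrD_le (R : realFieldType) (p q : R) :
  (p + q) ^+ 2 <= 2 * (p ^+ 2 + q ^+ 2).
Proof. by have := sqr_ge0 (p - q); rewrite !expr2; lra. Qed.

Lemma ler_abs1_sqr (R : realFieldType) (p : R) : `|p| <= 1 + p ^+ 2.
Proof.
rewrite -[p ^+ 2]real_normK ?num_real //; move: `|p| => t.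
by have := sqr_ge0 (t - 2^-1); rewrite !expr2; lra.
Qed.

Lemma ler_norm_young (R : realFieldType) (p q : R) :
  `|p * q| <= 2^-1 * (p ^+ 2 + q ^+ 2).
Proof.
rewrite ler_norml; have := sqr_ge0 (p - q); have := sqr_ge0 (p + q).
by rewrite !expr2; lra.
Qed.

(** * Bounds on the coefficients A and b *)

Section problem_data.
Context (R : realType) (dX : measure_display) (X : measurableType dX).
Context (mu : probability X R) (d : nat).
Context (A : X -> 'M[R]_d) (b : X -> 'cV[R]_d) (theta_star : 'cV[R]_d).
Hypothesis mA : measurable_mx A.
Hypothesis mb : measurable_mx b.
Hypothesis hA : (sup_norm (@opnorm R d d) A <= 1)%E.
Hypothesis hb : (sup_norm (@l2norm R d) b < +oo)%E.
Hypothesis hstar : mx_mean mu A *m theta_star + mx_mean mu b = 0.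

Definition noise (x : X) : 'cV[R]_d := A x *m theta_star + b x.

Lemma opnorm_A_le x : opnorm (A x) <= 1.
Proof.
rewrite -lee_fin; apply: le_trans hA.
by apply: ereal_sup_ubound; exists x.
Qed.

Lemma A_contract x (v : 'cV[R]_d) : l2norm (A x *m v) <= l2norm v.
Proof.
apply: le_trans (l2norm_opnorm _ _) _.
by rewrite ler_piMl ?l2norm_ge0 // opnorm_A_le.
Qed.

Lemma bmeas_A i j : bmeas (fun x => A x i j) 1.
Proof.
split=> [|x]; first exact: mA.
exact: le_trans (ler_abs_opnorm _ _ _) (opnorm_A_le x).
Qed.

Lemma b_bounded : exists M : R, forall x, l2norm (b x) <= M.
Proof.
pose s := sup_norm (@l2norm R d) b.
have hs x : ((l2norm (b x))%:E <= s)%E by apply: ereal_sup_ubound; exists x.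
have fs : s \is a fin_num.
  rewrite ge0_fin_numE //; apply: le_trans (hs point).
  by rewrite lee_fin l2norm_ge0.
by exists (fine s) => x; rewrite -lee_fin fineK.
Qed.

Lemma noise_bounded : exists G : R, forall x, l2norm (noise x) <= G.
Proof.
have [M hM] := b_bounded; exists (l2norm theta_star + M) => x.
by apply: le_trans (l2normD _ _) _; apply: lerD; [exact: A_contract|exact: hM].
Qed.

Lemma bmeas_noise G i : (forall x, l2norm (noise x) <= G) ->
  bmeas (fun x => noise x i 0) G.
Proof.
move=> hG; split=> [|x]; last exact: le_trans (ler_abs_l2norm _ _) (hG x).
rewrite /noise; under eq_fun do rewrite !mxE.
apply: measurable_funD; last exact: mb.
by apply: measurable_sum => j; apply: measurable_funM => //; exact: mA.
Qed.

Lemma mean_A_mul (v : 'cV[R]_d) i :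
  (mx_mean mu A *m v) i 0 = Ex mu (fun x => (A x *m v) i 0).
Proof.
under eq_fun do rewrite mxE.
rewrite Ex_sum; last first.
  by move=> j; have := L1Z (v j 0) (L1_bmeas mu (bmeas_A i j));
    under eq_fun do rewrite mulrC.
rewrite mxE; apply: eq_bigr => j _; rewrite mxE mulrC.
rewrite -ExZ; last exact: L1_bmeas (bmeas_A i j).
by congr Ex; apply/funext => x; rewrite mulrC.
Qed.

Lemma bmeas_A_mul (v : 'cV[R]_d) i : bmeas (fun x => (A x *m v) i 0) (l2norm v).
Proof.
split=> [|x]; last exact: le_trans (ler_abs_l2norm _ _) (A_contract x v).
under eq_fun do rewrite !mxE.
by apply: measurable_sum => j; apply: measurable_funM => //; exact: mA.
Qed.

Lemma noise_mean i : Ex mu (fun x => noise x i 0) = 0.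
Proof.
have [M hM] := b_bounded.
have bb : bmeas (fun x => b x i 0) M.
  by split=> [|x]; [exact: mb|exact: le_trans (ler_abs_l2norm _ _) (hM x)].
have -> : (fun x => noise x i 0) = (fun x => (A x *m theta_star) i 0 + b x i 0).
  by apply/funext => x; rewrite /noise mxE.
rewrite ExD; [|exact: L1_bmeas (bmeas_A_mul _ _)|exact: L1_bmeas bb].
rewrite -mean_A_mul; have := congr1 (fun v : 'cV[R]_d => v i 0) hstar.
by rewrite [RHS]mxE mxE [X in _ + X = _]mxE.
Qed.

(** Jensen's inequality by duality: for w = Abar v, |w|^2 is the mean of w^T A(x) v, at most |w|
    |v|. *)
Lemma mean_A_contract (v : 'cV[R]_d) : l2norm (mx_mean mu A *m v) <= l2norm v.
Proof.
set w := mx_mean mu A *m v.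
have [w0|wn0] := eqVneq (l2norm w) 0; first by rewrite w0 l2norm_ge0.
have wp : 0 < l2norm w by rewrite lt_def wn0 l2norm_ge0.
rewrite -(ler_pM2l wp) -expr2 sqr_l2norm.
have bwA i : bmeas (fun x => w i 0 * (A x *m v) i 0) (`|w i 0| * l2norm v).
  exact: bmeasZ (bmeas_A_mul v i).
have -> : \sum_i w i 0 ^+ 2 = Ex mu (fun x => \sum_i w i 0 * (A x *m v) i 0).
  rewrite Ex_sum => [|i]; last exact: L1_bmeas (bwA i).
  apply: eq_bigr => i _; rewrite ExZ; last exact: L1_bmeas (bmeas_A_mul v i).
  by rewrite -mean_A_mul expr2.
rewrite -(Ex_cst mu (l2norm w * l2norm v)); apply: le_Ex.
- by apply: L1_sum => i; exact: L1_bmeas (bwA i).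
- exact: L1_bmeas (@bmeas_cst _ _ X _).
move=> x; have -> : \sum_i w i 0 * (A x *m v) i 0 = qf 1%:M w (A x *m v).
  rewrite /qf mulmx1 [RHS]mxE; apply: eq_bigr => i _.
  by rewrite [X in _ = X * _]mxE.
apply: le_trans (ler_norm _) _; apply: le_trans (qf_le_qnorm _ _ (psd1 _ _)) _.
by rewrite -!l2norm_qnorm ler_pM2l // A_contract.
Qed.

End problem_data.

Lemma measurable_l2norm (R : realType) dT (T : measurableType dT) (d : nat)
    (f : T -> 'cV[R]_d) :
  measurable_mx f -> measurable_fun [set: T] (fun t => l2norm (f t)).
Proof.
move=> mf; apply: measurableT_comp.
  by apply: continuous_measurable_fun; exact: sqrt_continuous.
by apply: measurable_sum => i; apply: measurable_funX; exact: mf.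
Qed.

(** * Second moment of the initial iterate *)

Section initial_law.
Context (R : realType) (dO : measure_display) (Omega : measurableType dO).
Context (Pr : probability Omega R) (d : nat).
Context (law : probability (d.-tuple R) R) (u : Omega -> 'cV[R]_d).
Hypothesis mu_ : measurable_mx u.
Hypothesis hlaw : has_law Pr u law.
Hypothesis h2 : finite_second_moment law.

(** Computed from the law and not on Omega, so that constants built on it are the same for all
    realizations of the initial iterate. *)
Definition law_second_moment : R :=
  \int[law]_t (l2norm (\col_(i < d) tnth t i)) ^+ 2.

Let T w : d.-tuple R := [tuple u w i 0 | i < d].

Let mT : measurable_fun [set: Omega] T.
Proof.
apply/measurable_fun_tnthP => i.
by rewrite (_ : _ \o _ = (fun w => u w i 0)) //; apply/funext => w /=;
  rewrite tnth_mktuple.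
Qed.

Let phi (t : d.-tuple R) : R := (l2norm (\col_(i < d) tnth t i)) ^+ 2.

Let mphi : measurable_fun [set: d.-tuple R] phi.
Proof.
apply: measurable_funX; apply: measurable_l2norm => i j.
by under eq_fun do rewrite mxE; exact: measurable_tnth.
Qed.

Let phiT w : phi (T w) = l2norm (u w) ^+ 2.
Proof.
by rewrite /phi; congr (l2norm _ ^+ 2); apply/colP => i;
  rewrite mxE tnth_mktuple.
Qed.

Let int_law : (\int[law]_t (phi t)%:E = \int[Pr]_w (l2norm (u w) ^+ 2)%:E)%E.
Proof.
transitivity (\int[pushforward Pr T]_t (phi t)%:E)%E.
  by apply: eq_measure_integral => B mB _; exact/esym/hlaw.
rewrite ge0_integral_pushforward //.
- by apply: eq_integral => w _; rewrite /= phiT.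
- exact/measurable_EFinP.
- by move=> t _; rewrite lee_fin sqr_ge0.
Qed.

Lemma L1_init : L1 Pr (fun w => l2norm (u w) ^+ 2).
Proof.
apply/integrableP; split.
  apply/measurable_EFinP; apply: measurable_funX.
  exact: measurable_l2norm.
under eq_integral do rewrite /= ger0_norm ?sqr_ge0 //.
by rewrite -int_law.
Qed.

Lemma Ex_init : Ex Pr (fun w => l2norm (u w) ^+ 2) = law_second_moment.
Proof. by rewrite /Ex /law_second_moment /Rintegral -int_law. Qed.

End initial_law.

(** * Moments along one data stream *)

Section chain_moments.
Context (R : realType) (dX : measure_display) (X : measurableType dX).
Context (P : R.-pker X ~> X) (d : nat).
Context (A : X -> 'M[R]_d) (b : X -> 'cV[R]_d) (theta_star : 'cV[R]_d) (G : R).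
Hypothesis mA : measurable_mx A.
Hypothesis mb : measurable_mx b.
Hypothesis hA : (sup_norm (@opnorm R d d) A <= 1)%E.
Hypothesis hG : forall x, l2norm (noise A b theta_star x) <= G.
Context (dO : measure_display) (Omega : measurableType dO).
Context (Pr : probability Omega R) (x : nat -> {RV Pr >-> X}).
Context (u : Omega -> 'cV[R]_d).
Hypothesis markov : markov_chain P x.
Hypothesis mu_ : measurable_mx u.
Hypothesis cindep : cond_independent (x 0%N) (sigma_vec u) (sigma_future x).
Hypothesis u_L1 : L1 Pr (fun w => l2norm (u w) ^+ 2).
Variable beta : R.
Hypothesis beta01 : 0 < beta <= 1.

Local Notation nse := (noise A b theta_star).

Definition err n (w : Omega) : 'cV[R]_d :=
  lsa A b (fun n => x n : Omega -> X) beta u n w - theta_star.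

Lemma errS n w :
  err n.+1 w = err n w + beta *: (A (x n w) *m err n w + nse (x n w)).
Proof.
rewrite /err /= /noise mulmxBr addrAC; congr (_ + beta *: _).
by rewrite addrA subrK.
Qed.

Lemma errS_coord n w i : err n.+1 w i 0 = err n w i 0 +
  beta * (\sum_j A (x n w) i j * err n w j 0 + nse (x n w) i 0).
Proof.
rewrite errS; move: (err n w) (A (x n w)) (nse (x n w)) => e B g.
by rewrite !mxE.
Qed.

Lemma gmeas_mono m n (f : Omega -> R) : (m <= n)%N ->
  gmeas (hist x u m) f -> gmeas (hist x u n) f.
Proof.
move=> mn hf _ B mB; rewrite setTI; apply: (@sub_hist _ _ _ _ _ _ _ x u _ _ mn (f @^-1` B)).
by have := hf (@measurableT _ (g_sigma_algebraType (hist x u m))) B mB; rewrite setTI.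
Qed.

Lemma gmeas_x n k (f : X -> R) : (k <= n)%N -> measurable_fun [set: X] f ->
  gmeas (hist x u n) (fun w => f (x k w)).
Proof.
move=> kn mf; apply: (@gmeas_comp _ _ X _ _ _ (x k) f) => // B mB.
exact: hist_x.
Qed.

(** The step to time n uses x_(n-1), so err n is known before x_n; this is the shift that
    [markov_hist] exploits. At n = 0, where n.-1 is 0, the initial iterate belongs to [hist] at
    0. *)
Lemma gmeas_err n i : gmeas (hist x u n.-1) (fun w => err n w i 0).
Proof.
elim: n i => [|n ih] i.
  rewrite /err /=; under eq_fun do rewrite !mxE.
  by apply: measurable_funB => //; exact: hist_u.
have ih' j : gmeas (hist x u n) (fun w => err n w j 0).
  by apply: gmeas_mono (ih j); exact: leq_pred.
rewrite (funext (fun w => errS_coord n w i)).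
apply: measurable_funD; first exact: ih'.
apply: measurable_funM; first exact: measurable_cst.
apply: measurable_funD.
  apply: measurable_sum => j; apply: measurable_funM; last exact: ih'.
  exact: (gmeas_x (leqnn n) (mA i j)).
have mg : measurable_fun [set: X] (fun y => nse y i 0).
  by case: (bmeas_noise mA mb i hG).
exact: (gmeas_x (leqnn n) mg).
Qed.

Lemma gmeas_err_le n k i : (n.-1 <= k)%N ->
  gmeas (hist x u k) (fun w => err n w i 0).
Proof. by move=> h; exact: (gmeas_mono h (@gmeas_err n i)). Qed.

Lemma err_measurable n : measurable_mx (err n).
Proof.
move=> i j; rewrite (ord1 j).
by apply: (gmeas_measurable (@hist_measurable _ _ _ _ _ _ _ x u mu_ _)) (@gmeas_err n i).
Qed.

Lemma bmeas_Ax n i j : bmeas (fun w => A (x n w) i j) 1.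
Proof. exact: (bmeas_RV (x n) (bmeas_A mA hA i j)). Qed.

Lemma bmeas_noisex n i : bmeas (fun w => nse (x n w) i 0) G.
Proof. exact: (bmeas_RV (x n) (bmeas_noise mA mb i hG)). Qed.

Lemma L2_err n i : L2 Pr (fun w => err n w i 0).
Proof.
elim: n i => [|n ih] i.
  have mu0 : measurable_fun [set: Omega] (fun w => u w i 0) by exact: mu_.
  have hu : L2 Pr (fun w => u w i 0).
    split=> //; apply: L1_dominated u_L1 _; first exact: measurable_funX.
    move=> w; rewrite ger0_norm ?sqr_ge0 // sqr_l2norm (bigD1 i) //=.
    by rewrite lerDl sumr_ge0 // => j _; exact: sqr_ge0.
  rewrite /err /=; under eq_fun do rewrite !mxE.
  exact: L2D hu (L2_cst Pr _).
rewrite (funext (fun w => errS_coord n w i)).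
apply: L2D => //; apply: L2Z; apply: L2D.
  by apply: L2_sum => j; exact: L2_bM (bmeas_Ax n i j) (ih j).
exact: L2_bmeas (bmeas_noisex n i).
Qed.

Lemma L1_sqr_err n : L1 Pr (fun w => l2norm (err n w) ^+ 2).
Proof.
under eq_fun do rewrite sqr_l2norm.
by apply: L1_sum => i; case: (L2_err n i).
Qed.

Definition msq n : R := Ex Pr (fun w => l2norm (err n w) ^+ 2).

Lemma msq_ge0 n : 0 <= msq n.
Proof. by apply: Ex_ge0 => w; exact: sqr_ge0. Qed.

Lemma L2_l2norm_err n : L2 Pr (fun w => l2norm (err n w)).
Proof.
split; last exact: L1_sqr_err.
by apply: measurable_l2norm; exact: err_measurable.
Qed.

Definition quad_moment n i j (f : X -> R) : R :=
  Ex Pr (fun w => f (x n w) * (err n w i 0 * err n w j 0)).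

Definition lin_moment n i (f : X -> R) : R := Ex Pr (fun w => f (x n w) * err n w i 0).

Lemma err_le n w i : `|err n w i 0| <= l2norm (err n w).
Proof. exact: ler_abs_l2norm. Qed.

Definition incr n w : 'cV[R]_d := A (x n w) *m err n w + nse (x n w).

Lemma incr_le n w : l2norm (incr n w) <= l2norm (err n w) + G.
Proof.
by apply: le_trans (l2normD _ _) _; apply: lerD => //; exact: A_contract.
Qed.

Lemma G_ge0 : 0 <= G. Proof. exact: le_trans (l2norm_ge0 _) (hG point). Qed.

Lemma L1_sqr_msq c n : L1 Pr (fun w => c * (1 + l2norm (err n w) ^+ 2)).
Proof.
by apply: L1Z; apply: L1D; [exact: L1_bmeas (@bmeas_cst _ _ _ 1)|exact: L1_sqr_err].
Qed.

Lemma Ex_sqr_msq c n :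
  Ex Pr (fun w => c * (1 + l2norm (err n w) ^+ 2)) = c * (1 + msq n).
Proof.
rewrite ExZ; last first.
  by have := L1_sqr_msq 1 n; under eq_fun do rewrite mul1r.
rewrite ExD ?Ex_cst //; [exact: L1_bmeas (@bmeas_cst _ _ _ 1)|exact: L1_sqr_err].
Qed.

Lemma Ex_dominated c n (f : Omega -> R) : measurable_fun [set: Omega] f ->
  (forall w, `|f w| <= c * (1 + l2norm (err n w) ^+ 2)) ->
  `|Ex Pr f| <= c * (1 + msq n).
Proof.
move=> mf hf; rewrite -Ex_sqr_msq; apply: Ex_norm_le => //.
  exact: L1_dominated (L1_sqr_msq c n) hf.
exact: L1_sqr_msq.
Qed.

Lemma L1_quad_moment n i j f M : bmeas f M ->
  L1 Pr (fun w => f (x n w) * (err n w i 0 * err n w j 0)).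
Proof.
move=> bf; apply: L1_bM (bmeas_RV (x n) bf) _.
exact: L2M (L2_err n i) (L2_err n j).
Qed.

Lemma L1_lin_moment n i f M : bmeas f M -> L1 Pr (fun w => f (x n w) * err n w i 0).
Proof. by move=> bf; apply: L1_bM (bmeas_RV (x n) bf) (L2_L1 (L2_err n i)). Qed.

Lemma quad_moment0_le i j f M : bmeas f M -> `|quad_moment 0%N i j f| <= M * (1 + msq 0%N).
Proof.
move=> bf; apply: Ex_dominated; first exact: L1_meas (L1_quad_moment _ _ _ bf).
move=> w; rewrite !normrM; apply: ler_pM => //; first by case: bf.
have h1 := err_le 0 w i; have h2 := err_le 0 w j.
apply: (@le_trans _ _ (l2norm (err 0 w) ^+ 2)); last by rewrite lerDr.
by rewrite expr2; apply: ler_pM.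
Qed.

Lemma lin_moment0_le i f M : bmeas f M -> `|lin_moment 0%N i f| <= M * (1 + msq 0%N).
Proof.
move=> bf; apply: Ex_dominated; first exact: L1_meas (L1_lin_moment _ _ bf).
move=> w; rewrite !normrM; apply: ler_pM => //; first by case: bf.
apply: le_trans (err_le 0 w i) _; move: (l2norm _) => t.
by have := sqr_ge0 (t - 2^-1); rewrite !expr2; lra.
Qed.

Lemma markov_quad_moment n i j f M : bmeas f M -> quad_moment n.+1 i j f =
  Ex Pr (fun w => op P f (x n w) * (err n.+1 w i 0 * err n.+1 w j 0)).
Proof.
move=> bf; apply: (markov_hist markov mu_ cindep bf).
  apply: measurable_funM; [exact: (@gmeas_err n.+1 i)|exact: (@gmeas_err n.+1 j)].
exact: L2M (L2_err _ _) (L2_err _ _).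
Qed.

Lemma markov_lin_moment n i f M : bmeas f M ->
  lin_moment n.+1 i f = Ex Pr (fun w => op P f (x n w) * err n.+1 w i 0).
Proof.
move=> bf; apply: (markov_hist markov mu_ cindep bf); first exact: (@gmeas_err n.+1 i).
exact: L2_L1 (L2_err _ _).
Qed.

(** The Markov property trades f(x_(n+1)) for op f(x_n); what remains is the change of the error,
    beta times an increment of norm at most t + G with t = |e_n|. The constant comes from 2 t (t +
    G) + (t + G)^2 <= 5 t^2 + 3 G^2. *)
Lemma quad_moment_step (K : R) n i j f M : 5 + 3 * G ^+ 2 <= K -> bmeas f M ->
  `|quad_moment n.+1 i j f - quad_moment n i j (op P f)| <= beta * (K * (1 + msq n)) * M.
Proof.
move=> hK bf; have bof := bmeas_op P bf.
rewrite (markov_quad_moment _ _ _ bf).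
have i1 : L1 Pr (fun w => op P f (x n w) * (err n.+1 w i 0 * err n.+1 w j 0)).
  by apply: L1_bM (bmeas_RV (x n) bof) _; exact: L2M (L2_err _ _) (L2_err _ _).
have i2 := L1_quad_moment n i j bof.
rewrite /quad_moment -mulN1r -ExZ // -ExD //; last exact: L1Z.
have -> : beta * (K * (1 + msq n)) * M = (M * (beta * K)) * (1 + msq n) by ring.
apply: Ex_dominated; first by apply: L1_meas (L1D i1 (L1Z _ i2)).
move=> w.
have -> : op P f (x n w) * (err n.+1 w i 0 * err n.+1 w j 0) +
    -1 * (op P f (x n w) * (err n w i 0 * err n w j 0)) =
    op P f (x n w) * (beta * (err n w i 0 * incr n w j 0 + incr n w i 0 * err n w j 0 +
     beta * (incr n w i 0 * incr n w j 0))).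
  by rewrite errS -/(incr n w) !mxE; ring.
have /andP[b0 b1] := beta01.
rewrite normrM -mulrA; apply: ler_pM => //; first by case: bof.
rewrite normrM gtr0_norm // -mulrA ler_pM2l //.
have e1 := err_le n w i; have e2 := err_le n w j.
have d1 := le_trans (ler_abs_l2norm (incr n w) i) (incr_le n w).
have d2 := le_trans (ler_abs_l2norm (incr n w) j) (incr_le n w).
have G0 := G_ge0; have t0 := l2norm_ge0 (err n w).
move: (l2norm (err n w)) t0 e1 e2 d1 d2 => t t0 e1 e2 d1 d2.
apply: (@le_trans _ _ (t * (t + G) + (t + G) * t + 1 * ((t + G) * (t + G)))).
  apply: le_trans (ler_normD _ _) _; apply: lerD.
    by apply: le_trans (ler_normD _ _) _; rewrite !normrM; apply: lerD; apply: ler_pM.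
  by rewrite !normrM; apply: ler_pM => //; [rewrite gtr0_norm|apply: ler_pM].
have : (5 + 3 * G ^+ 2) * (1 + t ^+ 2) <= K * (1 + t ^+ 2).
  by apply: ler_wpM2r => //; rewrite addr_ge0 // sqr_ge0.
apply: le_trans.
by have := sqr_ge0 (t - G); have := mulr_ge0 (sqr_ge0 G) (sqr_ge0 t); rewrite !expr2; lra.
Qed.

Lemma lin_moment_step (K : R) n i f M : 5 + 3 * G ^+ 2 <= K -> bmeas f M ->
  `|lin_moment n.+1 i f - lin_moment n i (op P f)| <= beta * (K * (1 + msq n)) * M.
Proof.
move=> hK bf; have bof := bmeas_op P bf.
rewrite (markov_lin_moment _ _ bf).
have i1 : L1 Pr (fun w => op P f (x n w) * err n.+1 w i 0).
  by apply: L1_bM (bmeas_RV (x n) bof) _; exact: L2_L1 (L2_err _ _).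
have i2 := L1_lin_moment n i bof.
rewrite /lin_moment -mulN1r -ExZ // -ExD //; last exact: L1Z.
have -> : beta * (K * (1 + msq n)) * M = (M * (beta * K)) * (1 + msq n) by ring.
apply: Ex_dominated; first by apply: L1_meas (L1D i1 (L1Z _ i2)).
move=> w.
have -> : op P f (x n w) * err n.+1 w i 0 +
    -1 * (op P f (x n w) * err n w i 0) =
    op P f (x n w) * (beta * incr n w i 0).
  by rewrite errS -/(incr n w) !mxE; ring.
have /andP[b0 b1] := beta01.
rewrite normrM -mulrA; apply: ler_pM => //; first by case: bof.
rewrite normrM gtr0_norm // -mulrA ler_pM2l //.
have d1 := le_trans (ler_abs_l2norm (incr n w) i) (incr_le n w).
apply: le_trans d1 _.
have G0 := G_ge0; have t0 := l2norm_ge0 (err n w).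
move: (l2norm (err n w)) t0 => t t0.
have : (5 + 3 * G ^+ 2) * (1 + t ^+ 2) <= K * (1 + t ^+ 2).
  by apply: ler_wpM2r => //; rewrite addr_ge0 // sqr_ge0.
apply: le_trans.
have := sqr_ge0 (t - 1); have := sqr_ge0 (G - 1).
have := sqr_ge0 t; have := sqr_ge0 G.
by have := mulr_ge0 (sqr_ge0 G) (sqr_ge0 t); rewrite !expr2; lra.
Qed.

Context (mu : probability X R) (Gamma : 'M[R]_d) (gmax : R).
Local Notation Abar := (mx_mean mu A).
Hypothesis hGsym : Gamma^T = Gamma.
Hypothesis hGpos : posdefmx Gamma.
Hypothesis hgmax : max_eigenvalue Gamma gmax.
Hypothesis hGlyap : Abar^T *m Gamma + Gamma *m Abar = - 1%:M.

Definition lyap n : R := Ex Pr (fun w => qf Gamma (err n w) (err n w)).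

Lemma L1_qf n : L1 Pr (fun w => qf Gamma (err n w) (err n w)).
Proof.
rewrite (funext (fun w => qfE Gamma (err n w) (err n w))).
apply: L1_sum => i; apply: L1_sum => j; apply: L1Z.
exact: L2M (L2_err n i) (L2_err n j).
Qed.

(** Abar gives the drift - beta |e|^2 by the Lyapunov equation. What is left at first order has
    coefficients A - Abar and the noise; in expectation it becomes [quad_moment] and [lin_moment] at
    centered functions, as in [second_moment_bound]. *)
Lemma lyap_pathwise (K : R) n w : 0 <= gmax -> 2 * gmax * (1 + G ^+ 2) <= K ->
  qf Gamma (err n.+1 w) (err n.+1 w) <=
  qf Gamma (err n w) (err n w) + - beta * l2norm (err n w) ^+ 2 +
  2 * beta * (\sum_i \sum_j Gamma i j *
    (\sum_k (A (x n w) j k - Abar j k) * (err n w i 0 * err n w k 0) +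
     nse (x n w) j 0 * err n w i 0)) +
  beta ^+ 2 * (K * (1 + l2norm (err n w) ^+ 2)).
Proof.
move=> g0 hK; have hD := incr_le n w; rewrite errS.
rewrite /incr in hD; move: (err n w) (A (x n w)) (nse (x n w)) hD => e B g hD.
have -> : \sum_i \sum_j Gamma i j *
    (\sum_k (B j k - Abar j k) * (e i 0 * e k 0) + g j 0 * e i 0) =
  qf Gamma e ((B - Abar) *m e + g).
  rewrite qfE; apply: eq_bigr => i _; apply: eq_bigr => j _.
  congr (_ * _); rewrite mxE mulrDr; congr (_ + _); last exact: mulrC.
  rewrite mxE mulr_sumr; apply: eq_bigr => k _.
  by move: Abar => M; rewrite !mxE; ring.
have lyap0 := lyapunov_cross hGsym hGlyap e.
have step : qf Gamma (B *m e + g) (B *m e + g) <= K * (1 + l2norm e ^+ 2).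
  apply: le_trans (qf_le_gmax hGsym hGpos hgmax _) _.
  have t0 := l2norm_ge0 e; have G0 := G_ge0; have l0 := l2norm_ge0 (B *m e + g).
  have h2 : l2norm (B *m e + g) ^+ 2 <= 2 * ((1 + G ^+ 2) * (1 + l2norm e ^+ 2)).
    apply: (@le_trans _ _ ((l2norm e + G) ^+ 2)).
      by rewrite ler_sqr ?nnegrE // addr_ge0.
    move: (l2norm e) => t; have := sqr_ge0 (t - G).
    by have := mulr_ge0 (sqr_ge0 G) (sqr_ge0 t); rewrite !expr2; lra.
  apply: le_trans (ler_wpM2l g0 h2) _.
  rewrite [leLHS](_ : _ = 2 * gmax * (1 + G ^+ 2) * (1 + l2norm e ^+ 2)); last by ring.
  by rewrite ler_wpM2r // addr_ge0 // sqr_ge0.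
have step' := ler_wpM2l (sqr_ge0 beta) step.
have eD : B *m e + g = Abar *m e + ((B - Abar) *m e + g).
  by rewrite mulmxBl addrA addrCA subrr addr0.
rewrite eD in step' *.
move: ((B - Abar) *m e + g) step' => v step'.
rewrite qfDl !qfDr !qfZl !qfZr !qfDr !qfDl.
rewrite !qfDl !qfDr in step'.
rewrite (qfC _ e hGsym) (qfC v e hGsym).
apply: le_trans (lerD (lexx _) step').
have hb : beta * (2 * qf Gamma e (Abar *m e)) = beta * (- l2norm e ^+ 2) by rewrite lyap0.
by rewrite le_eqVlt; apply/orP; left; apply/eqP; rewrite mulNr -mulrN -hb; ring.
Qed.

Lemma lyap_step (K : R) n : 0 <= gmax -> 2 * gmax * (1 + G ^+ 2) <= K ->
  lyap n.+1 <= lyap n - beta * msq n +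
   2 * beta * (\sum_i \sum_j Gamma i j *
     (\sum_k quad_moment n i k (fun y => A y j k - Abar j k) +
      lin_moment n i (fun y => nse y j 0))) + beta ^+ 2 * (K * (1 + msq n)).
Proof.
move=> g0 hK.
have bF j k : bmeas (fun y => A y j k - Abar j k) (1 + `|Abar j k|).
  apply: bmeasB; first exact: bmeas_A.
  by apply: bmeasW (@bmeas_cst _ _ X _).
have iF i j k : L1 Pr (fun w => (A (x n w) j k - Abar j k) * (err n w i 0 * err n w k 0)).
  exact: L1_quad_moment (bF j k).
have ig i j : L1 Pr (fun w => nse (x n w) j 0 * err n w i 0).
  exact: L1_lin_moment (bmeas_noise mA mb j hG).
have iS i j : L1 Pr (fun w => \sum_k (A (x n w) j k - Abar j k) *
    (err n w i 0 * err n w k 0) + nse (x n w) j 0 * err n w i 0).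
  by apply: L1D => //; exact: L1_sum.
have iD : L1 Pr (fun w => \sum_i \sum_j Gamma i j *
    (\sum_k (A (x n w) j k - Abar j k) * (err n w i 0 * err n w k 0) +
     nse (x n w) j 0 * err n w i 0)).
  by apply: L1_sum => i; apply: L1_sum => j; exact: L1Z.
have i1 := L1_qf n; have i2 := L1Z (- beta) (L1_sqr_err n).
have i3 := L1Z (2 * beta) iD; have i4 := L1Z (beta ^+ 2) (L1_sqr_msq K n).
apply: le_trans (le_Ex (L1_qf n.+1) (L1D (L1D (L1D i1 i2) i3) i4)
  (fun w => lyap_pathwise n w g0 hK)) _.
rewrite ExD //; last by apply: L1D => //; exact: L1D.
rewrite ExD //; last exact: L1D.
rewrite ExD // (ExZ _ (L1_sqr_err n)) (ExZ _ iD) (ExZ _ (L1_sqr_msq K n)).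
rewrite Ex_sqr_msq mulNr Ex_sum => [|i]; last by apply: L1_sum => j; exact: L1Z.
rewrite le_eqVlt; apply/orP; left; apply/eqP.
congr (_ + 2 * beta * _ + _); apply: eq_bigr => i _.
rewrite Ex_sum => [|j]; last exact: L1Z.
apply: eq_bigr => j _; rewrite ExZ // ExD //; last exact: L1_sum.
by rewrite Ex_sum.
Qed.

Lemma msq0_le : msq 0%N <=
  2 * (Ex Pr (fun w => l2norm (u w) ^+ 2) + l2norm theta_star ^+ 2).
Proof.
have i1 : L1 Pr (fun w => 2 * (l2norm (u w) ^+ 2 + l2norm theta_star ^+ 2)).
  by apply: L1Z; apply: L1D => //; exact: L1_bmeas (@bmeas_cst _ _ _ _).
apply: (@le_trans _ _ (Ex Pr (fun w => 2 * (l2norm (u w) ^+ 2 + l2norm theta_star ^+ 2)))).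
  apply: le_Ex => //; first exact: L1_sqr_err.
  move=> w; rewrite /err /=.
  apply: (@le_trans _ _ ((l2norm (u w) + l2norm theta_star) ^+ 2)).
    rewrite ler_sqr ?nnegrE ?addr_ge0 ?l2norm_ge0 //.
    by apply: le_trans (l2normD _ _) _; rewrite l2normN.
  have := sqr_ge0 (l2norm (u w) - l2norm theta_star).
  by move: (l2norm _) (l2norm _) => s t; rewrite !expr2; lra.
rewrite ExZ ?ExD ?Ex_cst //; first exact: L1_bmeas (@bmeas_cst _ _ _ _).
by apply: L1D => //; exact: L1_bmeas (@bmeas_cst _ _ _ _).
Qed.

Section weighted_moments.
Variables (s : nat) (zeta : Omega -> R).
Hypothesis gzeta : gmeas (hist x u s) zeta.
Hypothesis zeta_L2 : L2 Pr zeta.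

Definition weighted_mass n (f : X -> R) : R :=
  Ex Pr (fun w => f (x (s + n)%N w) * zeta w).

Definition weighted_moment n i (f : X -> R) : R :=
  Ex Pr (fun w => f (x (s + n)%N w) * (err (s + n) w i 0 * zeta w)).

Let L1_mass n f M : bmeas f M -> L1 Pr (fun w => f (x (s + n)%N w) * zeta w).
Proof. by move=> bf; apply: L1_bM (bmeas_RV _ bf) (L2_L1 zeta_L2). Qed.

Let L1_moment k n i f M : bmeas f M ->
  L1 Pr (fun w => f (x k w) * (err n w i 0 * zeta w)).
Proof. by move=> bf; apply: L1_bM (bmeas_RV _ bf) (L2M (L2_err n i) zeta_L2). Qed.

Let L2_abs_zeta : L2 Pr (fun w => `|zeta w|).
Proof.
case: zeta_L2 => mz iz; split; first exact: measurableT_comp.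
by have -> : (fun w => `|zeta w| ^+ 2) = (fun w => zeta w ^+ 2);
  [apply/funext => w; rewrite real_normK ?num_real|].
Qed.

(** The clock starts at s. Since zeta is a function of the history up to s, it remains in the past
    at each later step and is a mere factor in the Markov property. *)
Lemma weighted_first_moments : first_moments P A nse beta
  (Ex Pr (fun w => `|zeta w|)) (Ex Pr (fun w => l2norm (err s w) * `|zeta w|))
  weighted_mass weighted_moment.
Proof.
split.
- split=> [n|n i] f g a M N bf bg.
    rewrite /weighted_mass -ExZ ?(L1_mass _ bg) //.
    rewrite -ExD ?(L1_mass _ bf) //; last by apply: L1Z; exact: L1_mass bg.
    by congr Ex; apply/funext => w; ring.
  rewrite /weighted_moment -ExZ ?(L1_moment _ _ _ bg) //.
  rewrite -ExD ?(L1_moment _ _ _ bf) //; last by apply: L1Z; exact: L1_moment bg.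
  by congr Ex; apply/funext => w; ring.
- move=> f M bf; rewrite /weighted_mass -ExZ; last exact: L2_L1.
  apply: Ex_norm_le; first exact: L1_mass bf.
    by apply: L1Z; exact: L2_L1.
  by move=> w; rewrite normrM ler_wpM2r //; case: bf.
- move=> i f M bf; rewrite /weighted_moment addn0.
  have h := L2M (L2_l2norm_err s) L2_abs_zeta.
  rewrite -ExZ //; apply: Ex_norm_le; [exact: L1_moment bf|exact: L1Z|].
  move=> w; rewrite normrM; apply: ler_pM => //; first by case: bf.
  by rewrite normrM ler_wpM2r // err_le.
- move=> n f M bf; rewrite /weighted_mass addnS.
  apply: (markov_hist markov mu_ cindep bf); last exact: L2_L1.
  exact: (gmeas_mono (leq_addr n s) gzeta).
- move=> n i f M bf; have bof := bmeas_op P bf.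
  rewrite /weighted_moment addnS.
  rewrite (markov_hist markov mu_ cindep bf); first last.
  + exact: L2M (L2_err _ _) zeta_L2.
  + apply: measurable_funM; first exact: (@gmeas_err (s + n).+1 i).
    exact: (gmeas_mono (leq_addr n s) gzeta).
  have bA j := bmeasM (bmeas_A mA hA i j) bof.
  have bg := bmeasM (bmeas_noise mA mb i hG) bof.
  have iA : L1 Pr (fun w => \sum_j (A (x (s + n)%N w) i j * op P f (x (s + n)%N w)) *
      (err (s + n) w j 0 * zeta w)).
    by apply: L1_sum => j; exact: L1_moment (bA j).
  rewrite /weighted_mass -Ex_sum => [|j]; last exact: L1_moment (bA j).
  rewrite -ExD //; last exact: L1_mass bg.
  rewrite -ExZ; last by apply: L1D => //; exact: L1_mass bg.
  rewrite -ExD; first last.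
  + by apply: L1Z; apply: L1D => //; exact: L1_mass bg.
  + exact: L1_moment bof.
  congr Ex; apply/funext => w; rewrite errS_coord.
  rewrite [in RHS](eq_bigr (fun j => (op P f (x (s + n)%N w) * zeta w) *
    (A (x (s + n)%N w) i j * err (s + n) w j 0))); last by move=> j _; ring.
  by rewrite -mulr_sumr; ring.
Qed.

Lemma total_weighted_moment n i :
  total_moment weighted_moment n i 0 = Ex Pr (fun w => err (s + n) w i 0 * zeta w).
Proof.
by rewrite mxE /weighted_moment; congr Ex; apply/funext => w; rewrite mul1r.
Qed.

Lemma weighted_massE : weighted_mass 0%N (fun=> 1) = Ex Pr zeta.
Proof. by rewrite /weighted_mass; congr Ex; apply/funext => w; rewrite mul1r. Qed.

End weighted_moments.

Definition dev n i (w : Omega) : R :=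
  err n w i 0 - Ex Pr (fun w => err n w i 0).

Lemma L2_dev n i : L2 Pr (dev n i).
Proof. exact: L2D (L2_err n i) (L2_cst Pr _). Qed.

Lemma Ex_dev n i : Ex Pr (dev n i) = 0.
Proof.
rewrite /dev ExD ?Ex_cst ?subrr //; first exact: L2_L1 (L2_err n i).
exact: L2_L1 (L2_cst Pr _).
Qed.

Lemma Ex_sqr_dev n i : Ex Pr (fun w => dev n i w ^+ 2) <= msq n.
Proof.
have ie := L2_L1 (L2_err n i); have ie2 := (L2_err n i).2.
pose c := Ex Pr (fun w => err n w i 0).
have -> : (fun w => dev n i w ^+ 2) =
    (fun w => err n w i 0 ^+ 2 + ((- 2 * c) * err n w i 0 + c ^+ 2)).
  by apply/funext => w; rewrite /dev -/c; ring.
rewrite ExD //; last first.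
  by apply: L1D; [exact: L1Z|exact: L2_L1 (L2_cst Pr _)].
have ic : L1 Pr (fun=> c ^+ 2) := L2_L1 (L2_cst Pr _).
rewrite (ExD (L1Z (-2 * c) ie) ic) (ExZ _ ie) Ex_cst.
apply: (@le_trans _ _ (Ex Pr (fun w => err n w i 0 ^+ 2))).
  by rewrite gerDl -/c; have := sqr_ge0 c; rewrite !expr2; lra.
apply: le_Ex => //; first exact: L1_sqr_err.
move=> w; rewrite sqr_l2norm (bigD1 i) //= lerDl sumr_ge0 // => j _.
exact: sqr_ge0.
Qed.

Section first_order.
Variables (B : 'cV[R]_d) (r C : R).
Hypothesis r01 : 0 <= r < 1.
Hypothesis C0 : 0 <= C.
Hypothesis first_bound : forall (z z' : R) m0 m, 0 <= z' ->
  first_moments P A nse beta z z' m0 m -> forall n,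
  l2norm (total_moment m n - (beta * m0 0%N (fun=> 1)) *: B) <=
    C * ((z' + beta * z) * r ^+ n + beta ^+ 2 * `|m0 0%N (fun=> 1)|).

Let weighted_bound s zeta n i : gmeas (hist x u s) zeta -> L2 Pr zeta ->
  `|Ex Pr (fun w => err (s + n) w i 0 * zeta w) - beta * Ex Pr zeta * B i 0| <=
  C * ((Ex Pr (fun w => l2norm (err s w) * `|zeta w|) +
        beta * Ex Pr (fun w => `|zeta w|)) * r ^+ n +
       beta ^+ 2 * `|Ex Pr zeta|).
Proof.
move=> gz zL2.
have z'0 : 0 <= Ex Pr (fun w => l2norm (err s w) * `|zeta w|).
  by apply: Ex_ge0 => w; rewrite mulr_ge0 // l2norm_ge0.
have := first_bound z'0 (weighted_first_moments gz zL2) n.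
rewrite weighted_massE; apply: le_trans.
rewrite -total_weighted_moment; move: (total_moment _ _) => v.
by apply: le_trans (ler_abs_l2norm _ i); rewrite !mxE.
Qed.

(** Weight 1 started at time 0: then z = 1 and z' is the mean of |e_0|, at most 1 plus that of
    |e_0|^2. *)
Lemma mean_err_bound n i :
  `|Ex Pr (fun w => err n w i 0) - beta * B i 0| <=
  C * ((2 + msq 0%N) * r ^+ n + beta ^+ 2).
Proof.
have g1 : gmeas (hist x u 0) (fun=> 1 : R) by exact: measurable_cst.
have := weighted_bound n i g1 (L2_cst Pr 1).
have -> : (fun w => err (0 + n) w i 0 * 1) = (fun w => err n w i 0).
  by apply/funext => w; rewrite mulr1 add0n.
rewrite Ex_cst normr1 !mulr1 => /le_trans; apply.
rewrite Ex_cst mulr1 ler_wpM2l // lerD2r ler_wpM2r ?exprn_ge0 //; first by case/andP: r01.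
have := @Ex_dominated 1 0 (fun w => l2norm (err 0 w) * 1).
rewrite mul1r; have /andP[_ b1] := beta01.
move=> h; suff: `|Ex Pr (fun w => l2norm (err 0 w) * 1)| <= 1 + msq 0%N.
  by rewrite ler_norml => /andP[_ h']; lra.
apply: h; first by apply: measurable_funM => //; exact: L2_meas (L2_l2norm_err 0).
move=> w; rewrite mulr1 mul1r ger0_norm ?l2norm_ge0 //.
move: (l2norm _) => t; have := sqr_ge0 (t - 2^-1); rewrite !expr2; lra.
Qed.

(** The weight [dev] s i has mean 0, so both the bias beta B and the beta^2 term disappear and only
    geometric decay remains. Centering the later factor changes nothing, for the same reason. *)
Lemma cov_bound s n i :
  `|Ex Pr (fun w => dev (s + n) i w * dev s i w)| <=
  C * (2 * msq s + beta) * r ^+ n.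
Proof.
have gz : gmeas (hist x u s) (dev s i).
  by apply: measurable_funB; [exact: (gmeas_err_le i (leq_pred s))|exact: measurable_cst].
have := weighted_bound n i gz (L2_dev s i).
rewrite Ex_dev normr0 !mulr0 mul0r subr0 addr0.
have -> : Ex Pr (fun w => dev (s + n) i w * dev s i w) =
    Ex Pr (fun w => err (s + n) w i 0 * dev s i w).
  set c := Ex Pr (fun w => err (s + n) w i 0).
  have -> : (fun w => dev (s + n) i w * dev s i w) =
      (fun w => err (s + n) w i 0 * dev s i w + (- c) * dev s i w).
    by apply/funext => w; rewrite /dev -/c; ring.
  have id1 := L2_L1 (L2_dev s i).
  rewrite (ExD (L2M (L2_err _ _) (L2_dev s i)) (L1Z (- c) id1)) (ExZ _ id1).
  by rewrite Ex_dev mulr0 addr0.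
move=> /le_trans; apply; rewrite -mulrA ler_wpM2l // ler_wpM2r ?exprn_ge0 //.
  by case/andP: r01.
have id2 := (L2_dev s i).2.
have hdev := Ex_sqr_dev s i.
have mdev : measurable_fun [set: Omega] (fun w => `|dev s i w|).
  by apply: measurableT_comp => //; exact: L2_meas (L2_dev s i).
have h1 : Ex Pr (fun w => l2norm (err s w) * `|dev s i w|) <= msq s.
  have i1 : L1 Pr (fun w => 2^-1 * (l2norm (err s w) ^+ 2 + dev s i w ^+ 2)).
    by apply: L1Z; apply: L1D => //; exact: L1_sqr_err.
  have le w : l2norm (err s w) * `|dev s i w| <=
      2^-1 * (l2norm (err s w) ^+ 2 + dev s i w ^+ 2).
    rewrite -[dev s i w ^+ 2]real_normK ?num_real //.
    move: (l2norm _) `|_| => a c; have := sqr_ge0 (a - c); rewrite !expr2; lra.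
  apply: (@le_trans _ _ (2^-1 * (msq s + Ex Pr (fun w => dev s i w ^+ 2)))); last lra.
  rewrite -ExD ?L1_sqr_err // -ExZ; last by apply: L1D => //; exact: L1_sqr_err.
  apply: le_Ex => //; apply: L1_dominated i1 _.
    by apply: measurable_funM => //; exact: L2_meas (L2_l2norm_err s).
  by move=> w; rewrite ger0_norm ?le // mulr_ge0 // l2norm_ge0.
have h2 : Ex Pr (fun w => `|dev s i w|) <= 1 + msq s.
  have i1 : L1 Pr (fun w => 1 + dev s i w ^+ 2).
    by apply: L1D => //; exact: L2_L1 (L2_cst Pr 1).
  apply: (@le_trans _ _ (Ex Pr (fun w => 1 + dev s i w ^+ 2))).
    have le w : `|dev s i w| <= 1 + dev s i w ^+ 2.
      rewrite -[dev s i w ^+ 2]real_normK ?num_real //.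
      move: `|_| => t; have := sqr_ge0 (t - 2^-1); rewrite !expr2; lra.
    apply: le_Ex => //; apply: L1_dominated i1 _ => //.
    by move=> w; rewrite normr_id.
  by rewrite ExD ?Ex_cst ?lerD2l //; exact: L2_L1 (L2_cst Pr 1).
have /andP[b0 b1] := beta01.
have h3 := ler_wpM2l (ltW b0) h2.
have h4 : beta * msq s <= msq s by rewrite ler_piMl // msq_ge0.
lra.
Qed.

Definition avg_err k0 n i (w : Omega) : R :=
  n%:R^-1 * \sum_(j < n) err (k0 + j)%N w i 0.

Lemma L2_avg_err k0 n i : L2 Pr (avg_err k0 n i).
Proof. by apply: L2Z; apply: L2_sum => j; exact: L2_err. Qed.

Lemma Ex_avg_err k0 n i : Ex Pr (avg_err k0 n i) =
  n%:R^-1 * \sum_(j < n) Ex Pr (fun w => err (k0 + j)%N w i 0).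
Proof.
have h j : L1 Pr (fun w => err (k0 + j)%N w i 0) by exact: L2_L1 (L2_err _ i).
by rewrite /avg_err ExZ ?Ex_sum //; apply: L1_sum.
Qed.

Lemma mean_avg_bound k0 n i : (0 < n)%N ->
  `|Ex Pr (avg_err k0 n i) - beta * B i 0| <=
  C * ((2 + msq 0%N) * (r ^+ k0 / (n%:R * (1 - r))) + beta ^+ 2).
Proof.
move=> n0; have n0' : 0 < n%:R :> R by rewrite ltr0n.
have [r0 r1] := andP r01.
have -> : Ex Pr (avg_err k0 n i) - beta * B i 0 =
    n%:R^-1 * \sum_(j < n) (Ex Pr (fun w => err (k0 + j)%N w i 0) - beta * B i 0).
  rewrite Ex_avg_err big_split /= sumr_const card_ord mulrDr; congr (_ + _).
  by rewrite -[X in _ = _ * X]mulr_natl mulKf // gt_eqF.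
rewrite normrM ger0_norm ?invr_ge0 ?ler0n // mulrC ler_pdivrMr //.
apply: le_trans (ler_norm_sum _ _ _) _.
apply: (@le_trans _ _ (\sum_(j < n)
    C * ((2 + msq 0%N) * r ^+ (k0 + j) + beta ^+ 2))).
  by apply: ler_sum => j _; exact: mean_err_bound.
rewrite -mulr_sumr -mulrA ler_wpM2l // big_split /= sumr_const card_ord.
rewrite mulrDl -[X in _ + X <= _]mulr_natr lerD2r -mulr_sumr -mulrA.
rewrite ler_wpM2l ?addr_ge0 ?msq_ge0 //.
under eq_bigr do rewrite exprD.
rewrite -mulr_sumr -mulrA ler_wpM2l ?exprn_ge0 //.
rewrite invfM mulrAC mulVf ?mul1r ?gt_eqF //.
by apply: sum_geom_le.
Qed.

Variables (p C2 : R).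
Hypothesis p01 : 0 <= p < 1.
Hypothesis C20 : 0 <= C2.
Hypothesis msq_bound : forall n, msq n <= C2 * (beta + p ^+ n).

(** The covariances have amplitude of order beta + p^t and sum over the lags to 1 / (1 - r). For r =
    1 - beta / (4 gmax) the factors beta cancel and the order is 1 / n; a merely bounded [msq] would
    leave 1 / (beta n). *)
Lemma var_avg_bound k0 n i : (0 < n)%N ->
  Ex Pr (fun w => (avg_err k0 n i w - Ex Pr (avg_err k0 n i)) ^+ 2) <=
  n%:R ^- 2 * (2 * (C * ((2 * C2 + 1) * beta * n%:R +
    2 * C2 * (p ^+ k0 / (1 - p)))) / (1 - r)).
Proof.
move=> n0; have n0' : 0 < n%:R :> R by rewrite ltr0n.
have [p0 p1] := andP p01; have [r0 r1] := andP r01; have [b0 b1] := andP beta01.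
have B0 := ltW b0.
have -> : (fun w => (avg_err k0 n i w - Ex Pr (avg_err k0 n i)) ^+ 2) =
    (fun w => n%:R ^- 2 * (\sum_(j < n) dev (k0 + j)%N i w) ^+ 2).
  apply/funext => w; rewrite -exprVn -exprMn; congr (_ ^+ 2).
  by rewrite Ex_avg_err /avg_err -mulrBr -sumrB.
have L2S : L2 Pr (fun w => \sum_(j < n) dev (k0 + j)%N i w).
  by apply: L2_sum => j; exact: L2_dev.
rewrite ExZ; last exact: L2S.2.
rewrite ler_wpM2l ?invr_ge0 ?exprn_ge0 ?ler0n //.
have a0 j : 0 <= C * (2 * msq (k0 + j) + beta).
  by rewrite mulr_ge0 // addr_ge0 // mulr_ge0 // msq_ge0.
have hY j m : `|Ex Pr (fun w => dev (k0 + (j + m))%N i w * dev (k0 + j)%N i w)| <=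
    C * (2 * msq (k0 + j) + beta) * r ^+ m.
  by rewrite addnA; exact: cov_bound.
apply: le_trans (second_moment_sum n r01 a0 (fun j => L2_dev (k0 + j) i) hY) _.
rewrite ler_wpM2r ?invr_ge0 ?subr_ge0 ?(ltW r1) // ler_wpM2l // -mulr_sumr ler_wpM2l //.
apply: (@le_trans _ _ (\sum_(j < n)
    ((2 * C2 + 1) * beta + 2 * C2 * p ^+ k0 * p ^+ j))).
  apply: ler_sum => j _; have := msq_bound (k0 + j); rewrite exprD; lra.
rewrite big_split /= sumr_const card_ord -[X in X + _]mulr_natr lerD2l.
rewrite -mulr_sumr -[leLHS]mulrA ler_wpM2l ?mulr_ge0 //.
by rewrite ler_wpM2l ?exprn_ge0 // sum_geom_le.
Qed.

End first_order.

Lemma lsa_avg_err k0 k w i : (k0 < k)%N ->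
  (lsa_avg A b (fun n => x n : Omega -> X) beta u k0 k w - theta_star) i 0 =
  avg_err k0 (k - k0) i w.
Proof.
move=> kk; have n0 : ((k - k0)%:R : R) != 0 by rewrite pnatr_eq0 subn_eq0 -ltnNge.
rewrite /lsa_avg /avg_err mxE [X in X + _]mxE [X in _ + X]mxE.
have -> : theta_star i 0 = (k - k0)%:R^-1 * \sum_(j < k - k0) theta_star i 0.
  by rewrite sumr_const card_ord -[X in _ = _ * X]mulr_natl mulKf.
rewrite -mulrBr; congr (_ * _).
rewrite -{1}[k0]add0n big_addn big_mkord summxE -sumrB.
apply: eq_bigr => j _; rewrite /err addnC.
by rewrite [RHS]mxE [X in _ = _ + X]mxE.
Qed.

End chain_moments.

(** * Bounds uniform in the data stream *)

Lemma expr_le_expR (R : realType) (y : R) (n : nat) : 0 <= y <= 1 ->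
  (1 - y) ^+ n <= expR (- (y * n%:R)).
Proof.
move=> /andP[y0 y1]; rewrite -mulNr expRM_natr lerXn2r ?nnegrE ?expR_ge0 //.
  by rewrite subr_ge0.
exact: expR_ge1Dx.
Qed.

(** Collects what depends on the probability space. Keeping of the initial law only the bound M on
    its second moment lets the same constants serve both initial iterates. *)
Definition data_stream (R : realType) (dX : measure_display)
    (X : measurableType dX) (P : R.-pker X ~> X) (M : R)
    (dO : measure_display) (Omega : measurableType dO)
    (Pr : probability Omega R) (x : nat -> {RV Pr >-> X}) (d : nat)
    (u : Omega -> 'cV[R]_d) : Prop :=
  [/\ markov_chain P x, measurable_mx u,
      cond_independent (x 0%N) (sigma_vec u) (sigma_future x),
      L1 Pr (fun w => l2norm (u w) ^+ 2) &
      Ex Pr (fun w => l2norm (u w) ^+ 2) <= M].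

Section uniform_constants.
Context (R : realType) (dX : measure_display) (X : measurableType dX).
Context (P : R.-pker X ~> X) (mu : probability X R) (d : nat).
Context (A : X -> 'M[R]_d) (b : X -> 'cV[R]_d) (theta_star : 'cV[R]_d).
Context (Gamma : 'M[R]_d) (gmax : R).
Local Notation Abar := (mx_mean mu A).
Hypothesis hstat : stationary P mu.
Hypothesis herg : uniform_ergodicity P mu.
Hypothesis mA : measurable_mx A.
Hypothesis mb : measurable_mx b.
Hypothesis hA : (sup_norm (@opnorm R d d) A <= 1)%E.
Hypothesis hb : (sup_norm (@l2norm R d) b < +oo)%E.
Hypothesis hGsym : Gamma^T = Gamma.
Hypothesis hGpos : posdefmx Gamma.
Hypothesis hGlyap : Abar^T *m Gamma + Gamma *m Abar = - 1%:M.
Hypothesis hgmax : max_eigenvalue Gamma gmax.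
Hypothesis hstar : Abar *m theta_star + mx_mean mu b = 0.

Let hAbar (v : 'cV[R]_d) : l2norm (Abar *m v) <= l2norm v.
Proof. exact: mean_A_contract. Qed.

Let gmax_ge' : 2^-1 <= gmax.
Proof. by have := gmax_ge hGsym hGpos hgmax hGlyap hAbar. Qed.

Lemma msq_small_step M : exists beta0 C : R, [/\ 0 < beta0, 0 <= C &
  forall (dO : measure_display) (Omega : measurableType dO)
    (Pr : probability Omega R) (x : nat -> {RV Pr >-> X})
    (u : Omega -> 'cV[R]_d) (beta : R) (n : nat),
  data_stream P M x u -> 0 < beta <= beta0 ->
  msq A b theta_star x u beta n <= C * (beta + (1 - beta / (2 * gmax)) ^+ n)].
Proof.
have g2 := gmax_ge'; have g0 : 0 < gmax by lra.
have [rho rho01 hgeo] := geometric_ergodicity hstat herg.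
have [G hG] := noise_bounded theta_star hA hb.
have [c c0 hc] := posdef_lower hGsym hGpos.
(* The first summand is the constant of [quad_moment_step] and [lin_moment_step], the second that of
   [lyap_step]. *)
pose K := (5 + 3 * G ^+ 2) + 2 * gmax * (1 + G ^+ 2).
have K1 : 0 < 5 + 3 * G ^+ 2 by have := sqr_ge0 G; lra.
have K2 : 0 <= 2 * gmax * (1 + G ^+ 2).
  by rewrite mulr_ge0 ?addr_ge0 ?sqr_ge0 // mulr_ge0 // ltW.
have K0 : 0 < K by rewrite /K; lra.
have bA := bmeas_A mA hA.
have bg i := bmeas_noise mA mb i hG.
have g_mean i := noise_mean mA mb hA hb hstar i.
have [b2 [C2 [b20 C20 main]]] := second_moment_bound rho01 hgeo bA bg g_mean
  hGsym hGpos hgmax hGlyap hAbar K0 c0.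
pose M0 := 2 * (M + l2norm theta_star ^+ 2).
exists (Num.min 1 b2), (C2 * (1 + `|M0|)); split.
- by rewrite lt_min ltr01.
- by rewrite mulr_ge0 // addr_ge0.
move=> dO Omega Pr x u beta n [hm mu_ hci hL1 hM].
rewrite le_min => /and3P[be0 be1 be2].
have beta01 : 0 < beta <= 1 by rewrite be0.
have vV k : [/\ 0 <= msq A b theta_star x u beta k,
    c * msq A b theta_star x u beta k <= lyap A b theta_star x u beta Gamma k &
    lyap A b theta_star x u beta Gamma k <= gmax * msq A b theta_star x u beta k].
  have i1 := L1_sqr_err mA mb hA hG x mu_ hL1 beta k.
  have i2 := L1_qf mA mb hA hG x mu_ hL1 beta Gamma k.
  split; first exact: msq_ge0.
    by rewrite /msq -ExZ //; apply: le_Ex => //; exact: L1Z.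
  rewrite /msq -ExZ //; apply: le_Ex => //; first exact: L1Z.
  by move=> w; exact: qf_le_gmax.
apply: le_trans (main beta (msq A b theta_star x u beta)
  (lyap A b theta_star x u beta Gamma) (quad_moment A b theta_star x u beta)
  (lin_moment A b theta_star x u beta) _ vV _ _ _ _ _ n) _.
- by rewrite be0.
- by move=> i j f N; exact: (quad_moment0_le mA mb hA hG x mu_ hL1).
- by move=> i f N; exact: (lin_moment0_le mA mb hA hG x mu_ hL1).
- move=> k i j f N; apply: (quad_moment_step mA mb hA hG hm mu_ hci hL1 beta01).
  by rewrite /K lerDl.
- move=> k i f N; apply: (lin_moment_step mA mb hA hG hm mu_ hci hL1 beta01).
  by rewrite /K lerDl.
- move=> k.
  apply: (lyap_step mA mb hA hG x mu_ hL1 beta hGsym hGpos hgmax hGlyap k (ltW g0)).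
  by rewrite /K lerDr ltW.
have p0 : 0 <= 1 - beta / (2 * gmax).
  by rewrite subr_ge0 ler_pdivrMr ?mulr_gt0 //; lra.
rewrite ler_wpM2r ?addr_ge0 ?exprn_ge0 ?(ltW be0) // ler_wpM2l // lerD2l.
apply: le_trans (ler_norm _).
apply: le_trans (msq0_le mA mb hA hG x mu_ hL1 beta) _.
by rewrite /M0 ler_wpM2l // lerD2r.
Qed.

(** Means decay at 1 - beta / (4 gmax) and second moments at 1 - beta / (2 gmax): after k0 steps
    these are at most E and E^2, with E the exponential of the statement. Summing geometric series
    divides them by multiples of beta, which produces [tail] and its square. *)
Lemma small_step_bound M : exists (beta0 D : R) (B : 'cV[R]_d),
  [/\ 0 < beta0, 0 <= D &
  forall (dO : measure_display) (Omega : measurableType dO)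
    (Pr : probability Omega R) (x : nat -> {RV Pr >-> X})
    (u : Omega -> 'cV[R]_d) (beta : R) (k0 n : nat) (i : 'I_d),
  data_stream P M x u -> 0 < beta <= beta0 -> (0 < n)%N ->
  let avg := avg_err A b theta_star x u beta k0 n i in
  let tail := expR (- (beta * k0%:R / (4 * gmax))) / (beta * n%:R) in
  `|Ex Pr avg - beta * B i 0| <= D * (beta ^+ 2 + tail) /\
  Ex Pr (fun w => (avg w - Ex Pr avg) ^+ 2) <= D * (n%:R^-1 + tail ^+ 2)].
Proof.
have g2 := gmax_ge'; have g0 : 0 < gmax by lra.
have gm0 := ltW g0.
have [rho rho01 hgeo] := geometric_ergodicity hstat herg.
have [G hG] := noise_bounded theta_star hA hb.
have bA := bmeas_A mA hA.
have bg i := bmeas_noise mA mb i hG.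
have g_mean i := noise_mean mA mb hA hb hstar i.
have [B [b1 [C1 [b10 C10 first]]]] := first_moment_bound rho01 hgeo bA bg g_mean
  hGsym hGpos hgmax hGlyap hAbar.
have [b2 [C2 [b20 C20 second]]] := msq_small_step M.
pose C3 := C1 * (1 + 4 * gmax * (2 + 2 * C2)).
pose C4 := C1 * (8 * gmax * (2 * C2 + 1) + 32 * gmax ^+ 2 * C2).
have C30 : 0 <= C3.
  by rewrite mulr_ge0 // addr_ge0 // !mulr_ge0 ?addr_ge0 ?mulr_ge0 // ltW.
have C40 : 0 <= C4.
  by rewrite mulr_ge0 // addr_ge0 // !mulr_ge0 ?addr_ge0 ?mulr_ge0 ?exprn_ge0 // ltW.
exists (Num.min 1 (Num.min b1 b2)), (C3 + C4), B; split.
- by rewrite !lt_min ltr01 b10.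
- exact: addr_ge0.
move=> dO Omega Pr x u beta k0 n i hds.
rewrite !le_min => /and4P[be0 be1 beb1 beb2] n0 avg tail.
have [hm mu_ hci hL1 hM] := hds.
have beta01 : 0 < beta <= 1 by rewrite be0.
have n0' : 0 < n%:R :> R by rewrite ltr0n.
have y4 : 0 < beta / (4 * gmax) <= 2^-1.
  by rewrite divr_gt0 ?mulr_gt0 //= ler_pdivrMr ?mulr_gt0 //; lra.
have y2 : 0 < beta / (2 * gmax) <= 1.
  by rewrite divr_gt0 ?mulr_gt0 //= ler_pdivrMr ?mulr_gt0 //; lra.
have r01 : 0 <= 1 - beta / (4 * gmax) < 1 by lra.
have p01 : 0 <= 1 - beta / (2 * gmax) < 1 by lra.
have hfirst (z z' : R) m0 m : 0 <= z' ->
  first_moments P A (noise A b theta_star) beta z z' m0 m -> forall n,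
  l2norm (total_moment m n - (beta * m0 0%N (fun=> 1)) *: B) <=
    C1 * ((z' + beta * z) * (1 - beta / (4 * gmax)) ^+ n +
      beta ^+ 2 * `|m0 0%N (fun=> 1)|).
  by apply: first; rewrite be0.
have hmsq k : msq A b theta_star x u beta k <=
    C2 * (beta + (1 - beta / (2 * gmax)) ^+ k).
  by apply: second => //; rewrite be0.
set E := expR (- (beta * k0%:R / (4 * gmax))) in tail *.
have E0 : 0 <= E := expR_ge0 _.
have rE : (1 - beta / (4 * gmax)) ^+ k0 <= E.
  by rewrite /E mulrAC; apply: expr_le_expR; lra.
have pE : (1 - beta / (2 * gmax)) ^+ k0 <= E ^+ 2.
  have -> : E ^+ 2 = expR (- (beta / (2 * gmax) * k0%:R)).
    by rewrite /E -expRM_natl; congr expR; field; rewrite gt_eqF.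
  by apply: expr_le_expR; lra.
have bn0 : 0 < beta * n%:R by rewrite mulr_gt0.
have t0 : 0 <= tail by rewrite divr_ge0 // ltW.
split.
  apply: le_trans (mean_avg_bound mA mb hA hG hm mu_ hci hL1 beta01 r01 C10 hfirst k0 i n0) _.
  apply: (@le_trans _ _ (C3 * (beta ^+ 2 + tail))); last first.
    by rewrite ler_wpM2r ?addr_ge0 ?sqr_ge0 // lerDl.
  rewrite /C3 -mulrA ler_wpM2l //.
  have q0 : msq A b theta_star x u beta 0 <= 2 * C2.
    by apply: le_trans (hmsq 0%N) _; rewrite expr0 mulrC ler_wpM2r //; lra.
  have rt : (1 - beta / (4 * gmax)) ^+ k0 / (n%:R * (1 - (1 - beta / (4 * gmax)))) <=
      4 * gmax * tail.
    rewrite subKr /tail.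
    have -> : 4 * gmax * (E / (beta * n%:R)) = E / (n%:R * (beta / (4 * gmax))).
      by field; rewrite !gt_eqF.
    by rewrite ler_wpM2r // invr_ge0 mulr_ge0 ?ltW //; case/andP: y4.
  have m0 := msq_ge0 A b theta_star x u beta 0.
  have rt0 : 0 <= 4 * gmax * tail := mulr_ge0 (mulr_ge0 (ler0n R 4) gm0) t0.
  have h1 : (2 + msq A b theta_star x u beta 0) *
     ((1 - beta / (4 * gmax)) ^+ k0 / (n%:R * (1 - (1 - beta / (4 * gmax))))) <=
     (2 + 2 * C2) * (4 * gmax * tail).
    apply: (@le_trans _ _ ((2 + msq A b theta_star x u beta 0) * (4 * gmax * tail))).
      by rewrite ler_wpM2l // addr_ge0.
    by rewrite ler_wpM2r // lerD2l.
  apply: (@le_trans _ _ ((2 + 2 * C2) * (4 * gmax * tail) + beta ^+ 2)).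
    by rewrite lerD2r.
  have -> : (1 + 4 * gmax * (2 + 2 * C2)) * (beta ^+ 2 + tail) =
    ((2 + 2 * C2) * (4 * gmax * tail) + beta ^+ 2) +
    (tail + 4 * gmax * (2 + 2 * C2) * beta ^+ 2) by ring.
  have c2 : 0 <= 2 + 2 * C2 := addr_ge0 (ler0n R 2) (mulr_ge0 (ler0n R 2) C20).
  rewrite lerDl; apply: addr_ge0 => //; apply: mulr_ge0 (sqr_ge0 beta).
  exact: mulr_ge0 (mulr_ge0 (ler0n R 4) gm0) c2.
apply: le_trans (var_avg_bound mA mb hA hG hm mu_ hci hL1 beta01 r01 C10 hfirst
  p01 C20 hmsq k0 i n0) _.
apply: (@le_trans _ _ (C4 * (n%:R^-1 + tail ^+ 2))); last first.
  by rewrite ler_wpM2r ?addr_ge0 ?sqr_ge0 ?invr_ge0 ?(ltW n0') // lerDr.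
apply: (@le_trans _ _ (C1 * (8 * gmax * (2 * C2 + 1) * n%:R^-1 +
    32 * gmax ^+ 2 * C2 * tail ^+ 2))).
  have -> : 8 * gmax * (2 * C2 + 1) * n%:R^-1 + 32 * gmax ^+ 2 * C2 * tail ^+ 2 =
    n%:R ^- 2 * (2 * ((2 * C2 + 1) * beta * n%:R + 2 * C2 * (E ^+ 2 / (beta / (2 * gmax))))
      / (beta / (4 * gmax))).
    by rewrite /tail; field; rewrite !gt_eqF.
  rewrite !subKr.
  rewrite [leRHS]mulrCA ler_wpM2l ?invr_ge0 ?exprn_ge0 ?ler0n //.
  rewrite [leRHS]mulrA ler_wpM2r ?invr_ge0 //; first by case/andP: y4 => /ltW.
  rewrite [leRHS]mulrCA ler_wpM2l // ler_wpM2l // lerD2l ler_wpM2l ?mulr_ge0 //.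
  by rewrite ler_wpM2r // invr_ge0; case/andP: y2 => /ltW.
rewrite /C4 -[leRHS]mulrA ler_wpM2l //.
have i0 : 0 <= n%:R^-1 :> R by rewrite invr_ge0 ltW.
have a0 : 0 <= 8 * gmax * (2 * C2 + 1).
  by apply: mulr_ge0 (mulr_ge0 (ler0n R 8) gm0) _; lra.
have c0 : 0 <= 32 * gmax ^+ 2 * C2 := mulr_ge0 (mulr_ge0 (ler0n R 32) (sqr_ge0 gmax)) C20.
move: (8 * gmax * _) (32 * gmax ^+ 2 * _) a0 c0 => a c a0 c0.
have := mulr_ge0 a0 (sqr_ge0 tail); have := mulr_ge0 c0 i0; lra.
Qed.

(** * Mixing times *)

Lemma kernel_iter_mean_bound : exists2 rho : R, 0 < rho < 1 &
  forall f M k y, bmeas f M ->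
  `|\int[kernel_iter P k y]_z f z - Ex mu f| <= 4 * M * rho ^+ k.
Proof.
have [rho rho01 hgeo] := geometric_ergodicity hstat herg.
exists rho => // f M k y bf; rewrite (kernel_iter_op _ _ _ bf).
have [_ /(_ y)] := hgeo k _ _ (bmeas_center mu bf) (Ex_center mu bf).
have -> : (fun x => f x - Ex mu f) = (fun x => f x + - Ex mu f * (fun=> 1) x).
  by apply/funext => z; rewrite mulr1.
rewrite (iter_opD P k (- Ex mu f) bf (@bmeas_cst _ _ X 1)) iter_op_cst mulr1.
by move=> /le_trans; apply; rewrite mulrA -natrM.
Qed.

(** N stands for [opnorm] on A and for the Euclidean norm on b; both lie between the largest entry
    and the sum of the entries. The entries are bounded by the supremum s itself, so that s is a
    factor of both sides and may be 0. *)
Lemma eventually_mixed (m n : nat) (N : 'M[R]_(m, n) -> R) (F : X -> 'M[R]_(m, n))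
    (eps : R) :
  (forall M, N M <= entry_sum M) -> (forall (M : 'M[R]_(m, n)) i j, `|M i j| <= N M) ->
  (forall M, 0 <= N M) -> measurable_mx F -> (sup_norm N F < +oo)%E -> 0 < eps ->
  exists t, forall y k, (t <= k)%N ->
  ((N (mx_mean (kernel_iter P k y) F - mx_mean mu F))%:E <= eps%:E * sup_norm N F)%E.
Proof.
move=> hN1 hN2 N0 mF fin eps0.
have hs y : ((N (F y))%:E <= sup_norm N F)%E by apply: ereal_sup_ubound; exists y.
have fs : sup_norm N F \is a fin_num.
  by rewrite ge0_fin_numE //; apply: le_trans (hs point); rewrite lee_fin.
move: (sup_norm N F) fs hs {fin} => s /fineK <- hs; move: (fine s) hs => {}s hs.
have s0 : 0 <= s by apply: le_trans (N0 (F point)) _; rewrite -lee_fin.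
have bF i j : bmeas (fun y => F y i j) s.
  by split=> [|y]; [exact: mF|apply: le_trans (hN2 _ _ _) _; rewrite -lee_fin].
have [rho /andP[r0 r1] hrho] := kernel_iter_mean_bound.
pose c : R := (m * n)%:R * 4 + 1.
have c0 : 0 < c by rewrite ltr_wpDl // mulr_ge0.
have : (fun k => rho ^+ k) @ \oo --> (0 : R) by apply: cvg_expr; rewrite ger0_norm // ltW.
move=> /cvgrPdist_le /(_ (eps / c) (divr_gt0 eps0 c0)) [t _ ht].
exists t => y k tk; rewrite -EFinM lee_fin.
have rk : c * rho ^+ k <= eps.
  have := ht k tk; rewrite /= sub0r normrN ger0_norm ?exprn_ge0 ?(ltW r0) //.
  by rewrite ler_pdivlMr // mulrC.
apply: le_trans (hN1 _) _.
apply: (@le_trans _ _ (\sum_(i < m) \sum_(j < n) (4 * s * rho ^+ k))).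
  by apply: ler_sum => i _; apply: ler_sum => j _; rewrite !mxE; exact: hrho.
rewrite !sumr_const !card_ord -mulrnA mulnC -[leLHS]mulr_natl.
have : s * (c * rho ^+ k) <= s * eps by rewrite ler_wpM2l.
have := mulr_ge0 s0 (exprn_ge0 k (ltW r0)).
by rewrite /c; move: (m * n)%:R (rho ^+ k) => a p; lra.
Qed.

Lemma l2norm_le_entry_sum (v : 'cV[R]_d) : l2norm v <= entry_sum v.
Proof.
apply: le_trans (l2norm_le_sum v) _; apply: ler_sum => i _.
by rewrite big_ord1.
Qed.

(** Rules out the default value of [xget]: beyond the larger of the two times for A and b all is
    mixed, and among such times there is a least one. *)
Lemma mixing_timeP eps : 0 < eps ->
  is_mixing_time P mu A b eps (mixing_time P mu A b eps).
Proof.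
move=> eps0; apply: xgetPex.
have [|t1 h1] := eventually_mixed (@opnorm_le_entry_sum R d d)
  (@ler_abs_opnorm R d d) (@opnorm_ge0 R d d) mA _ eps0.
  exact: le_lt_trans hA (ltry 1).
have [|t2 h2] := eventually_mixed l2norm_le_entry_sum _ (@l2norm_ge0 R d) mb hb eps0.
  by move=> M i j; rewrite (ord1 j); exact: ler_abs_l2norm.
have hex : exists t, (1 <= t)%N && `[< mixed_from P mu A b eps t >].
  exists (maxn 1 (maxn t1 t2)); rewrite leq_maxl; apply/asboolP => y k.
  by rewrite !geq_max => /and3P[_ k1 k2]; split; [exact: h1|exact: h2].
exists (ex_minn hex); case: ex_minnP => t /andP[t0 /asboolP ht] tmin; split=> //.
by move=> s s0 hs; apply: tmin; rewrite s0; apply/asboolP.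
Qed.

Lemma mixing_time_ge1 eps : (1 <= mixing_time P mu A b eps)%N.
Proof. by rewrite /mixing_time; case: xgetP => // t _ []. Qed.

Lemma mixing_time_opnorm eps y k : 0 < eps -> (mixing_time P mu A b eps <= k)%N ->
  opnorm (mx_mean (kernel_iter P k y) A - Abar) <= eps.
Proof.
move=> eps0 hk; have [_ /(_ y k hk) [h _] _] := mixing_timeP eps0.
rewrite -lee_fin; apply: le_trans h _; rewrite -[leRHS]mule1.
by apply: lee_wpmul2l => //; rewrite lee_fin ltW.
Qed.

Let gmax0 : 0 < gmax.
Proof. by apply: lt_le_trans gmax_ge'; rewrite invr_gt0. Qed.

Lemma qf_abs_le (v w : 'cV[R]_d) : `|qf Gamma v w| <= gmax * l2norm v * l2norm w.
Proof.
apply: le_trans (qf_le_qnorm v w (psd_posdef hGsym hGpos)) _.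
have hq (z : 'cV[R]_d) := qnorm_le_l2norm hGsym hGpos hgmax z.
apply: le_trans (ler_pM (qnorm_ge0 _ _) (qnorm_ge0 _ _) (hq v) (hq w)) _.
by rewrite mulrACA -expr2 (sqr_sqrtr (ltW gmax0)) mulrA.
Qed.

Lemma lyapunov_drift (M : 'M[R]_d) (e : 'cV[R]_d) (eps : R) :
  opnorm (M - Abar) <= eps ->
  2 * qf Gamma e (M *m e) <= (2 * gmax * eps - 1) * l2norm e ^+ 2.
Proof.
move=> hM; have lyap0 := lyapunov_cross hGsym hGlyap e.
have -> : M *m e = Abar *m e + (M - Abar) *m e.
  by rewrite mulmxBl addrCA subrr addr0.
rewrite qfDr mulrDr lyap0 mulrBl mul1r addrC lerD2r.
rewrite -!mulrA ler_wpM2l //; apply: le_trans (ler_norm _) _.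
apply: le_trans (qf_abs_le _ _) _; rewrite -!mulrA ler_wpM2l ?(ltW gmax0) //.
rewrite [leRHS]mulrC expr2 -mulrA ler_wpM2l ?l2norm_ge0 //.
apply: le_trans (l2norm_opnorm _ _) _; rewrite mulrC.
by rewrite ler_wpM2r ?l2norm_ge0.
Qed.

(* One step from f, when f is close to e and the noise is bounded: the drift is
   that of the frozen point e, up to a small fraction of |e|^2. *)
Lemma lagged_drift (B : 'M[R]_d) (e f g : 'cV[R]_d) (G beta t : R) :
  0 < beta <= t -> gmax * t <= 1 / 1900 -> l2norm g <= G ->
  (forall v : 'cV[R]_d, l2norm (B *m v) <= l2norm v) ->
  l2norm (f - e) <= 2 * t * (l2norm e + G) ->
  qf Gamma (f + beta *: (B *m f + g)) (f + beta *: (B *m f + g)) <=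
  qf Gamma f f + beta * (2 * qf Gamma e (B *m e)) +
  beta * (l2norm e ^+ 2 / 10 + (12 * gmax ^+ 2 + 1) * G ^+ 2).
Proof.
move=> /andP[b0 bt] gt hg hB hD.
have eD : B *m f + g = B *m e + (B *m (f - e) + g).
  by rewrite mulmxBr addrA addrCA subrr addr0.
have G0 : 0 <= G := le_trans (l2norm_ge0 _) hg.
have n0 := l2norm_ge0 e.
have t0 : 0 < t := lt_le_trans b0 bt.
have t1 : t <= 1 / 950.
  have := ler_wpM2r (ltW t0) gmax_ge'; move: gt; lra.
set h := l2norm e + G in hD *.
have h0 : 0 <= h by rewrite addr_ge0.
have hf : l2norm f + G <= (1 + 2 * t) * h.
  have := l2normD (f - e) e; rewrite subrK => hfe.
  by move: hD hfe; rewrite /h; lra.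
have hDelta : l2norm (B *m f + g) <= (1 + 2 * t) * h.
  by apply: le_trans (l2normD _ _) _; apply: le_trans hf; apply: lerD.
have b1 : `|qf Gamma (f - e) (B *m f + g)| <= gmax * (2 * t * h) * ((1 + 2 * t) * h).
  apply: le_trans (qf_abs_le _ _) _; apply: ler_pM => //; rewrite ?l2norm_ge0 //.
    by rewrite mulr_ge0 ?l2norm_ge0 // ltW.
  by rewrite ler_wpM2l // ltW.
have b2 : `|qf Gamma e (B *m (f - e))| <= gmax * h * (2 * t * h).
  apply: le_trans (qf_abs_le _ _) _; apply: ler_pM => //; rewrite ?l2norm_ge0 //.
  - by rewrite mulr_ge0 ?l2norm_ge0 // ltW.
  - by rewrite ler_wpM2l ?(ltW gmax0) // lerDl.
  - exact: le_trans (hB _) hD.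
have b3 : `|qf Gamma e g| <= gmax * l2norm e * G.
  apply: le_trans (qf_abs_le _ _) _; rewrite ler_wpM2l // mulr_ge0 //.
  exact: ltW.
have b4 : qf Gamma (B *m f + g) (B *m f + g) <= gmax * ((1 + 2 * t) * h) ^+ 2.
  apply: le_trans (qf_le_gmax hGsym hGpos hgmax _) _.
  rewrite ler_wpM2l ?(ltW gmax0) // ler_sqr ?nnegrE ?l2norm_ge0 //.
  by rewrite mulr_ge0 // addr_ge0 // mulr_ge0 // ltW.
have exp : qf Gamma (f + beta *: (B *m f + g)) (f + beta *: (B *m f + g)) =
    qf Gamma f f + beta * (2 * qf Gamma e (B *m e)) +
    beta * (2 * (qf Gamma e (B *m (f - e)) + qf Gamma e g +
      qf Gamma (f - e) (B *m f + g)) +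
      beta * qf Gamma (B *m f + g) (B *m f + g)).
  have h1 : qf Gamma f (B *m f + g) = qf Gamma e (B *m e) +
      (qf Gamma e (B *m (f - e)) + qf Gamma e g) + qf Gamma (f - e) (B *m f + g).
    by rewrite -2!qfDr -eD -qfDl [e + _]addrC subrK.
  move: h1; move: (B *m f + g) => De h1.
  rewrite qfDl [qf _ f (f + _)]qfDr [qf _ (_ *: _) (f + _)]qfDr !qfZl !qfZr.
  by rewrite (qfC De f hGsym) h1; ring.
rewrite exp lerD2l ler_wpM2l ?(ltW b0) //.
have b5 : beta * qf Gamma (B *m f + g) (B *m f + g) <=
    t * (gmax * ((1 + 2 * t) * h) ^+ 2).
  apply: le_trans (ler_wpM2l (ltW b0) b4) _; rewrite ler_wpM2r //.
  by rewrite mulr_ge0 ?(ltW gmax0) // exprn_ge0 // mulr_ge0 // addr_ge0 // mulr_ge0 // ltW.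
move: b1 b2 b3; rewrite !ler_norml => /andP[_ b1] /andP[_ b2] /andP[_ b3].
have t2 : 1 + 2 * t <= 1 + 1 / 400 by lra.
move: b5 b1 b2 b3; move: (qf _ _ _) (qf _ _ _) (qf _ _ _) (beta * _) => q1 q2 q3 q4.
move=> b5 b1 b2 b3.
pose w : R := 1 + 1 / 400.
have th0 : 0 <= 1 + 2 * t by lra.
have hh : 0 <= h * h by rewrite mulr_ge0.
have c1 : gmax * (2 * t * h) * ((1 + 2 * t) * h) <= 1 / 1900 * (2 * w * (h * h)).
  have -> : gmax * (2 * t * h) * ((1 + 2 * t) * h) =
    gmax * t * (2 * (1 + 2 * t) * (h * h)) by ring.
  apply: ler_pM => //; first by rewrite mulr_ge0 // ltW.
    by rewrite mulr_ge0 // mulr_ge0.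
  by rewrite ler_wpM2r // ler_wpM2l.
have c2 : gmax * h * (2 * t * h) <= 1 / 1900 * (2 * (h * h)).
  have -> : gmax * h * (2 * t * h) = gmax * t * (2 * (h * h)) by ring.
  by rewrite ler_wpM2r // mulr_ge0.
have c3 : t * (gmax * ((1 + 2 * t) * h) ^+ 2) <= 1 / 1900 * (w * w * (h * h)).
  have -> : t * (gmax * ((1 + 2 * t) * h) ^+ 2) =
    gmax * t * ((1 + 2 * t) * (1 + 2 * t) * (h * h)) by ring.
  apply: ler_pM => //; first by rewrite mulr_ge0 // ltW.
    by rewrite mulr_ge0 // mulr_ge0.
  by rewrite ler_wpM2r //; apply: ler_pM.
have hhe : h * h <= 2 * l2norm e ^+ 2 + 2 * G ^+ 2.
  by rewrite /h; have := sqr_ge0 (l2norm e - G); rewrite !expr2; lra.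
(* The weight 1/12 leaves room, below the 1/10 of the statement, for the terms of order 1/1900. *)
have young : 2 * (gmax * l2norm e * G) <= l2norm e ^+ 2 / 12 + 12 * gmax ^+ 2 * G ^+ 2.
  have := sqr_ge0 (l2norm e - 12 * gmax * G).
  have -> : (l2norm e - 12 * gmax * G) ^+ 2 =
    l2norm e ^+ 2 - 12 * (2 * (gmax * l2norm e * G)) + 144 * gmax ^+ 2 * G ^+ 2 by ring.
  lra.
have s0 := sqr_ge0 G; have s1 := sqr_ge0 (l2norm e).
move: (gmax * (2 * t * h) * _) (gmax * h * _) (t * _) (h * h) (gmax * l2norm e * G)
  c1 c2 c3 hhe young b1 b2 b3 b5 hh => a1 a2 a3 a4 a5 c1 c2 c3 hhe young b1 b2 b3 b5 hh.
have -> : (12 * gmax ^+ 2 + 1) * G ^+ 2 = 12 * gmax ^+ 2 * G ^+ 2 + G ^+ 2 by ring.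
move: (12 * gmax ^+ 2 * G ^+ 2) (l2norm e ^+ 2) (G ^+ 2) young hhe s0 s1 => k1 k2 k3 young hhe s0 s1.
rewrite /w in c1 c3; clear -c1 c2 c3 hhe young b1 b2 b3 b5 hh s0 s1; lra.
Qed.

(** * Conditioning several steps back *)

Section lagged_chain.
Context (dO : measure_display) (Omega : measurableType dO).
Context (Pr : probability Omega R) (x : nat -> {RV Pr >-> X}).
Context (u : Omega -> 'cV[R]_d) (M G beta : R).
Hypothesis hds : data_stream P M x u.
Hypothesis hG : forall y, l2norm (noise A b theta_star y) <= G.
Hypothesis beta0 : 0 < beta.
Local Notation e := (err A b theta_star x u beta).

Let hm : markov_chain P x. Proof. by case: hds. Qed.
Let mu_ : measurable_mx u. Proof. by case: hds. Qed.
Let hci : cond_independent (x 0%N) (sigma_vec u) (sigma_future x).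
Proof. by case: hds. Qed.
Let hL1 : L1 Pr (fun w => l2norm (u w) ^+ 2). Proof. by case: hds. Qed.
Let G0 : 0 <= G. Proof. exact: le_trans (l2norm_ge0 _) (hG point). Qed.

(** Each increment has norm at most |e_(s+n) - e_s| + |e_s| + G. As long as 2 beta n <= 1 the
    induction hypothesis bounds this by 2 (|e_s| + G), so the lag grows linearly and Gronwall's
    exponential is avoided. *)
Lemma err_lag s n w : 2 * (beta * n%:R) <= 1 ->
  l2norm (e (s + n)%N w - e s w) <= 2 * (beta * n%:R) * (l2norm (e s w) + G).
Proof.
have h0 : 0 <= l2norm (e s w) + G by rewrite addr_ge0 // l2norm_ge0.
elim: n => [|n ih] hn.
  by rewrite addn0 subrr l2norm0 mulr0 mulr0 mul0r.
have eS : beta * n.+1%:R = beta * n%:R + beta by rewrite -natr1 mulrDr mulr1.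
rewrite eS in hn *.
have bn : 2 * (beta * n%:R) <= 1 by have := beta0; move: hn; lra.
have {}ih := ih bn.
rewrite addnS errS addrAC; apply: le_trans (l2normD _ _) _.
rewrite l2normZ gtr0_norm //.
have hd : l2norm (A (x (s + n)%N w) *m e (s + n)%N w +
    noise A b theta_star (x (s + n)%N w)) <=
    l2norm (e (s + n)%N w - e s w) + (l2norm (e s w) + G).
  apply: le_trans (l2normD _ _) _; rewrite addrA; apply: lerD => //.
  apply: le_trans (A_contract hA _ _) _.
  by have := l2normD (e (s + n)%N w - e s w) (e s w); rewrite subrK.
have hd2 : l2norm (A (x (s + n)%N w) *m e (s + n)%N w +
    noise A b theta_star (x (s + n)%N w)) <= 2 * (l2norm (e s w) + G).
  apply: le_trans hd _; have := ler_wpM2r h0 bn; move: ih; lra.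
have := ler_wpM2l (ltW beta0) hd2; move: ih.
move: (l2norm _) (l2norm _) (l2norm (e s w) + G) (beta * n%:R) => p q r y; lra.
Qed.

Lemma msq_lag s n : 2 * (beta * n%:R) <= 1 / 100 ->
  msq A b theta_star x u beta (s + n)%N <=
  2 * msq A b theta_star x u beta s + 2 * G ^+ 2.
Proof.
move=> hn; have i1 := L1_sqr_err mA mb hA hG x mu_ hL1 beta.
have i2 : L1 Pr (fun w => 2 * l2norm (e s w) ^+ 2 + 2 * G ^+ 2).
  by apply: L1D; [exact: L1Z|exact: L1_bmeas (@bmeas_cst _ _ _ _)].
apply: (@le_trans _ _ (Ex Pr (fun w => 2 * l2norm (e s w) ^+ 2 + 2 * G ^+ 2))).
  apply: le_Ex => // w.
  have h := @err_lag s n w (le_trans hn _).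
  have {h} h := h ltac:(lra).
  have h2 := l2normD (e (s + n)%N w - e s w) (e s w); rewrite subrK in h2.
  have n1 := l2norm_ge0 (e s w); have n2 := l2norm_ge0 (e (s + n)%N w).
  have G0' := G0.
  move: (l2norm (_ - _)) (l2norm (e s w)) (l2norm (e (s + n)%N w)) (beta * n%:R)
    hn h h2 n1 n2 => p q r y hn h h2 n1 n2.
  have h3 := ler_wpM2r (addr_ge0 n1 G0') hn.
  have h4 : r <= 101 / 100 * q + G / 100 by move: h h2 h3; lra.
  apply: (@le_trans _ _ ((101 / 100 * q + G / 100) ^+ 2)).
    by rewrite ler_sqr ?nnegrE //; lra.
  have := sqr_ge0 (q - G); have := sqr_ge0 q; have := sqr_ge0 G; rewrite !expr2; lra.
rewrite ExD ?Ex_cst ?ExZ //; [exact: L1Z|exact: L1_bmeas (@bmeas_cst _ _ _ _)].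
Qed.

Lemma markov_hist_iter s n f N Z : bmeas f N -> gmeas (hist x u s) Z -> L1 Pr Z ->
  Ex Pr (fun w => f (x (s + n)%N w) * Z w) =
  Ex Pr (fun w => iter n (op P) f (x s w) * Z w).
Proof.
move=> bf gZ iZ; elim: n f bf => [|n ih] f bf; first by rewrite addn0.
rewrite addnS (markov_hist hm mu_ hci bf _ iZ); last first.
  exact: (gmeas_mono (leq_addr n s) gZ).
by rewrite (ih _ (bmeas_op P bf)) -iterSr.
Qed.

(** With e_s frozen, A(x_(s+n)) can be averaged over n steps of the chain from x_s. This is where
    the mixing time enters: for n = tau the averaged matrix is close to Abar uniformly in x_s. *)
Lemma Ex_lagged_qf s n :
  Ex Pr (fun w => qf Gamma (e s w) (A (x (s + n)%N w) *m e s w)) =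
  Ex Pr (fun w => qf Gamma (e s w)
    (mx_mean (kernel_iter P n (x s w)) A *m e s w)) /\
  L1 Pr (fun w => qf Gamma (e s w) (A (x (s + n)%N w) *m e s w)) /\
  L1 Pr (fun w => qf Gamma (e s w)
    (mx_mean (kernel_iter P n (x s w)) A *m e s w)).
Proof.
pose Z i k w := e s w i 0 * e s w k 0.
have gZ i k : gmeas (hist x u s) (Z i k).
  by apply: measurable_funM; exact: (gmeas_err_le mA mb hG beta _ (leq_pred s)).
have iZ i k : L1 Pr (Z i k) by apply: L2M; exact: L2_err.
have expand (B : Omega -> 'M[R]_d) :
    (fun w => qf Gamma (e s w) (B w *m e s w)) =
    (fun w => \sum_i \sum_j Gamma i j * (\sum_k B w j k * Z i k w)).
  apply/funext => w; rewrite qfE; apply: eq_bigr => i _; apply: eq_bigr => j _.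
  congr (_ * _); rewrite [X in _ * X]mxE mulr_sumr; apply: eq_bigr => k _.
  by rewrite /Z; ring.
have bA := bmeas_A mA hA.
have i1 j k i : L1 Pr (fun w => A (x (s + n)%N w) j k * Z i k w).
  exact: L1_bM (bmeas_RV _ (bA j k)) (iZ i k).
have eM j k w : mx_mean (kernel_iter P n (x s w)) A j k =
    iter n (op P) (fun y => A y j k) (x s w).
  by rewrite mxE (kernel_iter_op _ _ _ (bA j k)).
have i2 j k i : L1 Pr (fun w => mx_mean (kernel_iter P n (x s w)) A j k * Z i k w).
  rewrite (funext (fun w => congr1 (fun r => r * Z i k w) (eM j k w))).
  exact: L1_bM (bmeas_RV _ (bmeas_iter_op P n (bA j k))) (iZ i k).
have iS (B : Omega -> 'M[R]_d) : (forall j k i, L1 Pr (fun w => B w j k * Z i k w)) ->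
    L1 Pr (fun w => \sum_i \sum_j Gamma i j * (\sum_k B w j k * Z i k w)) /\
    Ex Pr (fun w => \sum_i \sum_j Gamma i j * (\sum_k B w j k * Z i k w)) =
    \sum_i \sum_j Gamma i j * (\sum_k Ex Pr (fun w => B w j k * Z i k w)).
  move=> iB.
  have j1 i j : L1 Pr (fun w => \sum_k B w j k * Z i k w) by exact: L1_sum.
  have j2 i j : L1 Pr (fun w => Gamma i j * (\sum_k B w j k * Z i k w)) by exact: L1Z.
  have j3 i : L1 Pr (fun w => \sum_j Gamma i j * (\sum_k B w j k * Z i k w)) by exact: L1_sum.
  split; first exact: L1_sum.
  rewrite Ex_sum //; apply: eq_bigr => i _; rewrite Ex_sum //.
  by apply: eq_bigr => j _; rewrite ExZ // Ex_sum.
have [k1 e1] := iS _ i1; have [k2 e2] := iS _ i2.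
rewrite !expand; split=> //; rewrite e1 e2.
apply: eq_bigr => i _; apply: eq_bigr => j _; congr (_ * _).
apply: eq_bigr => k _; rewrite (funext (fun w => congr1 (fun r => r * Z i k w) (eM j k w))).
exact: (markov_hist_iter _ (bA j k)).
Qed.

End lagged_chain.

(** The drift of V at time s + tau is governed by [msq] at time s. Bounding V (s + tau) by gmax (2
    msq s + 2 G^2) through [msq_lag] turns this lagged drift into a contraction of V; times up to
    tau are reached from time 0 by the same lemma. *)
Lemma apriori_bound M : exists C : R, forall (dO : measure_display)
    (Omega : measurableType dO) (Pr : probability Omega R)
    (x : nat -> {RV Pr >-> X}) (u : Omega -> 'cV[R]_d) (beta : R) (n : nat),
  data_stream P M x u -> 0 < beta ->
  beta * (mixing_time P mu A b beta)%:R < (5 / 100) / (95 * gmax) ->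
  msq A b theta_star x u beta n <= C.
Proof.
have gm0 := ltW gmax0; have g2 := gmax_ge'.
have [G hG] := noise_bounded theta_star hA hb.
have [c c0 hc] := posdef_lower hGsym hGpos.
pose K := (12 * gmax ^+ 2 + 1) * G ^+ 2.
have K0 : 0 <= K.
  apply: mulr_ge0 (sqr_ge0 _); apply: addr_ge0 => //.
  exact: mulr_ge0 (sqr_ge0 _).
pose Ms := 2 * `|2 * (M + l2norm theta_star ^+ 2)| + 2 * G ^+ 2.
have Ms0 : 0 <= Ms by apply: addr_ge0; apply: mulr_ge0 => //; exact: sqr_ge0.
pose W := gmax * Ms + (K + G ^+ 2) * (gmax * (5 / 2)).
have gMs : 0 <= gmax * Ms := mulr_ge0 gm0 Ms0.
have W0' : 0 <= (K + G ^+ 2) * (gmax * (5 / 2)).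
  by apply: mulr_ge0; [exact: addr_ge0 K0 (sqr_ge0 G)|apply: mulr_ge0 => //; lra].
exists (Ms + W / c) => dO Omega Pr x u beta n hds be0.
set tau := mixing_time P mu A b beta => hbt.
have tau1 : (1 <= tau)%N := mixing_time_ge1 beta.
have [hm mu_ hci hL1 hM] := hds.
set t := beta * tau%:R in hbt.
(* 0.05 / 95 = 1 / 1900. *)
have gt : gmax * t <= 1 / 1900.
  move: hbt; rewrite ltr_pdivlMr ?mulr_gt0 // => hbt.
  by move: hbt; rewrite mulrCA; move: (gmax * t) (t * gmax) (mulrC gmax t) => p q <-; lra.
have bt : beta <= t by rewrite /t ler_peMr ?(ltW be0) // ler1n.
have t0 : 0 < t := lt_le_trans be0 bt.
have t1 : t <= 1 / 950 by have := ler_wpM2r (ltW t0) g2; move: gt; lra.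
have i1 := L1_sqr_err mA mb hA hG x mu_ hL1 beta.
have i2 := L1_qf mA mb hA hG x mu_ hL1 beta Gamma.
pose m := msq A b theta_star x u beta; pose V := lyap A b theta_star x u beta Gamma.
have m_ge0 k : 0 <= m k := msq_ge0 A b theta_star x u beta k.
have m00 : m 0%N <= `|2 * (M + l2norm theta_star ^+ 2)|.
  apply: le_trans (ler_norm _).
  apply: le_trans (msq0_le mA mb hA hG x mu_ hL1 beta) _.
  by rewrite ler_wpM2l // lerD2r.
have cV k : c * m k <= V k.
  by rewrite /m /msq -ExZ //; apply: le_Ex => //; exact: L1Z.
have Vg k : V k <= gmax * m k.
  rewrite /m /msq -ExZ //; apply: le_Ex => //; first exact: L1Z.
  by move=> w; exact: qf_le_gmax.
have small k : (k <= tau)%N -> m k <= Ms.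
  move=> kt; have := msq_lag hds hG be0 0 (n := k).
  rewrite add0n => h; apply: le_trans (h _) _; last first.
    by rewrite /Ms lerD2r ler_wpM2l.
  have : beta * k%:R <= t by rewrite /t ler_wpM2l ?(ltW be0) // ler_nat.
  by move: t1; lra.
have step s : V (s + tau).+1 <= V (s + tau)%N - 8 / 10 * (beta * m s) + beta * K.
  have [E1 [j1 j2]] := Ex_lagged_qf beta hds hG s tau.
  have j3 : L1 Pr (fun w => 2 * qf Gamma (err A b theta_star x u beta s w)
      (A (x (s + tau)%N w) *m err A b theta_star x u beta s w)) by exact: L1Z.
  have j4 : L1 Pr (fun w => l2norm (err A b theta_star x u beta s w) ^+ 2 / 10 + K).
    apply: L1D; last exact: L1_bmeas (@bmeas_cst _ _ _ _).
    by under eq_fun do rewrite mulrC; exact: L1Z.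
  have hstep : V (s + tau).+1 <= Ex Pr (fun w =>
      (qf Gamma (err A b theta_star x u beta (s + tau)%N w)
          (err A b theta_star x u beta (s + tau)%N w) +
       beta * (2 * qf Gamma (err A b theta_star x u beta s w)
         (A (x (s + tau)%N w) *m err A b theta_star x u beta s w))) +
       beta * (l2norm (err A b theta_star x u beta s w) ^+ 2 / 10 + K)).
    apply: le_Ex => //.
      by apply: L1D; [apply: L1D => //; exact: L1Z|exact: L1Z].
    move=> w; rewrite errS; apply: (lagged_drift (t := t)) => //.
    - by rewrite be0.
    - exact: A_contract.
    - by apply: (err_lag x u hG be0); move: t1; rewrite -/t; lra.
  have drift : Ex Pr (fun w => 2 * qf Gamma (err A b theta_star x u beta s w)
      (A (x (s + tau)%N w) *m err A b theta_star x u beta s w)) <= - (9 / 10) * m s.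
    rewrite ExZ // E1 -ExZ // /m /msq -ExZ //.
    apply: le_Ex; [exact: L1Z|exact: L1Z|].
    move=> w; apply: le_trans (lyapunov_drift (eps := beta) _ _) _.
      exact: mixing_time_opnorm.
    apply: ler_wpM2r; first exact: sqr_ge0.
    have : gmax * beta <= gmax * t by rewrite ler_wpM2l.
    by move: gt; rewrite -mulrA; lra.
  apply: le_trans hstep _.
  rewrite ExD; [|by apply: L1D => //; exact: L1Z|exact: L1Z].
  rewrite ExD //; last exact: L1Z.
  rewrite (ExZ _ j3) (ExZ _ j4) ExD; first last.
  - exact: L1_bmeas (@bmeas_cst _ _ _ _).
  - by under eq_fun do rewrite mulrC; exact: L1Z.
  have E10 : Ex Pr (fun w => l2norm (err A b theta_star x u beta s w) ^+ 2 / 10) =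
      m s / 10.
    by rewrite /m /msq mulrC -ExZ //; congr Ex; apply/funext => w; rewrite mulrC.
  rewrite Ex_cst E10.
  rewrite -addrA -[leRHS]addrA lerD2l.
  have := ler_wpM2l (ltW be0) drift; move: (Ex Pr _) (m s) => z p.
  by lra.
have large j : V (j + tau)%N <= W.
  elim: j => [|s ih].
    rewrite add0n; apply: le_trans (Vg tau) _; apply: (@le_trans _ _ (gmax * Ms)).
      by rewrite ler_wpM2l // small.
    by rewrite /W lerDl.
  rewrite addSn; apply: le_trans (step s) _.
  have lag : V (s + tau)%N <= gmax * (2 * m s + 2 * G ^+ 2).
    apply: le_trans (Vg _) _; rewrite ler_wpM2l //; apply: (msq_lag hds hG be0).
    by move: t1; rewrite -/t; lra.
  (* With this y, the product y V (s + tau) is at most (8 / 10) beta m s plus a multiple of beta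
     G^2: the drift of [step] is used up exactly, and W is large enough to be preserved. *)
  pose y := beta * (2 / 5) / gmax.
  have yg : y * gmax = beta * (2 / 5) by rewrite /y mulfVK // gt_eqF.
  have y0 : 0 <= y.
    by apply: divr_ge0 => //; apply: mulr_ge0; [exact: ltW|lra].
  have y1 : y <= 1.
    rewrite /y ler_pdivrMr //; move: bt t1 g2; lra.
  have h1 : y * V (s + tau)%N <= beta * (2 / 5) * (2 * m s + 2 * G ^+ 2).
    by rewrite -yg -[leRHS]mulrA ler_wpM2l.
  have h2 : (1 - y) * V (s + tau)%N <= (1 - y) * W by rewrite ler_wpM2l // subr_ge0.
  have h3 : y * W = beta * (2 / 5) * Ms + beta * (K + G ^+ 2).
    rewrite /W mulrDr mulrA yg; congr (_ + _).
    have -> : y * ((K + G ^+ 2) * (gmax * (5 / 2))) = y * gmax * (5 / 2) * (K + G ^+ 2) by ring.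
    by rewrite yg; field.
  have h4 : 0 <= beta * Ms := mulr_ge0 (ltW be0) Ms0.
  have h5 : 0 <= beta * G ^+ 2 := mulr_ge0 (ltW be0) (sqr_ge0 G).
  move: h1 h2 h3 h4 h5; move: (G ^+ 2) (V _) (m s) => p q r.
  by lra.
have [nt|tn] := leqP n tau.
  apply: le_trans (small _ nt) _; rewrite lerDl divr_ge0 ?(ltW c0) //.
  exact: addr_ge0.
apply: (@le_trans _ _ (W / c)); last by rewrite lerDr.
rewrite ler_pdivlMr // mulrC; apply: le_trans (cV n) _.
by rewrite -(subnK (ltnW tn)).
Qed.

(** Small steps use the asymptotic bounds. For alpha > h a bound S on both moments suffices, since S
    <= (S / h^2) alpha^2 and S <= (S / h^4) alpha^4. *)
Lemma rr_coordinate_bound M : exists2 c : R, 0 <= c &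
  forall (dO : measure_display) (Omega : measurableType dO)
    (Pr : probability Omega R) (x : nat -> {RV Pr >-> X})
    (u v : Omega -> 'cV[R]_d) (alpha : R) (k0 n : nat),
  data_stream P M x u -> data_stream P M x v ->
  let tau := mixing_time P mu A b in
  let Z i w := 2 * avg_err A b theta_star x u alpha k0 n i w -
    avg_err A b theta_star x v (2 * alpha) k0 n i w in
  let tail := expR (- (alpha * k0%:R / (4 * gmax))) / (alpha * n%:R) in
  0 < alpha ->
  alpha * (tau alpha)%:R < (5 / 100) / (95 * gmax) ->
  2 * alpha * (tau (2 * alpha))%:R < (5 / 100) / (95 * gmax) ->
  4 * gmax / alpha * ln (1 / (alpha * (tau alpha)%:R)) <= k0%:R ->
  (tau alpha <= n)%N -> forall i,
  [/\ L2 Pr (Z i), `|Ex Pr (Z i)| <= c * (alpha ^+ 2 + tail) &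
      Ex Pr (fun w => Z i w ^+ 2) <= c * (alpha ^+ 4 + (tau alpha)%:R / n%:R)].
Proof.
have [G hG] := noise_bounded theta_star hA hb.
have [b0 [D [B [b00 D0 small]]]] := small_step_bound M.
have [C large] := apriori_bound M.
(* Large steps: 10 = 8 + 2 from [sqr_extrapolated_le], and the 1 from |Z| <= 1 + Z^2. *)
pose S : R := 10 * `|C| + 1.
have S0 : 0 <= S by rewrite addr_ge0 // mulr_ge0.
pose c1 : R := 72 * D ^+ 2 + 20 * D.
have c10 : 0 <= c1.
  by apply: addr_ge0; apply: mulr_ge0 => //; exact: sqr_ge0.
(* Half of b0, because 2 alpha must satisfy the small-step condition as well. *)
pose h := b0 / 2; have h0 : 0 < h by rewrite divr_gt0.
pose c2 : R := S / h ^+ 2 + S / h ^+ 4.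
have h2 : 0 < h ^+ 2 by rewrite exprn_gt0.
have h4 : 0 < h ^+ 4 by rewrite exprn_gt0.
have c20 : 0 <= c2 by rewrite addr_ge0 // divr_ge0 // ltW.
have D6 : 0 <= 6 * D := mulr_ge0 (ler0n R 6) D0.
exists (6 * D + c1 + c2); first exact: addr_ge0 (addr_ge0 D6 c10) c20.
move=> dO Omega Pr x u v alpha k0 n du dv tau Z tail a0 ht1 ht2 hk tn i.
have [hm mu_ hcu uL1 uM] := du; have [_ mv_ hcv vL1 vM] := dv.
pose Y1 := avg_err A b theta_star x u alpha k0 n i.
pose Y2 := avg_err A b theta_star x v (2 * alpha) k0 n i.
have L1Y : L2 Pr Y1 := L2_avg_err mA mb hA hG x mu_ uL1 alpha k0 n i.
have L2Y : L2 Pr Y2 := L2_avg_err mA mb hA hG x mv_ vL1 (2 * alpha) k0 n i.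
have tau1 : (1 <= tau alpha)%N := mixing_time_ge1 alpha.
have n1 : (0 < n)%N := leq_trans tau1 tn.
have n0 : 0 < n%:R :> R by rewrite ltr0n.
have gm0 : 0 < gmax by have := gmax_ge hGsym hGpos hgmax hGlyap hAbar; lra.
have L2Z' : L2 Pr (Z i).
  have := L2D (L2Z 2 L1Y) (L2Z (-1) L2Y).
  by under [X in L2 _ X -> _]eq_fun do rewrite mulN1r.
have tail0 : 0 <= tail by rewrite divr_ge0 ?expR_ge0 // mulr_ge0 // ltW.
have tn0 : 0 <= (tau alpha)%:R / n%:R :> R by rewrite divr_ge0 // ltW.
have a2 : 0 <= alpha ^+ 2 := sqr_ge0 _.
have a4 : 0 <= alpha ^+ 4 by rewrite exprn_ge0 // ltW.
have EZ : Ex Pr (Z i) = 2 * Ex Pr Y1 - Ex Pr Y2.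
  have i1 := L2_L1 L1Y; have i2 := L2_L1 L2Y.
  rewrite -mulN1r -!ExZ // -ExD; [|exact: L1Z|exact: L1Z].
  by congr Ex; apply/funext => w; rewrite mulN1r.
suff [bd1 bd2] : `|Ex Pr (Z i)| <= (6 * D + c2) * (alpha ^+ 2 + tail) /\
    Ex Pr (fun w => Z i w ^+ 2) <= (c1 + c2) * (alpha ^+ 4 + (tau alpha)%:R / n%:R).
  split=> //.
    apply: le_trans bd1 _; rewrite ler_wpM2r ?addr_ge0 //.
    by rewrite addrAC lerDl.
  apply: le_trans bd2 _; rewrite ler_wpM2r ?addr_ge0 //.
  by rewrite -[leRHS]addrA lerDr.
have [hsmall|hlarge] := leP alpha h.
  have ab0 : 2 * alpha <= b0 by move: hsmall; rewrite /h; lra.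
  have [m1 v1] := small _ _ _ x u alpha k0 n i du ltac:(by rewrite a0; lra) n1.
  have [m2 v2] := small _ _ _ x v (2 * alpha) k0 n i dv ltac:(by rewrite mulr_gt0) n1.
  rewrite -/Y1 -/tail in m1 v1; rewrite -/Y2 in m2 v2.
  have tail2 : expR (- (2 * alpha * k0%:R / (4 * gmax))) / (2 * alpha * n%:R) <= tail.
    rewrite /tail; apply: ler_pM; rewrite ?expR_ge0 ?invr_ge0 ?mulr_ge0 ?(ltW a0) ?(ltW n0) //.
      rewrite ler_expR lerN2 ler_pM2r ?invr_gt0 ?mulr_gt0 //.
      by rewrite -mulrA ler_peMl ?mulr_ge0 ?(ltW a0) // ler1n.
    rewrite lef_pV2 ?posrE ?mulr_gt0 //.
    by rewrite -mulrA ler_peMl ?mulr_ge0 ?(ltW a0) ?(ltW n0) // ler1n.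
  set t2 := expR _ / _ in m2 v2 tail2.
  have t20 : 0 <= t2 by rewrite divr_ge0 ?expR_ge0 ?mulr_ge0 ?(ltW a0) ?(ltW n0).
  have mZ : `|Ex Pr (Z i)| <= 6 * D * (alpha ^+ 2 + tail).
    (* The cancellation of the bias: 2 (alpha B_i) = (2 alpha) B_i. *)
    rewrite EZ [X in `|X|](_ : _ = 2 * (Ex Pr Y1 - alpha * B i 0) -
      (Ex Pr Y2 - 2 * alpha * B i 0)); last by ring.
    apply: le_trans (ler_normB _ _) _; rewrite normrM ger0_norm //.
    apply: extrapolated_mean_le D0 tail0 tail2 m1 _.
    by rewrite (_ : 4 * alpha ^+ 2 = (2 * alpha) ^+ 2) //; ring.
  split.
    by apply: le_trans mZ _; rewrite ler_wpM2r ?addr_ge0 // lerDl.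
  have vZ : Ex Pr (fun w => Z i w ^+ 2) <= Ex Pr (Z i) ^+ 2 +
      (8 * Ex Pr (fun w => (Y1 w - Ex Pr Y1) ^+ 2) +
       2 * Ex Pr (fun w => (Y2 w - Ex Pr Y2) ^+ 2)).
    have W1 : L2 Pr (fun w => Y1 w - Ex Pr Y1) := L2D L1Y (L2_cst Pr _).
    have W2 : L2 Pr (fun w => Y2 w - Ex Pr Y2) := L2D L2Y (L2_cst Pr _).
    have W3 : L2 Pr (fun w => Z i w - Ex Pr (Z i)) := L2D L2Z' (L2_cst Pr _).
    have iZ := L2_L1 L2Z'.
    have dec : Ex Pr (fun w => Z i w ^+ 2) = Ex Pr (Z i) ^+ 2 +
        Ex Pr (fun w => (Z i w - Ex Pr (Z i)) ^+ 2).
      pose c := Ex Pr (Z i).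
      have ic : L1 Pr (fun=> - c ^+ 2) := L2_L1 (L2_cst Pr _).
      have j1 := L1D (L1Z (2 * c) iZ) ic.
      have -> : (fun w => Z i w ^+ 2) = (fun w => (Z i w - c) ^+ 2 +
          (2 * c * Z i w + - c ^+ 2)) by apply/funext => w; ring.
      rewrite (ExD W3.2 j1) (ExD (L1Z (2 * c) iZ) ic) (ExZ _ iZ) Ex_cst -/c.
      by rewrite addrC; congr (_ + _); ring.
    rewrite dec lerD2l -(ExZ _ W1.2) -(ExZ _ W2.2) -(ExD (L1Z _ W1.2) (L1Z _ W2.2)).
    apply: le_Ex; [exact: W3.2|exact: L1D (L1Z _ W1.2) (L1Z _ W2.2)|].
    move=> w; rewrite EZ [Z i w](_ : _ = 2 * Y1 w - Y2 w) //.
    have -> : 2 * Y1 w - Y2 w - (2 * Ex Pr Y1 - Ex Pr Y2) =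
      2 * (Y1 w - Ex Pr Y1) - (Y2 w - Ex Pr Y2) by ring.
    exact: sqr_extrapolated_le.
  have lag := lag_tail_bound gm0 a0 tau1 tn hk.
  rewrite -/tail in lag.
  have t22 : t2 ^+ 2 <= tail ^+ 2 by rewrite ler_sqr ?nnegrE.
  have inv_n : n%:R^-1 <= (tau alpha)%:R / n%:R :> R.
    by rewrite ler_peMl ?invr_ge0 ?(ltW n0) // ler1n.
  apply: le_trans vZ _.
  have sqZ : Ex Pr (Z i) ^+ 2 <= 72 * D ^+ 2 * (alpha ^+ 4 + tail ^+ 2).
    rewrite -[Ex Pr (Z i) ^+ 2]real_normK ?num_real //.
    apply: (@le_trans _ _ ((6 * D * (alpha ^+ 2 + tail)) ^+ 2)).
      by rewrite ler_sqr ?nnegrE ?mulr_ge0 ?addr_ge0.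
    have -> : alpha ^+ 4 = alpha ^+ 2 ^+ 2 by rewrite -exprM.
    rewrite [leLHS](_ : _ = 36 * D ^+ 2 * (alpha ^+ 2 + tail) ^+ 2); last by ring.
    rewrite (_ : 72 * D ^+ 2 = 36 * D ^+ 2 * 2); last by ring.
    rewrite -[leRHS]mulrA; apply: ler_wpM2l; first exact: mulr_ge0 (ler0n R 36) (sqr_ge0 D).
    exact: sqrD_le.
  apply: (@le_trans _ _ (c1 * (alpha ^+ 4 + (tau alpha)%:R / n%:R))); last first.
    by rewrite ler_wpM2r ?addr_ge0 // lerDl.
  exact: extrapolated_square_le D0 (sqr_ge0 D) a4 inv_n lag t22 sqZ v1 v2.
have bY (w0 : Omega -> 'cV[R]_d) (beta : R) : data_stream P M x w0 -> 0 < beta ->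
    beta * (tau beta)%:R < (5 / 100) / (95 * gmax) ->
    Ex Pr (fun w => avg_err A b theta_star x w0 beta k0 n i w ^+ 2) <= `|C|.
  move=> dw be0 hbt; have [_ mw _ wL1 _] := dw.
  have iW := L2_avg_err mA mb hA hG x mw wL1 beta k0 n i.
  have ie j := L1_sqr_err mA mb hA hG x mw wL1 beta j.
  have iS : L1 Pr (fun w => \sum_(j < n) l2norm (err A b theta_star x w0 beta (k0 + j) w) ^+ 2).
    by apply: L1_sum => j.
  apply: (@le_trans _ _ (Ex Pr (fun w => n%:R^-1 *
      \sum_(j < n) l2norm (err A b theta_star x w0 beta (k0 + j) w) ^+ 2))).
    apply: le_Ex; [exact: iW.2|exact: L1Z|].
    move=> w; rewrite /avg_err exprMn expr2 -mulrA ler_wpM2l ?invr_ge0 ?(ltW n0) //.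
    rewrite mulrC ler_pdivrMr // mulrC.
    apply: le_trans (sqr_sum_le n (fun j => err A b theta_star x w0 beta (k0 + j) w i 0)) _.
    rewrite ler_wpM2l ?(ltW n0) //; apply: ler_sum => j _.
    rewrite sqr_l2norm (bigD1 i) //= lerDl sumr_ge0 // => l _.
    exact: sqr_ge0.
  rewrite ExZ // Ex_sum => [|j]; last exact: ie.
  rewrite mulrC ler_pdivrMr // mulr_natr -[X in _ *+ X]card_ord -sumr_const.
  apply: ler_sum => j _; apply: le_trans (ler_norm C).
  exact: large dw be0 hbt.
have sq : Ex Pr (fun w => Z i w ^+ 2) <= 10 * `|C|.
  have b1 := bY u alpha du a0 ht1.
  have b2 := bY v (2 * alpha) dv ltac:(by rewrite mulr_gt0) ht2.
  apply: (@le_trans _ _ (Ex Pr (fun w => 8 * Y1 w ^+ 2 + 2 * Y2 w ^+ 2))).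
    apply: le_Ex; [exact: L2Z'.2|exact: L1D (L1Z _ L1Y.2) (L1Z _ L2Y.2)|].
    by move=> w; exact: sqr_extrapolated_le.
  rewrite (ExD (L1Z _ L1Y.2) (L1Z _ L2Y.2)) (ExZ _ L1Y.2) (ExZ _ L2Y.2).
  rewrite (_ : 10 * `|C| = 8 * `|C| + 2 * `|C|); last by ring.
  by apply: lerD; rewrite ler_wpM2l.
have mean : `|Ex Pr (Z i)| <= S.
  have i1 : L1 Pr (fun w => 1 + Z i w ^+ 2).
    by apply: L1D L2Z'.2; exact: L2_L1 (L2_cst Pr 1).
  apply: (@le_trans _ _ (Ex Pr (fun w => 1 + Z i w ^+ 2))).
    apply: Ex_norm_le => //; first exact: L2_L1.
    by move=> w; exact: ler_abs1_sqr.
  rewrite ExD ?Ex_cst; [|exact: L2_L1 (L2_cst Pr 1)|exact: L2Z'.2].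
  by rewrite /S addrC lerD2r.
have ha2 : h ^+ 2 <= alpha ^+ 2 by rewrite lerXn2r ?nnegrE ?(ltW h0) ?(ltW a0) ?(ltW hlarge).
have ha4 : h ^+ 4 <= alpha ^+ 4 by rewrite lerXn2r ?nnegrE ?(ltW h0) ?(ltW a0) ?(ltW hlarge).
have S2 : S <= S / h ^+ 2 * alpha ^+ 2.
  by rewrite mulrAC ler_pdivlMr // ler_wpM2l.
have S4 : S <= S / h ^+ 4 * alpha ^+ 4.
  by rewrite mulrAC ler_pdivlMr // ler_wpM2l.
have q2 : 0 <= S / h ^+ 2 by rewrite divr_ge0 // ltW.
have q4 : 0 <= S / h ^+ 4 by rewrite divr_ge0 // ltW.
split.
  apply: le_trans mean _; apply: le_trans S2 _; apply: ler_pM => //.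
    by rewrite /c2 addrA addrAC lerDr; exact: addr_ge0.
  by rewrite lerDl.
apply: (@le_trans _ _ S); first by apply: le_trans sq _; rewrite lerDl.
apply: le_trans S4 _; apply: ler_pM => //.
  by rewrite /c2 addrA lerDr addr_ge0.
by rewrite lerDl.
Qed.

End uniform_constants.

(** * From coordinates to vectors and matrices *)

Lemma opnormZ_le (R : realType) (m n : nat) (a : R) (M : 'M[R]_(m, n)) :
  opnorm (a *: M) <= `|a| * opnorm M.
Proof.
apply: opnorm_le => [|v]; first by rewrite mulr_ge0 // opnorm_ge0.
by rewrite -scalemxAl l2normZ -mulrA ler_wpM2l // l2norm_opnorm.
Qed.

Lemma opnorm0 (R : realType) (m n : nat) : opnorm (0 : 'M[R]_(m, n)) = 0.
Proof.
apply/eqP; rewrite eq_le opnorm_ge0 andbT.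
by have := opnormZ_le 0 (0 : 'M[R]_(m, n)); rewrite scale0r normr0 mul0r.
Qed.

(** Homogeneity alone turns one bound by a sum into a sum of two error terms: h is cut in the
    proportions p and q. *)
Lemma norm_split (R : realType) (m n : nat) (N : 'M[R]_(m, n) -> R)
    (h : 'M[R]_(m, n)) (K p q : R) :
  (forall (a : R) (M : 'M[R]_(m, n)), N (a *: M) <= `|a| * N M) -> 0 < p -> 0 <= q ->
  N h <= K * (p + q) ->
  exists h1 h2, [/\ h = h1 + h2, N h1 <= K * p & N h2 <= K * q].
Proof.
move=> NZ p0 q0 hN; have pq : 0 < p + q by rewrite ltr_wpDr.
have part (r : R) : 0 <= r -> N ((r / (p + q)) *: h) <= K * r.
  move=> r0; apply: le_trans (NZ _ _) _.
  rewrite ger0_norm; last by rewrite divr_ge0 // ltW.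
  rewrite mulrAC ler_pdivrMr // -[leRHS]mulrA mulrCA.
  exact: ler_wpM2l.
exists ((p / (p + q)) *: h), ((q / (p + q)) *: h); split; last exact: part.
  by rewrite -scalerDl -mulrDl divff ?scale1r // gt_eqF.
by apply: part; exact: ltW.
Qed.

Theorem corollary4p7
    (R : realType) (dX : measure_display) (X : measurableType dX)
    (P : R.-pker X ~> X) (mu : probability X R)
    (d : nat) (A : X -> 'M[R]_d) (b : X -> 'cV[R]_d)
    (Gamma : 'M[R]_d) (gmax : R) (theta_star : 'cV[R]_d)
    (law1 law2 : probability (d.-tuple R) R)
    (hX : borel_space R X)
    (hstat : unique_stationary P mu)
    (herg : uniform_ergodicity P mu)
    (mA : measurable_mx A) (mb : measurable_mx b)
    (hA : (sup_norm (@opnorm R d d) A <= 1)%E)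
    (hb : (sup_norm (@l2norm R d) b < +oo)%E)
    (hH : hurwitz (mx_mean mu A))
    (hGsym : Gamma^T = Gamma) (hGpos : posdefmx Gamma)
    (hGlyap : (mx_mean mu A)^T *m Gamma + Gamma *m mx_mean mu A = - 1%:M)
    (hgmax : max_eigenvalue Gamma gmax)
    (hstar : mx_mean mu A *m theta_star + mx_mean mu b = 0)
    (hlaw1 : finite_second_moment law1) (hlaw2 : finite_second_moment law2) :
  exists c : R,
    forall (dO : measure_display) (Omega : measurableType dO)
      (Pr : probability Omega R) (x : nat -> {RV Pr >-> X})
      (u v : Omega -> 'cV[R]_d),
    markov_chain P x ->
    (forall B : set X, measurable B -> distribution Pr (x 0%N) B = mu B) ->
    admissible_init x law1 u ->
    admissible_init x law2 v ->
    forall (alpha : R) (k0 k : nat),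
    let tau := mixing_time P mu A b in
    let rr := rr_extrapolate A b (fun n => x n : Omega -> X) alpha u v k0 k in
    0 < alpha -> 2 * alpha < 1 ->
    alpha * (tau alpha)%:R < (5 / 100) / (95 * gmax) ->
    2 * alpha * (tau (2 * alpha))%:R < (5 / 100) / (95 * gmax) ->
    4 * gmax / alpha * ln (1 / (alpha * (tau alpha)%:R)) <= k0%:R ->
    (k0 + tau alpha <= k)%N ->
    (exists h1 h2 : 'cV[R]_d,
      [/\ mx_mean Pr rr - theta_star = h1 + h2,
          l2norm h1 <= c * alpha ^+ 2 &
          l2norm h2 <= c * (1 / (alpha * (k - k0)%N%:R)
                            * expR (- (alpha * k0%:R / (4 * gmax))))]) /\
    (exists h1 h2 h3 : 'M[R]_d,
      [/\ mx_mean Pr (fun w => (rr w - theta_star) *m (rr w - theta_star)^T)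
            = h1 + h2 + h3,
          opnorm h1 <= c * alpha ^+ 4,
          opnorm h2 <= c * ((tau alpha)%:R / (k - k0)%N%:R) &
          opnorm h3 <= c * (1 / (alpha * (k - k0)%N%:R ^+ 2)
                            * expR (- (alpha * k0%:R / (4 * gmax))))]).
Proof.
have [hs _] := hstat.
(* One M for both initial laws; the absolute values make the sum dominate each of them. *)
pose M := `|law_second_moment law1| + `|law_second_moment law2|.
have [c1 c10 main] := rr_coordinate_bound hs herg mA mb hA hb hGsym hGpos hGlyap
  hgmax hstar M.
(* d coordinates for the vector bound, d^2 entries for the matrix bound. *)
pose c := d%:R * c1 + (d * d)%:R * c1.
have hc1 : d%:R * c1 <= c by rewrite /c lerDl mulr_ge0.
have hc2 : (d * d)%:R * c1 <= c by rewrite /c lerDr mulr_ge0.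
exists c.
move=> dO Omega Pr x u v hm _ [mu_ lu cu] [mv_ lv cv] alpha k0 k tau rr.
move=> a0 _ ht1 ht2 hk hkk.
have du : data_stream P M x u.
  split=> //; first exact: L1_init mu_ lu hlaw1.
  by rewrite (Ex_init mu_ lu) (le_trans (ler_norm _)) // lerDl.
have dv : data_stream P M x v.
  split=> //; first exact: L1_init mv_ lv hlaw2.
  by rewrite (Ex_init mv_ lv) (le_trans (ler_norm _)) // lerDr.
have tau1 : (1 <= tau alpha)%N := mixing_time_ge1 P mu A b alpha.
have tn : (tau alpha <= k - k0)%N by rewrite leq_subRL // (leq_trans (leq_addr _ _) hkk).
have kk : (k0 < k)%N by rewrite -subn_gt0 (leq_trans tau1).
set n := (k - k0)%N in tn *.
have n0 : 0 < n%:R :> R by rewrite ltr0n (leq_trans tau1).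
pose Z i w := 2 * avg_err A b theta_star x u alpha k0 n i w -
  avg_err A b theta_star x v (2 * alpha) k0 n i w.
pose tail := expR (- (alpha * k0%:R / (4 * gmax))) / (alpha * n%:R).
have {}main : forall i, [/\ L2 Pr (Z i), `|Ex Pr (Z i)| <= c1 * (alpha ^+ 2 + tail) &
    Ex Pr (fun w => Z i w ^+ 2) <= c1 * (alpha ^+ 4 + (tau alpha)%:R / n%:R)].
  exact: main du dv a0 ht1 ht2 hk tn.
have tail0 : 0 <= tail by rewrite divr_ge0 ?expR_ge0 // mulr_ge0 // ltW.
have tailE : 1 / (alpha * n%:R) * expR (- (alpha * k0%:R / (4 * gmax))) = tail.
  by rewrite /tail div1r mulrC.
have rrE i w : (rr w - theta_star) i 0 = Z i w.
  rewrite /Z -!(lsa_avg_err A b theta_star) // /rr /rr_extrapolate.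
  by move: (lsa_avg _ _ _ _ _ _ _ _) (lsa_avg _ _ _ _ _ _ _ _) => p q; rewrite !mxE; ring.
have a2 : 0 < alpha ^+ 2 by rewrite exprn_gt0.
have a4 : 0 < alpha ^+ 4 by rewrite exprn_gt0.
have tn0 : 0 <= (tau alpha)%:R / n%:R :> R by rewrite divr_ge0 // ltW.
split.
  have bd : l2norm (mx_mean Pr rr - theta_star) <= d%:R * c1 * (alpha ^+ 2 + tail).
    rewrite -mulrA; apply: l2norm_le_bound => i.
    have [LZ hZ _] := main i.
    have -> : (mx_mean Pr rr - theta_star) i 0 = Ex Pr (Z i); last exact: hZ.
    rewrite mxE [X in X + _]mxE [X in _ + X]mxE.
    have -> : (fun w => rr w i 0) = (fun w => Z i w + theta_star i 0).
      apply/funext => w; rewrite -rrE; move: (rr w) => r.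
      by rewrite !mxE subrK.
    rewrite -/(Ex Pr _) (ExD (L2_L1 LZ) (L2_L1 (L2_cst Pr _))) Ex_cst.
    by rewrite addrK.
  have NZ (a : R) (r : 'cV[R]_d) : l2norm (a *: r) <= `|a| * l2norm r by rewrite l2normZ.
  have [h1 [h2 [e b1 b2]]] := norm_split NZ a2 tail0 bd.
  exists h1, h2; split=> //.
    by apply: le_trans b1 _; rewrite ler_wpM2r // ltW.
  by rewrite tailE; apply: le_trans b2 _; rewrite ler_wpM2r.
have bd : opnorm (mx_mean Pr (fun w => (rr w - theta_star) *m (rr w - theta_star)^T))
    <= (d * d)%:R * c1 * (alpha ^+ 4 + (tau alpha)%:R / n%:R).
  apply: le_trans (opnorm_le_entry_sum _) _.
  apply: (@le_trans _ _ (\sum_(i < d) \sum_(j < d)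
      (c1 * (alpha ^+ 4 + (tau alpha)%:R / n%:R)))).
    apply: ler_sum => i _; apply: ler_sum => j _.
    have [LZi _ hZi] := main i; have [LZj _ hZj] := main j.
    rewrite mxE -/(Ex Pr _).
    have -> : (fun w => ((rr w - theta_star) *m (rr w - theta_star)^T) i j) =
        (fun w => Z i w * Z j w).
      apply/funext => w; rewrite -!rrE; move: (rr w - theta_star) => r.
      by rewrite mxE big_ord1 [X in _ * X]mxE.
    (* Every entry, diagonal or not, is bounded by the second moments of two coordinates. *)
    have iS : L1 Pr (fun w => 2^-1 * (Z i w ^+ 2 + Z j w ^+ 2)).
      by apply: L1Z; exact: L1D LZi.2 LZj.2.
    apply: (@le_trans _ _ (Ex Pr (fun w => 2^-1 * (Z i w ^+ 2 + Z j w ^+ 2)))).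
      apply: Ex_norm_le => //; first exact: L2M.
      by move=> w; exact: ler_norm_young.
    rewrite (ExZ _ (L1D LZi.2 LZj.2)) (ExD LZi.2 LZj.2).
    rewrite mulrC ler_pdivrMr // mulr_natr mulr2n.
    exact: lerD.
  by rewrite !sumr_const !card_ord -mulrnA -[leLHS]mulr_natl mulrA.
have [h1 [h2 [e b1 b2]]] := norm_split (@opnormZ_le R d d) a4 tn0 bd.
exists h1, h2, 0; split.
- by rewrite addr0.
- by apply: le_trans b1 _; rewrite ler_wpM2r // ltW.
- by apply: le_trans b2 _; rewrite ler_wpM2r.
- rewrite opnorm0 mulr_ge0 //; last first.
    by rewrite mulr_ge0 ?expR_ge0 // divr_ge0 // mulr_ge0 ?exprn_ge0 // ltW.
  by apply: le_trans hc1; rewrite mulr_ge0.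
Qed.
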